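(* Let $n\ge 2$, let $\Omega\subset\mathbb{R}^n$ be a bounded open set, let $p>1$ and $q\in(p,n)$. Let $0\le h\in L^{q/p}(\Omega)$, and let $a_i:\Omega\times\mathbb{R}^n\to\mathbb{R}$, $i=1,\dots,n$, be Carathéodory functions for which there are constants $c_1>0$ and $\tilde\nu\in(0,+\infty)$ such that, for almost every $x\in\Omega$ and all $z,\tilde z\in\mathbb{R}^n$, $$|a_i(x,z)|\le c_1\Big(h(x)+\sum_{j=1}^n|z_j|^{p}\Big)^{1-1/p}\quad (i=1,\dots,n),$$ $$\tilde\nu\sum_{i=1}^n|z_i-\tilde z_i|^{p}\le\sum_{i=1}^n\big(a_i(x,z)-a_i(x,\tilde z)\big)(z_i-\tilde z_i).$$ Let $\theta\in W^{1,q}(\Omega)$, let $\psi:\Omega\to[-\infty,+\infty]$ be such that $\theta_*=\max\{\psi,\theta\}\in\theta+W_0^{1,q}(\Omega)$, and suppose $f^i\in L^{q/(p-1)}(\Omega)$ for $i=1,\dots,n$. Then every solution $u\in\mathcal{K}_{\psi,\theta}^{p}(\Omega)$ to the $\mathcal{K}_{\psi,\theta}^{p}$-obstacle problem (for the functions $a_i$ and $f^i$) satisfies $$u\in\theta_*+L^t_{weak}(\Omega),\qquad\text{where}\quad t=\frac{nq}{n-q}.$$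
   Context: $D_k v=\partial v/\partial x_k$ denotes the weak partial derivative and $Du=(D_1u,\dots,D_nu)$. For $r>1$, $W^{1,r}(\Omega)=\{v\in W^{1,1}(\Omega): D_kv\in L^{r}(\Omega)\text{ for every }k=1,\dots,n\}$ and $W_0^{1,r}(\Omega)=\{v\in W_0^{1,1}(\Omega): D_kv\in L^{r}(\Omega)\text{ for every }k=1,\dots,n\}$. For $t>0$, the weak Lebesgue (Marcinkiewicz) space $L^t_{weak}(\Omega)$ consists of all measurable functions $f$ on $\Omega$ for which there is a positive constant $k=k(f)$ with $|\{x\in\Omega:|f(x)|>\tau\}|\le k/\tau^t$ for every $\tau>0$, where $|E|$ is the $n$-dimensional Lebesgue measure of $E$. For $\psi:\Omega\to\mathbb{R}\cup\{\pm\infty\}$ (the obstacle) and $\theta\in W^{1,p}(\Omega)$ (the boundary datum), set $\mathcal{K}_{\psi,\theta}^{p}(\Omega)=\{v\in W^{1,p}(\Omega): v\ge\psi\text{ a.e. and }v\in\theta+W_0^{1,p}(\Omega)\}$. A solution to the $\mathcal{K}_{\psi,\theta}^{p}$-obstacle problem (for the equation $\sum_{i=1}^nD_i(a_i(x,Du(x)))=\sum_{i=1}^nD_if^i(x)$) is a function $u\in\mathcal{K}_{\psi,\theta}^{p}(\Omega)$ such that $$\int_\Omega\sum_{i=1}^na_i(x,Du(x))(D_iv(x)-D_iu(x))\,dx\ge\int_\Omega\sum_{i=1}^nf^i(x)(D_iv(x)-D_iu(x))\,dx$$ for every $v\in\mathcal{K}_{\psi,\theta}^{p}(\Omega)$.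 *)

(* Defs.v *)
From HB Require Import structures.
From mathcomp Require Import all_boot all_order all_algebra.
From mathcomp Require Import all_classical all_reals all_analysis.

Set Implicit Arguments.
Unset Strict Implicit.
Unset Printing Implicit Defensive.

Import Order.TTheory GRing.Theory Num.Theory.
Import numFieldNormedType.Exports.

Local Open Scope classical_set_scope.
Local Open Scope ring_scope.

Definition rV_display : measure_display -> measure_display.
Proof. exact. Qed.

(* The sigma-algebra on R^n generated by the coordinates, i.e. the Borel one. *)
Section borel_rV.
Variables (R : realType) (n : nat).

Definition rV_borel : set (set 'rV[R]_n) :=
  g_sigma_preimage (fun (i : 'I_n) (x : 'rV[R]_n) => (x ord0 i : R)).

Let rV_borel0 : rV_borel set0.
Proof. exact: sigma_algebra0. Qed.

Let rV_borelC A : rV_borel A -> rV_borel (~` A).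
Proof. exact: sigma_algebraC. Qed.

Let rV_borel_bigcup (F : (set 'rV[R]_n)^nat) :
  (forall i, rV_borel (F i)) -> rV_borel (\bigcup_i F i).
Proof. exact: sigma_algebra_bigcup. Qed.

HB.instance Definition _ := @isMeasurable.Build
  (rV_display default_measure_display) 'rV[R]_n
  rV_borel rV_borel0 rV_borelC rV_borel_bigcup.

End borel_rV.

Lemma measurable_coord (R : realType) n (i : 'I_n) :
  measurable_fun [set: 'rV[R]_n] (fun x : 'rV[R]_n => x ord0 i : R).
Proof.
move=> _ Y mY; apply: sub_sigma_algebra; rewrite -bigcup_seq/=.
by exists i => /=; [rewrite mem_index_enum|exists Y].
Qed.

Lemma measurable_fun_rV (R : realType) d (T : measurableType d) n
    (f : T -> 'rV[R]_n) :
  (forall i, measurable_fun [set: T] (fun x => f x ord0 i : R)) ->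
  measurable_fun [set: T] f.
Proof.
move=> mf; pose G := [set A | measurable (f @^-1` A)].
move=> _ A mA; rewrite setTI; suff : G A by [].
move: A mA; apply: smallest_sub.
  split; rewrite /G /=.
  - by rewrite preimage_set0; exact: measurable0.
  - by move=> A mA; rewrite setTD preimage_setC; exact: measurableC.
  - by move=> F mF; rewrite preimage_bigcup; exact: bigcup_measurable.
rewrite -bigcup_seq => B [i _] [Y mY] <-.
by rewrite /G /= setTI -comp_preimage -[_ @^-1` _]setTI; exact: mf.
Qed.

Section lebesgue_cons.
Variables (R : realType) (n : nat).

Definition rV_cons (tx : measurableTypeR R * 'rV[R]_n) : 'rV[R]_n.+1 :=
  \row_i (if unlift ord0 i is Some j then tx.2 ord0 j else tx.1).

Definition rV_uncons (x : 'rV[R]_n.+1) : measurableTypeR R * 'rV[R]_n :=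
  (x ord0 ord0, \row_i x ord0 (lift ord0 i)).

Lemma rV_consK : cancel rV_cons rV_uncons.
Proof.
move=> [t x]; rewrite /rV_uncons mxE unlift_none; congr pair.
by apply/rowP => i; rewrite !mxE liftK.
Qed.

Lemma measurable_rV_cons : measurable_fun setT rV_cons.
Proof.
apply: measurable_fun_rV => i; under eq_fun do rewrite mxE.
case: unliftP => [j|] _; last exact: measurable_fst.
exact: (measurableT_comp (measurable_coord j) measurable_snd).
Qed.

Lemma measurable_rV_uncons : measurable_fun setT rV_uncons.
Proof.
apply/measurable_fun_pairP; split; first exact: measurable_coord.
apply: measurable_fun_rV => i; rewrite /rV_uncons /=.
by under eq_fun do rewrite mxE; exact: measurable_coord.
Qed.

Variable mu : {sigma_finite_measure set 'rV[R]_n -> \bar R}.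

(* lebesgue_measure \x mu, transported to R^(n+1) *)
Definition lebesgue_cons : set 'rV[R]_n.+1 -> \bar R :=
  pushforward (lebesgue_measure \x mu)%E rV_cons.

Let lebesgue_cons0 : lebesgue_cons set0 = 0%E.
Proof. by rewrite /lebesgue_cons /pushforward preimage_set0 measure0. Qed.

Let lebesgue_cons_ge0 A : (0 <= lebesgue_cons A)%E.
Proof. by rewrite /lebesgue_cons /pushforward measure_ge0. Qed.

Let lebesgue_cons_sigma_additive : semi_sigma_additive lebesgue_cons.
Proof.
have mcons A : measurable A -> measurable (rV_cons @^-1` A).
  by move=> mA; rewrite -[X in measurable X]setTI; exact: measurable_rV_cons.
move=> F mF tF mUF; rewrite /lebesgue_cons /pushforward preimage_bigcup.
apply: measure_semi_sigma_additive => [i||].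
- exact: mcons.
- apply/trivIsetP => i j _ _ ij; rewrite -preimage_setI.
  by move/trivIsetP : tF => ->//; rewrite preimage_set0.
- by rewrite -preimage_bigcup; exact: mcons.
Qed.

HB.instance Definition _ := isMeasure.Build _ _ _ lebesgue_cons
  lebesgue_cons0 lebesgue_cons_ge0 lebesgue_cons_sigma_additive.

Let lebesgue_cons_sigma_finite : sigma_finite setT lebesgue_cons.
Proof.
have /sigma_finiteP[F [TF ndF Foo]] := sigma_finiteT (@lebesgue_measure R).
have /sigma_finiteP[G [TG ndG Goo]] := sigma_finiteT mu.
exists (fun i => rV_uncons @^-1` (F i `*` G i)).
  rewrite -preimage_bigcup (_ : \bigcup_i _ = setT) ?preimage_setT//.
  rewrite -subTset => -[x y] _.
  have [i _ Fix] : (\bigcup_i F i) x by rewrite -TF.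
  have [j _ Gjy] : (\bigcup_i G i) y by rewrite -TG.
  exists (maxn i j) => //; split => /=.
  - by move: x Fix; exact/subsetPset/ndF/leq_maxl.
  - by move: y Gjy; exact/subsetPset/ndG/leq_maxr.
move=> i; have [mF Fi] := Foo i; have [mG Gi] := Goo i; split.
  rewrite -[X in measurable X]setTI; apply: measurable_rV_uncons => //.
  exact: measurableX.
rewrite /lebesgue_cons /pushforward -comp_preimage.
rewrite (_ : rV_uncons \o rV_cons = id); last exact/funext/rV_consK.
by rewrite preimage_id product_measure1E// lte_mul_pinfty// ge0_fin_numE.
Qed.

HB.instance Definition _ := Measure_isSigmaFinite.Build _ _ _
  lebesgue_cons lebesgue_cons_sigma_finite.

End lebesgue_cons.

(* Lebesgue measure on the Borel sets of R^n, as an iterated product. *)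
Fixpoint borel_lebesgue (R : realType) (n : nat) :
    {sigma_finite_measure set 'rV[R]_n -> \bar R} :=
  if n is m.+1 then lebesgue_cons (borel_lebesgue R m)
  else dirac (0 : 'rV[R]_0).

Lemma borel_lebesgue_box (R : realType) n (A : 'I_n -> set R) :
  (forall i, measurable (A i)) ->
  borel_lebesgue R n [set x | forall i, A i (x ord0 i)] =
  (\prod_(i < n) lebesgue_measure (A i))%E.
Proof.
elim: n A => [|n IHn] A mA.
  by rewrite /= diracE big_ord0 mem_set// => -[].
have mbox : measurable
    [set x : 'rV[R]_n | forall i, A (lift ord0 i) (x ord0 i)].
  rewrite (_ : mkset _ = \bigcap_(i in [set: 'I_n])
      ((fun x : 'rV[R]_n => x ord0 i : R) @^-1` A (lift ord0 i))); last first.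
    by apply/seteqP; split=> x /= => [+ i _|+ i]; [exact|move/(_ i I)].
  apply: fin_bigcap_measurable => // i _.
  by rewrite -[X in measurable X]setTI; exact: measurable_coord.
rewrite big_ord_recl -IHn// -product_measure1E//=; last exact: mA.
rewrite /lebesgue_cons /pushforward; congr (_ _ _).
apply/seteqP; split=> -[t x] /=.
  move=> Atx; split=> [|i].
    by have := Atx ord0; rewrite mxE unlift_none.
  by have := Atx (lift ord0 i); rewrite mxE liftK.
by move=> [At Ax] i; rewrite mxE; case: unliftP => [j|] ->.
Qed.

(* R^n with the sigma-algebra of Lebesgue measurable sets, i.e. the completion
   of the Borel one. *)
Notation rV_lebesgue R n := (caratheodory_type (borel_lebesgue R n)^*%mu).

Definition lebesgue_rV (R : realType) n : set (rV_lebesgue R n) -> \bar R :=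
  @completed_measure_extension _ _ R (borel_lebesgue R n).
Arguments lebesgue_rV : clear implicits.

HB.instance Definition _ (R : realType) n := Measure.on (lebesgue_rV R n).

(* A function on an open set O is represented by a total function whose values
   outside O are irrelevant. *)
Section sobolev.
Variables (R : realType) (n : nat).
Notation mu := (lebesgue_rV R n).
Implicit Types (O : set 'rV[R]_n) (v phi : 'rV[R]_n -> R) (k : 'I_n) (r : R).

Definition ebase k : 'rV[R]_n := delta_mx ord0 k.

Definition partial k phi : 'rV[R]_n -> R := fun x => 'D_(ebase k) phi x.

Definition smooth phi := forall s : seq 'I_n,
  continuous (foldr partial phi s) /\
  forall k x, derivable (foldr partial phi s) x (ebase k).

Definition test_fun O : set ('rV[R]_n -> R) :=
  [set phi | [/\ smooth phi, compact (closure [set x | phi x != 0]) &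
    closure [set x | phi x != 0] `<=` O]].

Definition Lp O r : set ('rV[R]_n -> R) :=
  [set v | v \_ O \in Lfun mu r%:E].

Definition L1loc O : set ('rV[R]_n -> R) :=
  [set v | forall K, compact K -> K `<=` O -> mu.-integrable K (EFin \o v)].

Definition weak_derivative O k v : set ('rV[R]_n -> R) :=
  [set g | [/\ L1loc O v, L1loc O g & forall phi, test_fun O phi ->
    \int[mu]_(x in O) (v x * partial k phi x) =
    - \int[mu]_(x in O) (g x * phi x)]].

(* The weak derivative D_k v, defined up to a.e. equality: an arbitrary
   representative is chosen. *)
Definition wD O k v : 'rV[R]_n -> R := xget (cst 0) (weak_derivative O k v).

Definition W11 O : set ('rV[R]_n -> R) :=
  [set v | Lp O 1 v /\
    forall k, weak_derivative O k v !=set0 /\ Lp O 1 (wD O k v)].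

Definition W1 O r : set ('rV[R]_n -> R) :=
  [set v | W11 O v /\ forall k, Lp O r (wD O k v)].

Definition W11_norm O v : \bar R :=
  ('N[mu]_1 [EFin \o (v \_ O)] +
   \sum_(k < n) 'N[mu]_1 [EFin \o (wD O k v \_ O)])%E.

(* The closure of the test functions in W^{1,1}(O). *)
Definition W011 O : set ('rV[R]_n -> R) :=
  [set v | W11 O v /\ forall e : R, 0 < e ->
    exists2 phi, test_fun O phi & (W11_norm O (v \- phi)%R < e%:E)%E].

Definition W01 O r : set ('rV[R]_n -> R) :=
  [set v | W011 O v /\ forall k, Lp O r (wD O k v)].

Definition Lweak O (t : R) : set ('rV[R]_n -> R) :=
  [set v : _ -> R | measurable_fun (O : set (rV_lebesgue R n)) v /\
    exists2 c : R, 0 < c & forall tau : R, 0 < tau ->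
      (mu [set x | O x /\ (tau < `|v x|)%R] <= (c / tau `^ t)%:E)%E].

(* b + V as a set of functions on O, modulo a.e. equality. *)
Definition translate O (b : 'rV[R]_n -> \bar R) (V : set ('rV[R]_n -> R)) :
    set ('rV[R]_n -> \bar R) :=
  [set f | exists2 w, V w &
    \forall x \ae mu, O x -> f x = (b x + (w x)%:E)%E].

Definition caratheodory_fun O (a : 'rV[R]_n -> 'rV[R]_n -> R) :=
  (forall z, measurable_fun (O : set (rV_lebesgue R n)) (a ^~ z)) /\
  (\forall x \ae mu, O x -> continuous (a x)).

Definition theta_star (psi : 'rV[R]_n -> \bar R) (theta : 'rV[R]_n -> R) :
    'rV[R]_n -> \bar R := fun x => maxe (psi x) (theta x)%:E.

Definition obstacle_class O r (psi : 'rV[R]_n -> \bar R)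
    (theta : 'rV[R]_n -> R) : set ('rV[R]_n -> R) :=
  [set v | [/\ W1 O r v, \forall x \ae mu, O x -> (psi x <= (v x)%:E)%E &
    translate O (EFin \o theta) (W01 O r) (EFin \o v)]].

Definition obstacle_solution O r psi theta
    (a : 'I_n -> 'rV[R]_n -> 'rV[R]_n -> R) (f : 'I_n -> 'rV[R]_n -> R) :
    set ('rV[R]_n -> R) :=
  [set u | obstacle_class O r psi theta u /\
    forall v, obstacle_class O r psi theta v ->
    \int[mu]_(x in O) (\sum_(i < n)
      a i x (\row_j wD O j u x) * (wD O i v x - wD O i u x)) >=
    \int[mu]_(x in O) (\sum_(i < n) f i x * (wD O i v x - wD O i u x))].

End sobolev.

(* Main.v *)
Require Import Defs.
From mathcomp Require Import all_boot all_order all_algebra.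
From mathcomp Require Import all_classical all_reals all_analysis.
From mathcomp Require Import measurable_realfun lra.

Set Implicit Arguments.
Unset Strict Implicit.
Unset Printing Implicit Defensive.

Import Order.TTheory GRing.Theory Num.Theory.
Import numFieldNormedType.Exports.

Local Open Scope classical_set_scope.
Local Open Scope ring_scope.

(** Put Theta = max(psi, theta). Both u and Theta differ from theta by an
element of W_0^{1,1}, so that g = u - Theta belongs to W_0^{1,1}; the claim is
that lam(s) = |{|g| > s}| is O(s^-t).

The variational inequality is tested with a truncation of g. If H is smooth,
nondecreasing, 1-Lipschitz and vanishes at 0, then Theta + H(g) is at least
min(Theta, u), hence at least psi, and it has the right boundary values: it is
admissible ([competitor]). Its gradient differs from that of u by
-(1 - H'(g)) Dg, so that the inequality compares two integrals with the weight
om = 1 - H'(g) ([truncated_inequality]). When H is close to the truncation at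
level 2s, om is small where |g| <= s. Monotonicity, growth and Young's
inequality bound the integral of om |Dg|^p by a multiple of that of om Z, where
Z = |h| + |D Theta|^p + |f|^(p/(p-1)) belongs to L^(q/p). Interpolating once
for Z and once for Dg, one gets

  int om |Dg| <= C m^(1 - 1/q)   as soon as   int om <= m,

with C independent of H ([obstacle_energy_estimate]).

On the other hand g - H(g) belongs to W_0^{1,1}, with gradient om Dg
([w011_chain]), and |g - H(g)| >= |g| - 2s. The Sobolev inequality for level
sets in W_0^{1,1} ([w011_sobolev]) turns the estimate above into

  lam(4s)^(n-1) <= (K m^(1 - 1/q) / s)^n   for every m > lam(s).

The exponent t = nq/(n-q) is the one for which a bound lam(s) <= B s^-t
reproduces itself under this step, and iteration gives the theorem
([stampacchia], [weak_decay]).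

Two points make the argument elementary. The Sobolev inequality is only needed
for level sets, where it follows from a weighted Loomis-Whitney inequality
([loomis_whitney]): through each point of {|phi| >= tau}, the integral of
|D_i phi| / tau over the line in direction i is at least 1. And H is half the
difference of two translates of sqrt(s^2 + e^2), so that composition with H
maps test functions to test functions, and the chain rule in W_0^{1,1} is a
matter of approximation. Representatives of weak derivatives are compared by
the fundamental lemma of the calculus of variations ([L1loc_ae_eq0]). *)

(** * Lebesgue measurable sets and functions on R^n *)

Section lebesgue_basics.
Variables (R : realType) (n : nat).
Notation mu := (lebesgue_rV R n).
Notation LT := (rV_lebesgue R n).

Lemma borel_lebesgue_measurable (A : set 'rV[R]_n) :
  measurable A -> measurable (A : set LT).
Proof. exact: caratheodory_measurable_mu_ext. Qed.

Lemma lebesgue_rVE (A : set 'rV[R]_n) :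
  measurable A -> mu A = borel_lebesgue R n A.
Proof. by move=> mA; exact: measurable_mu_extE. Qed.

Lemma lebesgue_rV_complete : measure_is_complete mu.
Proof. exact: measure_is_complete_caratheodory. Qed.

(** Lets the filter lemmas apply to properties that hold almost everywhere for
the completed measure. *)
#[export] Instance lebesgue_rV_ae_filter : Filter (nbhs (almost_everywhere mu)).
Proof. exact: ae_filter_ringOfSetsType. Qed.

Lemma rV_ballP (x y : 'rV[R]_n) (e : R) : 0 < e ->
  ball x e y <-> forall i, `|x ord0 i - y ord0 i| < e.
Proof.
move=> e0; split => [[_ xy] i|xy]; first exact: xy.
by split=> // i j; rewrite !ord1; exact: xy.
Qed.

Lemma measurable_rV_ball (x : 'rV[R]_n) (e : R) : 0 < e -> measurable (ball x e).
Proof.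
move=> e0; rewrite [ball x e](_ : _ = \bigcap_(i in [set: 'I_n])
      ((fun y : 'rV[R]_n => y ord0 i : R) @^-1` ball (x ord0 i) e)); last first.
  apply/seteqP; split => y /= => [/(rV_ballP _ _ e0) xy i _ /=|xy]; first exact: xy.
  by apply/rV_ballP => // i; exact: xy.
apply: fin_bigcap_measurable => // i _.
rewrite -[X in measurable X]setTI; apply: measurable_coord => //.
by rewrite ball_itv.
Qed.

(** The closed balls stay inside A as well: they are compact boxes, which can
carry the support of a test function. *)
Lemma open_countable_ball_cover (A : set 'rV[R]_n) : open A ->
  exists (D : set nat) (c : nat -> 'rV[R]_n) (r : nat -> R),
    [/\ forall k, 0 < r k, A = \bigcup_(k in D) ball (c k) (r k) &
     forall k, D k -> forall y : 'rV[R]_n, (forall i, `|c k ord0 i - y ord0 i| <= r k) -> A y].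
Proof.
move=> oA.
pose cr (k : nat) : 'rV[rat]_n * nat := odflt (0, 0%N) (unpickle k).
pose c k : 'rV[R]_n := map_mx ratr (cr k).1.
pose r k : R := (cr k).2.+1%:R^-1.
have r0 k : 0 < r k by rewrite invr_gt0.
pose D := [set k | forall y : 'rV[R]_n, (forall i, `|c k ord0 i - y ord0 i| <= r k) -> A y].
exists D, c, r; split => //.
apply/seteqP; split => [x Ax|x [k Dk xk]]; last first.
  by apply: Dk => i; apply/ltW; move/rV_ballP : xk; apply.
have /nbhs_ballP[e /= e0 xeA] := oA _ Ax.
have [m _ /(_ _ (leqnn _)) me] := near_infty_natSinv_lt (PosNum (divr_gt0 e0 (ltr0n R 2))).
have q i : {q : rat | `|ratr q - x ord0 i| < m.+1%:R^-1}.
  apply: cid; have : x ord0 i - m.+1%:R^-1 < x ord0 i + m.+1%:R^-1.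
    by rewrite ltrD2l -subr_gt0 opprK addr_gt0 // invr_gt0.
  move=> /rat_in_itvoo[q]; rewrite in_itv/= => qx; exists q.
  by rewrite ltr_distl.
pose k := pickle ((\row_i projT1 (q i) : 'rV[rat]_n), m).
have crk : cr k = ((\row_i projT1 (q i)), m) by rewrite /cr /k pickleK.
have ck i : `|c k ord0 i - x ord0 i| < m.+1%:R^-1.
  by rewrite /c crk !mxE; case: (q i).
have rk : r k = m.+1%:R^-1 by rewrite /r crk.
exists k; last by apply/rV_ballP => // i; rewrite rk.
move=> y /= cy; apply: xeA; apply/rV_ballP => // i.
rewrite (le_lt_trans (ler_distD (c k ord0 i) _ _))// (splitr e).
rewrite ltrD//; last by rewrite (le_lt_trans (cy i)) // rk.
by rewrite distrC (lt_trans (ck i)).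
Qed.

Lemma open_borel (A : set 'rV[R]_n) : open A -> measurable A.
Proof.
move=> /open_countable_ball_cover[D [c [r [r0 -> _]]]].
by apply: bigcup_measurable => k _; exact: measurable_rV_ball.
Qed.

Lemma continuous_borel (f : 'rV[R]_n -> R) :
  continuous f -> measurable_fun [set: 'rV[R]_n] f.
Proof.
move=> cf; apply: (measurability _ (RGenOpens.measurableE R)).
move=> _ [_ [a [b ->] <-]]; rewrite setTI; apply: open_borel.
by apply: open_comp => //; exact: interval_open.
Qed.

Lemma measurable_fun_lebesgue d (T : measurableType d) (f : 'rV[R]_n -> T)
  (D : set LT) :
  measurable_fun [set: 'rV[R]_n] f -> measurable_fun D f.
Proof.
move=> mf mD Y mY; apply: measurableI => //; apply: borel_lebesgue_measurable.
by rewrite -[X in measurable X]setTI; exact: mf.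
Qed.

Lemma bounded_lebesgue_lty (A : set 'rV[R]_n) :
  measurable (A : set LT) -> bounded_set A -> (mu A < +oo)%E.
Proof.
move=> mA [M [Mreal bA]].
pose M1 : R := `|M| + 1.
have M10 : 0 < M1 by rewrite ltr_wpDl.
have mB := measurable_rV_ball (0 : 'rV[R]_n) (addr_gt0 M10 M10).
apply: (@le_lt_trans _ _ (mu (ball (0 : 'rV[R]_n) (M1 + M1)))).
  apply: le_measure; rewrite ?inE//; first exact: borel_lebesgue_measurable.
  move=> x Ax; rewrite mx_norm_ball /ball_ /= sub0r normrN.
  apply: (@le_lt_trans _ _ M1); last by rewrite ltrDl.
  by apply: bA => //; rewrite /M1 (le_lt_trans (ler_norm _))// ltrDl.
rewrite lebesgue_rVE//.
rewrite [ball _ _](_ : _ = [set x : 'rV[R]_n | forall i, ball (0:R) (M1 + M1) (x ord0 i)]).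
  rewrite (borel_lebesgue_box (A := fun=> ball (0:R) (M1 + M1))); last by move=> i; rewrite ball_itv.
  rewrite -ge0_fin_numE; last by apply: prode_ge0 => i _; exact: measure_ge0.
  apply: prode_fin_num => i _; rewrite lebesgue_measure_ball//.
  exact/ltW/addr_gt0.
apply/seteqP; split => [x /rV_ballP /= + i|x /= xi].
  by move=> /(_ (addr_gt0 M10 M10) i); rewrite mxE.
by apply/(rV_ballP _ _ (addr_gt0 M10 M10)) => i; rewrite mxE; exact: xi.
Qed.

(** A countable cover by Borel sets has measure within 1/k of that of E, and the
intersection over k works. This reduces a question on measurable sets to
Borel sets, where generating families are at hand. *)
Lemma lebesgue_borel_cover (E : set LT) : measurable E -> (mu E < +oo)%E ->
  exists B : set 'rV[R]_n, [/\ measurable B, E `<=` B & mu (B `\` E) = 0%E].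
Proof.
move=> mE Eoo.
have Efin : mu E \is a fin_num by rewrite ge0_fin_numE.
have H (k : nat) : exists B : set 'rV[R]_n, [/\ measurable B, E `<=` B &
   (mu B <= mu E + (k.+1%:R^-1)%:E)%E].
  have k0 : 0 < k.+1%:R^-1 :> R by rewrite invr_gt0.
  have [x [F [mF EF] <-{x} Fe]] := @lb_ereal_inf_adherent R
    [set (\sum_(k <oo) borel_lebesgue R n (A k))%E | A in @measurable_cover _ 'rV[R]_n E] _ k0 Efin.
  exists (\bigcup_k F k); split => //; first exact: bigcup_measurable.
  apply: le_trans (ltW Fe).
  have mU : measurable (\bigcup_k F k) by exact: bigcup_measurable.
  rewrite lebesgue_rVE//.
  exact: measure_sigma_subadditive.
have {}H k := cid (H k).
pose B := \bigcap_k projT1 (H k).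
have mB : measurable B by apply: bigcapT_measurable => k; case: (H k) => ? [].
have EB : E `<=` B by move=> x Ex k _; have [_ Bx _] := projT2 (H k); exact: Bx.
exists B; split => //.
have mB' := borel_lebesgue_measurable mB.
rewrite measureD//.
  rewrite setIidr//.
  apply/eqP; rewrite eq_le; apply/andP; split; last first.
    rewrite sube_ge0 ?Efin//. apply: le_measure; rewrite ?inE//.
  rewrite leeBlDr//. rewrite add0e.
  apply/lee_addgt0Pr => e e0.
  have [m _ /(_ _ (leqnn _)) me] := near_infty_natSinv_lt (PosNum e0).
  apply: (@le_trans _ _ (mu E + (m.+1%:R^-1)%:E)%E); last by rewrite leeD2l// lee_fin ltW.
  have [mBm _ +] := projT2 (H m); apply: le_trans.
  apply: le_measure; rewrite ?inE//; first exact: borel_lebesgue_measurable.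
  by move=> x; apply.
have [mB0 _ +] := projT2 (H 0); move=> H0.
apply: (@le_lt_trans _ _ (mu E + (1%:R^-1)%:E)%E); last by rewrite lte_add_pinfty ?ltry.
apply: le_trans H0; apply: le_measure; rewrite ?inE//; first exact: borel_lebesgue_measurable.
by move=> x; apply.
Qed.

Let mid : measurable_fun [set: LT] (id : LT -> 'rV[R]_n).
Proof. exact: measurable_fun_lebesgue. Qed.

(** Passes from the completion to the iterated product measure, to which
Tonelli's theorem applies. *)
Lemma ge0_integral_borel (f : 'rV[R]_n -> \bar R) :
  measurable_fun [set: 'rV[R]_n] f -> (forall x, (0 <= f x)%E) ->
  (\int[mu]_x f x = \int[borel_lebesgue R n]_x f x)%E.
Proof.
move=> mf f0.
have := @ge0_integral_pushforward _ _ LT 'rV[R]_n R id mid mu setT f measurableT mf (fun x _ => f0 x).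
rewrite preimage_setT => <-.
apply: eq_measure_integral => A mA _; exact: lebesgue_rVE.
Qed.

End lebesgue_basics.

(** * Iterated integrals and the Loomis-Whitney inequality *)

Definition rV_upd (R : realType) n (x : 'rV[R]_n) (i : 'I_n) (s : R) : 'rV[R]_n :=
  \row_j (if j == i then s else x ord0 j).

Section slices.
Variables (R : realType).
Local Notation bl := (borel_lebesgue R).

Lemma rV_updE n (x : 'rV[R]_n) i s :
  rV_upd x i s = (s - x ord0 i) *: ebase R i + x.
Proof.
apply/rowP => j; rewrite !mxE eqxx /=; case: eqVneq => [->|_].
  by rewrite mulr1 subrK.
by rewrite mulr0 add0r.
Qed.

Lemma rV_upd_id n (x : 'rV[R]_n) i : rV_upd x i (x ord0 i) = x.
Proof. by rewrite rV_updE subrr scale0r add0r. Qed.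

Lemma rV_upd_shift n (x : 'rV[R]_n) i s h :
  rV_upd x i (h + s) = h *: ebase R i + rV_upd x i s.
Proof. by rewrite !rV_updE addrA -scalerDl addrA. Qed.

Lemma rV_upd_cons0 n (t : R) (x : 'rV[R]_n) s :
  rV_upd (rV_cons (t, x)) ord0 s = rV_cons (s, x).
Proof.
apply/rowP => j; rewrite !mxE; case: unliftP => [k ->|->] /=.
  by [].
by [].
Qed.

Lemma rV_upd_cons n (t : R) (x : 'rV[R]_n) i s :
  rV_upd (rV_cons (t, x)) (lift ord0 i) s = rV_cons (t, rV_upd x i s).
Proof.
apply/rowP => j; rewrite !mxE; case: unliftP => [k ->|->] /=.
  by rewrite (inj_eq lift_inj) !mxE.
by [].
Qed.

Lemma measurable_rV_upd n (x : 'rV[R]_n) i :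
  measurable_fun [set: R] (rV_upd x i).
Proof.
apply: measurable_fun_rV => j; under eq_fun do rewrite mxE.
case: (j == i); [exact: measurable_id|exact: measurable_cst].
Qed.

Lemma measurable_rV_consl n (t : R) :
  measurable_fun [set: 'rV[R]_n] (fun x => rV_cons (t, x)).
Proof.
apply: measurable_fun_rV => j; under eq_fun do rewrite mxE /=.
by case: unliftP => [k _|_]; [exact: measurable_coord|exact: measurable_cst].
Qed.

Lemma integral_rV_cons n (f : 'rV[R]_n.+1 -> \bar R) :
  measurable_fun [set: 'rV[R]_n.+1] f -> (forall x, (0 <= f x)%E) ->
  (\int[bl n.+1]_x f x =
   \int[(lebesgue_measure \x bl n)%E]_z f (rV_cons z))%E.
Proof.
move=> mf f0.
have := @ge0_integral_pushforward _ _ _ _ R (@rV_cons R n)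
  (@measurable_rV_cons R n) (lebesgue_measure \x bl n)%E setT f measurableT mf (fun x _ => f0 x).
by rewrite preimage_setT.
Qed.

Lemma integral_rV_cons12 n (f : 'rV[R]_n.+1 -> \bar R) :
  measurable_fun [set: 'rV[R]_n.+1] f -> (forall x, (0 <= f x)%E) ->
  (\int[bl n.+1]_x f x =
   \int[lebesgue_measure]_t \int[bl n]_x f (rV_cons (t, x)))%E.
Proof.
move=> mf f0; rewrite integral_rV_cons//.
rewrite (@fubini_tonelli1 _ _ _ _ _ _ _ (f \o @rV_cons R n))//=.
exact: measurableT_comp mf (@measurable_rV_cons R n).
Qed.

Lemma integral_rV_cons21 n (f : 'rV[R]_n.+1 -> \bar R) :
  measurable_fun [set: 'rV[R]_n.+1] f -> (forall x, (0 <= f x)%E) ->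
  (\int[bl n.+1]_x f x =
   \int[bl n]_x \int[lebesgue_measure]_t f (rV_cons (t, x)))%E.
Proof.
move=> mf f0; rewrite integral_rV_cons//.
rewrite (@fubini_tonelli2 _ _ _ _ _ _ _ (f \o @rV_cons R n))//=.
exact: measurableT_comp mf (@measurable_rV_cons R n).
Qed.

Lemma measurable_slice_integral n (f : 'rV[R]_n.+1 -> \bar R) :
  measurable_fun [set: 'rV[R]_n.+1] f -> (forall x, (0 <= f x)%E) ->
  measurable_fun [set: R] (fun t => \int[bl n]_x f (rV_cons (t, x)))%E.
Proof.
move=> mf f0.
apply: (@measurable_fun_fubini_tonelli_F _ _ _ _ _ (bl n) (f \o @rV_cons R n)) => [|z]; last exact: f0.
exact: measurableT_comp mf (@measurable_rV_cons R n).
Qed.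

(** By Tonelli's theorem the k-th variable may be integrated first; induction on
the dimension peels off the variables that precede it. *)
Lemma eq_integral_lines n (k : 'I_n) (F G : 'rV[R]_n -> \bar R) :
  measurable_fun [set: 'rV[R]_n] F -> (forall x, (0 <= F x)%E) ->
  measurable_fun [set: 'rV[R]_n] G -> (forall x, (0 <= G x)%E) ->
  (forall x, \int[lebesgue_measure]_s F (rV_upd x k s) =
             \int[lebesgue_measure]_s G (rV_upd x k s))%E ->
  (\int[bl n]_x F x = \int[bl n]_x G x)%E.
Proof.
elim: n k F G => [[]//|n IH] k F G mF F0 mG G0 FG.
case: (unliftP ord0 k) => [j kj|k0].
  rewrite integral_rV_cons12// integral_rV_cons12//.
  apply: eq_integral => t _; apply: (IH j) => //.
  - exact: measurableT_comp mF (measurable_rV_consl _).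
  - exact: measurableT_comp mG (measurable_rV_consl _).
  - move=> x; have := FG (rV_cons (t, x)); rewrite kj.
    by under eq_integral do rewrite rV_upd_cons;
       under [RHS]eq_integral do rewrite rV_upd_cons.
rewrite integral_rV_cons21// integral_rV_cons21//.
apply: eq_integral => x _; have := FG (rV_cons (0, x)); rewrite k0.
by under eq_integral do rewrite rV_upd_cons0;
   under [RHS]eq_integral do rewrite rV_upd_cons0.
Qed.

Lemma prod_le_mean_pow n (E : 'I_n.+1 -> R) : (forall i, 0 <= E i) ->
  \prod_i E i <= ((\sum_i E i) / n.+1%:R) ^+ n.+1.
Proof.
move=> E0; have := leif_AGM (A := predT) (E := E) (fun i _ => E0 i).
by rewrite /= card_ord => -[].
Qed.

Lemma measurable_slice_sections n (A : set 'rV[R]_n.+1) (t : R) :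
  measurable A -> measurable [set x : 'rV[R]_n | A (rV_cons (t, x))].
Proof.
move=> mA; rewrite -[X in measurable X]setTI.
exact: (measurable_rV_consl t).
Qed.

Lemma integral_indic_setT d (T : measurableType d) (m : {measure set T -> \bar R})
  (A : set T) : measurable A -> (\int[m]_x (\1_A x)%:E = m A)%E.
Proof. by move=> mA; rewrite integral_indic// setIT. Qed.

Lemma integral_slice_indic n (A : set 'rV[R]_n.+1) : measurable A ->
  (bl n.+1 A = \int[lebesgue_measure]_t bl n [set x | A (rV_cons (t, x))])%E.
Proof.
move=> mA; rewrite -[LHS]integral_indic_setT// integral_rV_cons12//; last first.
  by apply/measurable_EFinP; exact: measurable_indic.
apply: eq_integral => t _; rewrite -integral_indic_setT//.
exact: measurable_slice_sections.
Qed.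

Lemma measurable_slice_measure n (A : set 'rV[R]_n.+1) : measurable A ->
  measurable_fun [set: R] (fun t : R => bl n [set x | A (rV_cons (t, x))]).
Proof.
move=> mA; rewrite (_ : (fun t => _) = fun t => (\int[bl n]_x (\1_A (rV_cons (t, x)))%:E)%E).
  apply: (@measurable_slice_integral n (fun x => (\1_A x)%:E)) => [|x].
    by apply/measurable_EFinP; exact: measurable_indic.
  by rewrite lee_fin.
apply/funext => t; rewrite -integral_indic_setT//.
exact: measurable_slice_sections.
Qed.

(** Arithmetic and geometric means. The slack d keeps the factors positive when
some e i vanishes. *)
Lemma mean_bound_of_prod n (m C : R) (e : 'I_n.+1 -> R) :
  0 <= m -> 0 < C -> (forall i, 0 <= e i) ->
  (forall d, 0 < d -> m ^+ n.+1 <= C ^+ n.+1 * \prod_i (e i + d)) ->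
  m <= C / n.+1%:R * \sum_i e i.
Proof.
move=> m0 C0 e0 H; apply/ler_addgt0Pr => d d0.
have dC : 0 < d / C by rewrite divr_gt0.
have s0 : 0 <= \sum_i e i by apply: sumr_ge0 => i _; exact: e0.
rewrite -(@ler_pXn2r _ n.+1) ?nnegrE//; last first.
  by apply: addr_ge0; [apply: mulr_ge0 => //; apply: divr_ge0 => //; exact: ltW|exact: ltW].
apply: (le_trans (H _ dC)).
have := @prod_le_mean_pow n (fun i => e i + d / C) (fun i => addr_ge0 (e0 i) (ltW dC)).
rewrite -(ler_pM2l (exprn_gt0 n.+1 C0)) => /le_trans; apply.
rewrite -exprMn; rewrite le_eqVlt; apply/orP; left; apply/eqP; congr (_ ^+ _).
rewrite big_split/= sumr_const card_ord -mulr_natr.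
rewrite !mul1r mulrA mulrDr mulrDl mulrAC; congr (_ + _).
by rewrite -(mulr_natr (d / C)) mulrA mulfK ?pnatr_eq0// mulrC divfK// gt_eqF.
Qed.

(** A weighted Loomis-Whitney inequality: the condition on line integrals is the
only property of the indicator functions of the projections of A that the
classical proof uses. Write A_t for the slices of A in the first variable and
f_i(t) for the integral of F_(i+1) over the slice. The induction hypothesis
together with |A_t| <= J_0 bounds |A_t|^(n+1) by J_0 prod_i f_i(t), which is
C^(n+1) prod_i (f_i(t) / J_(i+1)) with C^(n+1) = prod_i J_i. By the inequality
of means |A_t| is then at most C times the mean of the f_i(t) / J_(i+1), a
quantity that is linear in the f_i and whose integral is at most C. *)
Lemma loomis_whitney n (A : set 'rV[R]_n.+1) (F : 'I_n.+1 -> 'rV[R]_n.+1 -> \bar R)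
    (J : 'I_n.+1 -> R) :
  measurable A -> A !=set0 ->
  (forall i, measurable_fun [set: 'rV[R]_n.+1] (F i)) ->
  (forall i x, (0 <= F i x)%E) ->
  (forall i, 0 < J i) ->
  (forall i, (\int[bl n.+1]_x F i x <= (J i)%:E)%E) ->
  (forall x, A x -> forall i, (1 <= \int[lebesgue_measure]_s F i (rV_upd x i s))%E) ->
  forall m : R, 0 <= m -> (m%:E <= bl n.+1 A)%E -> m ^+ n <= \prod_i J i.
Proof.
elim: n A F J => [|n IH] A F J mA A0 mF F0 J0 FJ AF m m0 mlA.
  (* On a line, the hypothesis at a single point is the claim. *)
  case: A0 => x Ax; rewrite expr0 big_ord1 -lee_fin.
  apply: le_trans (FJ ord0); apply: (le_trans (AF _ Ax ord0)).
  rewrite integral_rV_cons21//.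
  have E0 (g : 'rV[R]_0 -> \bar R) : measurable_fun setT g ->
      (\int[bl 0]_y g y = g (0 : 'rV[R]_0)%R)%E.
    by move=> mg; rewrite /= [LHS]integral_dirac// diracT mul1e.
  rewrite E0; last first.
    apply: (@measurable_fun_fubini_tonelli_G _ _ _ _ _ lebesgue_measure (F ord0 \o @rV_cons R 0)) => [|z].
      exact: measurableT_comp (mF ord0) (@measurable_rV_cons R 0).
    exact: F0.
  rewrite le_eqVlt; apply/orP; left; apply/eqP.
  apply: eq_integral => s _; congr (F _ _); apply/rowP => j.
  by rewrite !mxE !ord1 unlift_none.
pose At t := [set x | A (rV_cons (t, x))].
have mAt t : measurable (At t) by exact: measurable_slice_sections.
pose f i t := (\int[bl n.+1]_x F (lift ord0 i) (rV_cons (t, x)))%E.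
have mf i : measurable_fun [set: R] (f i).
  by apply: measurable_slice_integral => // x; exact: F0.
have f0 i t : (0 <= f i t)%E by exact: integral_ge0.
have fJ i : (\int[lebesgue_measure]_t f i t <= (J (lift ord0 i))%:E)%E.
  by rewrite -integral_rV_cons12.
have AtJ t : (bl n.+1 (At t) <= (J ord0)%:E)%E.
  apply: le_trans (FJ ord0); rewrite integral_rV_cons21// -integral_indic_setT//.
  apply: ge0_le_integral => //.
  - by apply/measurable_EFinP; exact: measurable_indic.
  - apply: (@measurable_fun_fubini_tonelli_G _ _ _ _ _ lebesgue_measure (F ord0 \o @rV_cons R n.+1)) => [|z].
      exact: measurableT_comp (mF ord0) (@measurable_rV_cons R n.+1).
    exact: F0.
  - move=> x _; rewrite indicE; case: (boolP (x \in At t)) => [/set_mem Ax|_] /=; last first.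
      by apply: integral_ge0.
    have := AF _ Ax ord0.
    by under eq_integral do rewrite rV_upd_cons0.
have Jp : 0 < \prod_(i < n.+2) J i by apply: prodr_gt0 => i _; exact: J0.
pose C := (\prod_(i < n.+2) J i) `^ (n.+1%:R^-1).
have C0 : 0 < C by exact: powR_gt0.
have Cn : C ^+ n.+1 = \prod_(i < n.+2) J i.
  by rewrite -powR_mulrn ?ltW// /C -powRrM mulVf ?powRr1 ?ltW// pnatr_eq0.
have key t : (bl n.+1 (At t) <=
    (C / n.+1%:R)%:E * \sum_i f i t * ((J (lift ord0 i))^-1)%:E)%E.
  have Cn0 : 0 < C / n.+1%:R by rewrite divr_gt0.
  have [->|Atn0] := eqVneq (At t) set0.
    rewrite measure0; apply: mule_ge0; first by rewrite lee_fin ltW.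
    by apply: sume_ge0 => i _; rewrite mule_ge0// lee_fin invr_ge0 ltW.
  (* If some f i t is infinite, then so is the right-hand side. *)
  have [fin|] := pselect (forall i, f i t \is a fin_num); last first.
    move=> /existsNP[i /negP]; rewrite ge0_fin_numE// -leNgt leye_eq => /eqP fit.
    have fJy : (f i t * ((J (lift ord0 i))^-1)%:E = +oo)%E.
      by rewrite fit mulyr gtr0_sg ?mul1e// invr_gt0.
    rewrite (bigD1 i)//= fJy addye; last first.
      rewrite gt_eqF// (@lt_le_trans _ _ 0%E)//; apply: sume_ge0 => k _.
      by rewrite mule_ge0// lee_fin invr_ge0 ltW.
    by rewrite mulry gtr0_sg// mul1e leey.
  have mfin : bl n.+1 (At t) \is a fin_num.
    by rewrite ge0_fin_numE// (le_lt_trans (AtJ t))// ltry.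
  pose e i := fine (f i t) / J (lift ord0 i).
  have -> : (\sum_i f i t * (J (lift ord0 i))^-1%:E)%E = (\sum_i e i)%:E.
    rewrite -sumEFin; apply: eq_bigr => i _.
    by rewrite /e EFinM fineK.
  rewrite -(fineK mfin) -EFinM lee_fin; apply: mean_bound_of_prod => //.
  - exact: fine_ge0.
  - by move=> i; rewrite divr_ge0// ?fine_ge0// ltW.
  move=> d d0.
  have dJ i : 0 < fine (f i t) + d * J (lift ord0 i).
    by rewrite ltr_wpDl ?fine_ge0// mulr_gt0.
  have /set0P Atn := Atn0.
  have := IH (At t) (fun i x => F (lift ord0 i) (rV_cons (t, x)))
     (fun i => fine (f i t) + d * J (lift ord0 i)) (mAt t) Atn _ _ dJ _ _
     (fine (bl n.+1 (At t))) (fine_ge0 (measure_ge0 _ _)).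
  move=> /(_ _ _ _ _ _)H.
  rewrite exprS Cn big_ord_recl -mulrA -big_split /=.
  apply: ler_pM.
  - exact: fine_ge0.
  - by rewrite exprn_ge0 ?fine_ge0.
  - by have := AtJ t; rewrite -{1}(fineK mfin) lee_fin.
  - rewrite (eq_bigr (fun i => fine (f i t) + d * J (lift ord0 i))); last first.
      by move=> i _; rewrite /e mulrDr mulrC divfK ?gt_eqF// mulrC.
    apply: H.
    + by move=> i; exact: measurableT_comp (mF _) (measurable_rV_consl _).
    + by move=> i x; exact: F0.
    + move=> i; rewrite -[leLHS](fineK (fin i)) lee_fin lerDl.
      by rewrite mulr_ge0// ltW.
    + move=> x Ax i; have := AF _ Ax (lift ord0 i).
      by under eq_integral do rewrite rV_upd_cons.
    + by rewrite fineK.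
suff : (bl n.+2 A <= C%:E)%E.
  move=> /(le_trans mlA); rewrite lee_fin => mC.
  by rewrite -Cn lerXn2r ?nnegrE ?(le_trans m0).
have mfJ i : measurable_fun [set: R]
    (fun t => f i t * ((J (lift ord0 i))^-1)%:E)%E.
  by apply: emeasurable_funM; [exact: mf|exact: measurable_cst].
rewrite integral_slice_indic//.
apply: (@le_trans _ _ (\int[lebesgue_measure]_t
    ((C / n.+1%:R)%:E * \sum_i f i t * ((J (lift ord0 i))^-1)%:E))%E).
  apply: ge0_le_integral => //.
  - exact: measurable_slice_measure.
  - apply: measurable_funeM. apply: emeasurable_sum => i.
    exact: mfJ.
  - by move=> t _; exact: key.
rewrite ge0_integralZl//; last 3 first.
- by apply: emeasurable_sum => i; exact: mfJ.
- move=> t _; rewrite sume_ge0// => i _.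
  by rewrite mule_ge0// lee_fin invr_ge0 ltW.
- by rewrite lee_fin divr_ge0// ltW.
rewrite ge0_integral_sum//; last first.
  by move=> i t _; rewrite mule_ge0// lee_fin invr_ge0 ltW.
apply: (@le_trans _ _ ((C / n.+1%:R)%:E * \sum_(i < n.+1) 1)%E); last first.
  rewrite sumEFin sumr_const card_ord -EFinM lee_fin.
  by rewrite divfK// pnatr_eq0.
rewrite lee_pmul2l ?lte_fin ?divr_gt0//.
apply: lee_sum => i _; rewrite ge0_integralZr//.
- by rewrite lee_pdivrMr// mul1e.
- exact: mf.
- by rewrite lee_fin invr_ge0 ltW.
Qed.

End slices.

(** * Smooth functions and a Sobolev inequality for their level sets *)

Section smooth_functions.
Variables (R : realType) (n : nat).
Local Notation V := 'rV[R]_n.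
Implicit Types (phi psi : V -> R) (k : 'I_n).

(** Coinduction: the induction on the list of derivatives is carried out once,
here. *)
Lemma smooth_coind (P : set (V -> R)) :
  (forall phi, P phi -> continuous phi /\
    forall k, (forall x, derivable phi x (ebase R k)) /\ P (partial k phi)) ->
  P `<=` @smooth R n.
Proof.
move=> H phi Pphi s.
have : P (foldr (@partial R n) phi s) by elim: s => //= k s /H[_ /(_ k)[]].
by move=> /H[? Hk]; split=> // k x; have [] := Hk k.
Qed.

Lemma smooth_partial phi k : smooth phi -> smooth (partial k phi).
Proof. by move=> sphi s; rewrite -foldr_rcons. Qed.

Lemma smooth_continuous phi : smooth phi -> continuous phi.
Proof. by move=> /(_ [::])[]. Qed.

Lemma smooth_derivable phi x k : smooth phi -> derivable phi x (ebase R k).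
Proof. by move=> /(_ [::])[]. Qed.

(** The algebra generated by B and the smooth functions. It is the class to which
[smooth_coind] is applied when the derivatives of the members of B are known
to be polynomials in smooth functions and members of B. *)
Inductive smooth_alg (B : set (V -> R)) : (V -> R) -> Prop :=
| SmoothAlg phi of smooth phi : smooth_alg B phi
| SmoothAlgGen phi of B phi : smooth_alg B phi
| SmoothAlgD phi psi of smooth_alg B phi & smooth_alg B psi :
    smooth_alg B (phi \+ psi)
| SmoothAlgM phi psi of smooth_alg B phi & smooth_alg B psi :
    smooth_alg B (phi \* psi).

Lemma partialD phi psi k x : derivable phi x (ebase R k) ->
  derivable psi x (ebase R k) ->
  partial k (phi \+ psi) x = partial k phi x + partial k psi x.
Proof. by move=> d1 d2; exact: (deriveD d1 d2). Qed.

Lemma partialM phi psi k x : derivable phi x (ebase R k) ->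
  derivable psi x (ebase R k) ->
  partial k (phi \* psi) x = phi x * partial k psi x + psi x * partial k phi x.
Proof. by move=> d1 d2; exact: (deriveM d1 d2). Qed.

Lemma smooth_alg_smooth (B : set (V -> R)) :
  (forall phi, B phi -> continuous phi /\
    forall k, (forall x, derivable phi x (ebase R k)) /\
      smooth_alg B (partial k phi)) ->
  smooth_alg B `<=` @smooth R n.
Proof.
move=> HB; apply: smooth_coind => phi; elim => {phi}.
- move=> phi sphi; split; first exact: smooth_continuous.
  move=> k; split; first by move=> x; exact: smooth_derivable.
  by apply: SmoothAlg; exact: smooth_partial.
- exact: HB.
- move=> phi psi _ [cphi Hphi] _ [cpsi Hpsi]; split.
    by move=> x; exact: (cvgD (cphi x) (cpsi x)).
  move=> k; have [dphi gphi] := Hphi k; have [dpsi gpsi] := Hpsi k.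
  split; first by move=> x; exact: derivableD.
  rewrite (_ : partial k _ = partial k phi \+ partial k psi).
    exact: SmoothAlgD.
  by apply/funext => x; rewrite partialD.
- move=> phi psi aphi [cphi Hphi] apsi [cpsi Hpsi]; split.
    by move=> x; exact: (cvgM (cphi x) (cpsi x)).
  move=> k; have [dphi gphi] := Hphi k; have [dpsi gpsi] := Hpsi k.
  split; first by move=> x; exact: derivableM.
  rewrite (_ : partial k _ = (phi \* partial k psi) \+ (psi \* partial k phi)).
    by apply: SmoothAlgD; exact: SmoothAlgM.
  by apply/funext => x; rewrite partialM.
Qed.

Lemma smoothD phi psi : smooth phi -> smooth psi -> smooth (phi \+ psi).
Proof.
move=> s1 s2; apply: (@smooth_alg_smooth set0) => //.
exact: (SmoothAlgD (SmoothAlg _ s1) (SmoothAlg _ s2)).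
Qed.

Lemma smoothM phi psi : smooth phi -> smooth psi -> smooth (phi \* psi).
Proof.
move=> s1 s2; apply: (@smooth_alg_smooth set0) => //.
exact: (SmoothAlgM (SmoothAlg _ s1) (SmoothAlg _ s2)).
Qed.

Lemma partial_cst c k : partial k (fun=> c : R) = fun=> 0.
Proof. by apply/funext => x; exact: derive_cst. Qed.

Lemma smooth_cst c : smooth ((fun=> c) : V -> R).
Proof.
apply: (@smooth_coind [set phi | exists c, phi = fun=> c]); last by exists c.
move=> _ [d ->]; split; first exact: cst_continuous.
move=> k; split; first by move=> x; exact: derivable_cst.
by exists 0; exact: partial_cst.
Qed.

Lemma smoothZ c phi : smooth phi -> smooth (fun x => c * phi x).
Proof. by move=> sphi; exact: (smoothM (smooth_cst c)). Qed.

Lemma smooth_sub phi psi : smooth phi -> smooth psi -> smooth (phi \- psi).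
Proof.
move=> s1 s2; have -> : phi \- psi = phi \+ (fun x => -1 * psi x).
  by apply/funext => x /=; rewrite mulN1r.
exact: (smoothD s1 (smoothZ _ s2)).
Qed.

Lemma coord_diff_quot k i x (h : R) :
  (h *: ebase R k + x) ord0 i = h * (i == k)%:R + x ord0 i.
Proof. by rewrite !mxE eqxx. Qed.

Lemma is_derive_coord k i x :
  is_derive x (ebase R k) (fun x : V => x ord0 i : R) (i == k)%:R.
Proof.
have H : h^-1 *: (((fun x : V => x ord0 i : R) \o shift x) (h *: ebase R k) - x ord0 i)
    @[h --> (0:R)^'] --> ((i == k)%:R : R).
  apply: (@cvg_trans _ ((fun=> (i == k)%:R : R) @ (0 : R)^')); last exact: cvg_cst.
  apply: near_eq_cvg; near=> h.
  have h0 : h != 0 by near: h; exact: nbhs_dnbhs_neq.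
  by rewrite /= coord_diff_quot addrK -[_ *: _]/(_ * _) mulrA mulVf ?mul1r.
by split; [exact: cvgP H|exact: cvg_lim H].
Unshelve. all: by end_near.
Qed.

Lemma smooth_coord i : smooth (fun x : V => x ord0 i : R).
Proof.
apply: (@smooth_coind [set phi | smooth phi \/ phi = fun x : V => x ord0 i]).
  move=> phi [sphi|->]; split.
  - exact: smooth_continuous.
  - move=> k; split; first by move=> x; exact: smooth_derivable.
    by left; exact: smooth_partial.
  - exact: coord_continuous.
  move=> k; split; first by move=> x; apply: ex_derive; exact: is_derive_coord.
  left; rewrite (_ : partial k _ = fun=> (i == k)%:R); first exact: smooth_cst.
  apply/funext => x; rewrite /partial.
  by apply: derive_val; exact: is_derive_coord.
by right.
Qed.

Lemma is_derive_ray phi x (v : V) : derivable phi x v ->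
  is_derive (0 : R) 1 (fun h : R => phi (h *: v + x)) ('D_v phi x).
Proof.
move=> /derivable1P dphi; split => //.
rewrite /derive; set g1 := fun h => h^-1 *: _; set g2 := fun h => h^-1 *: _.
suff -> : g1 = g2 by [].
by rewrite funeqE /g1 /g2 => h /=; rewrite addr0 scale0r add0r [_%:A]mulr1.
Qed.

Lemma is_derive_comp (g : R -> R) (dg : R) phi x (v : V) :
  is_derive (phi x) 1 g dg -> derivable phi x v ->
  is_derive x v (g \o phi) (dg * 'D_v phi x).
Proof.
move=> gd dphi; have rd := is_derive_ray dphi.
have gd' : is_derive ((fun h : R => phi (h *: v + x)) 0) 1 g dg.
  by rewrite /= scale0r add0r.
have H := is_derive1_comp gd' rd.
have d : derivable (g \o phi) x v by apply/derivable1P; exact: (ex_derive (is_derive := H)).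
split => //; rewrite -(derive_val (is_derive := is_derive_ray d)).
exact: (derive_val (is_derive := H)).
Qed.

Lemma partial_out phi k x : ~ closure [set x | phi x != 0] x -> partial k phi x = 0.
Proof.
move=> xcl; rewrite /partial.
have nx : \near x, phi x = 0.
  move/existsNP : xcl => [B /not_implyP[nB /set0P/negP/negPn/eqP AB]].
  apply: filterS nB => y By; apply/eqP; apply/negPn/negP => phiy.
  by have : ([set x | phi x != 0] `&` B) y by []; rewrite AB.
by rewrite (near_eq_derive _ nx) derive_cst.
Qed.

Lemma coord_le_norm (x : V) i : `|x ord0 i| <= `|x|.
Proof.
rewrite [leRHS]/Num.norm /= mx_normrE; apply/bigmax_geP; right => /=.
by exists (ord0, i).
Qed.

Lemma compact_coord_bound (K : set V) : compact K ->
  exists2 M : R, 0 < M & forall x i, K x -> `|x ord0 i| < M.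
Proof.
move=> /compact_bounded[M [Mreal HM]]; exists (`|M| + 2).
  by rewrite ltr_wpDl.
move=> x i Kx; apply: (le_lt_trans (coord_le_norm x i)).
apply: (@le_lt_trans _ _ (`|M| + 1)); last by rewrite ltrD2l ltr1n.
by apply: HM => //; rewrite (le_lt_trans (ler_norm _))// ltrDl.
Qed.

Lemma is_derive_line phi x i s : derivable phi (rV_upd x i s) (ebase R i) ->
  is_derive s 1 (fun s : R => phi (rV_upd x i s)) (partial i phi (rV_upd x i s)).
Proof.
move=> dphi.
have E : (fun h : R => h^-1 *: (((fun s : R => phi (rV_upd x i s)) \o shift s) (h *: 1)
     - phi (rV_upd x i s))) =
   (fun h : R => h^-1 *: ((phi \o shift (rV_upd x i s)) (h *: ebase R i) - phi (rV_upd x i s))).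
  by apply/funext => h; rewrite /= -[h *: 1]/(h * 1) mulr1 rV_upd_shift.
by split; rewrite /derivable /derive ?E.
Qed.

Lemma FTC_line phi x i a b : smooth phi -> a < b ->
  (\int[lebesgue_measure]_(s in `[a, b]) (partial i phi (rV_upd x i s))%:E =
   (phi (rV_upd x i b))%:E - (phi (rV_upd x i a))%:E)%E.
Proof.
move=> sphi ab.
have d psi s : smooth psi -> derivable (fun s : R => psi (rV_upd x i s)) s 1.
  by move=> sp; apply: ex_derive; apply: is_derive_line; exact: smooth_derivable.
have c psi : smooth psi -> continuous (fun s : R => psi (rV_upd x i s)).
  move=> sp s; apply: differentiable_continuous; apply/derivable1_diffP; exact: d.
apply: (@continuous_FTC2 _ (fun s => partial i phi (rV_upd x i s))
   (fun s => phi (rV_upd x i s))) => //.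
- by apply: continuous_subspaceT; apply: c; exact: smooth_partial.
- split; first by move=> s _; exact: d.
  + by apply: cvg_at_right_filter; exact: c.
  + by apply: cvg_at_left_filter; exact: c.
- move=> s _; rewrite derive1E; apply: derive_val; apply: is_derive_line.
  exact: smooth_derivable.
Qed.

Lemma measurable_smooth phi : smooth phi -> measurable_fun [set: V] phi.
Proof. by move=> sphi; apply: continuous_borel; exact: smooth_continuous. Qed.

Lemma measurable_smooth_line phi x i : smooth phi ->
  measurable_fun [set: R] (fun s : R => phi (rV_upd x i s)).
Proof.
move=> sphi; apply: (measurableT_comp _ (measurable_rV_upd x i)).
exact: measurable_smooth.
Qed.

(** The line through x in direction i leaves the support of phi, so that phi x is
an integral of the derivative over a segment of it. *)
Lemma integral_line_ge phi x i : smooth phi ->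
  compact (closure [set x | phi x != 0]) ->
  (`|phi x|%:E <= \int[lebesgue_measure]_s `|partial i phi (rV_upd x i s)|%:E)%E.
Proof.
move=> sphi /compact_coord_bound[M M0 HM].
have [x0|/eqP xn0] := eqVneq (phi x) 0.
  by rewrite x0 normr0; apply: integral_ge0 => s _; rewrite lee_fin.
have xM : `|x ord0 i| < M by apply: HM; apply: subset_closure; apply/eqP.
have y0 : phi (rV_upd x i (- M)) = 0.
  apply/eqP/negPn/negP => yn0.
  have /(HM _ i) : closure [set x | phi x != 0] (rV_upd x i (- M)) by exact: subset_closure.
  by rewrite mxE eqxx normrN gtr0_norm// ltxx.
have Mx : - M < x ord0 i by move: xM; rewrite ltr_norml => /andP[].
have := FTC_line x i sphi Mx; rewrite rV_upd_id y0 sube0 => E.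
have mp := measurable_smooth_line x i (smooth_partial i sphi).
rewrite -abse_EFin -E; apply: (@le_trans _ _ (\int[lebesgue_measure]_(s in `[(- M)%R, x ord0 i]) `|partial i phi (rV_upd x i s)|%:E)%E).
  apply: (le_abse_integral lebesgue_measure (f := fun s => (partial i phi (rV_upd x i s))%:E)) => //.
  by apply/measurable_EFinP; exact: measurable_funS mp.
apply: ge0_subset_integral => //.
by apply/measurable_EFinP; exact: measurableT_comp.
Qed.

(** The integral of a derivative with compact support vanishes. Its positive and
negative parts are kept apart because Tonelli's theorem is applied to each of
them next. *)
Lemma integral_line_pos_neg phi x i : smooth phi ->
  compact (closure [set x | phi x != 0]) ->
  (\int[lebesgue_measure]_s ((fun s => (partial i phi (rV_upd x i s))%:E)^\+ s) =
   \int[lebesgue_measure]_s ((fun s => (partial i phi (rV_upd x i s))%:E)^\- s))%E.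
Proof.
move=> sphi /compact_coord_bound[M M0 HM].
pose g s := (partial i phi (rV_upd x i s))%:E.
have out s : M <= `|s| -> phi (rV_upd x i s) = 0 /\ g s = 0%E.
  move=> Ms; have nc : ~ closure [set x | phi x != 0] (rV_upd x i s).
    by move=> /(HM _ i); rewrite mxE eqxx ltNge Ms.
  split; last by rewrite /g partial_out.
  by apply/eqP/negPn/negP => yn0; apply: nc; exact: subset_closure.
have mp := measurable_smooth_line x i (smooth_partial i sphi).
have MM : - M < M by rewrite gtrN.
have mI : measurable `[- M, M]%classic by [].
have := FTC_line x i sphi MM.
have oM : phi (rV_upd x i M) = 0 by apply: (out M _).1; rewrite gtr0_norm.
have oNM : phi (rV_upd x i (- M)) = 0.
  by apply: (out (- M) _).1; rewrite normrN gtr0_norm.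
rewrite oM oNM subee// => E.
have ig : lebesgue_measure.-integrable `[- M, M] g.
  apply: continuous_compact_integrable; first exact: segment_compact.
  apply: continuous_subspaceT => s; apply: differentiable_continuous.
  apply/derivable1_diffP; apply: ex_derive; apply: is_derive_line.
  exact/smooth_derivable/smooth_partial.
have gT s : s \notin `[- M, M]%classic -> g s = 0%E.
  rewrite notin_setE /= in_itv/= => /negP; rewrite -ler_norml -ltNge => /ltW Ms.
  by have [] := out s Ms.
have Ep : (\int[lebesgue_measure]_s (g^\+ s) = \int[lebesgue_measure]_(s in `[(- M)%R, M]) (g^\+ s))%E.
  rewrite [RHS]integral_mkcond; apply: eq_integral => s _.
  by rewrite patchE; case: ifPn => // /gT gs0; rewrite funeposE gs0 maxxx.
have En : (\int[lebesgue_measure]_s (g^\- s) = \int[lebesgue_measure]_(s in `[(- M)%R, M]) (g^\- s))%E.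
  rewrite [RHS]integral_mkcond; apply: eq_integral => s _.
  by rewrite patchE; case: ifPn => // /gT gs0; rewrite funenegE gs0 oppe0 maxxx.
rewrite Ep En; move: E; rewrite integralE => E.
have fp : (\int[lebesgue_measure]_(s in `[(- M)%R, M]) (g^\+ s) \is a fin_num)%E.
  by apply: integrable_pos_fin_num.
have fn : (\int[lebesgue_measure]_(s in `[(- M)%R, M]) (g^\- s) \is a fin_num)%E.
  by apply: integrable_neg_fin_num.
rewrite -[LHS](@subeK _ _ _ fn) -[RHS]add0e; congr (_ + _)%E; exact: E.
Qed.

Lemma integral_partial_pos_neg phi i : smooth phi ->
  compact (closure [set x | phi x != 0]) ->
  (\int[borel_lebesgue R n]_x ((fun x => (partial i phi x)%:E)^\+ x) =
   \int[borel_lebesgue R n]_x ((fun x => (partial i phi x)%:E)^\- x))%E.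
Proof.
move=> sphi cphi.
have mp : measurable_fun [set: V] (fun x => (partial i phi x)%:E).
  by apply/measurable_EFinP; exact: (measurable_smooth (smooth_partial i sphi)).
apply: (eq_integral_lines (k := i)).
- exact: measurable_funepos.
- by move=> x; exact: funepos_ge0.
- exact: measurable_funeneg.
- by move=> x; exact: funeneg_ge0.
- move=> x; have H := integral_line_pos_neg x i sphi cphi.
  apply: (etrans (etrans _ H)); apply: eq_integral => s _.
    by rewrite !funeposE.
  by rewrite !funenegE.
Qed.

End smooth_functions.

Section test_sobolev.
Variables (R : realType) (n : nat).
Local Notation V := 'rV[R]_n.+2.
Notation mu := (lebesgue_rV R n.+2).

(** By [integral_line_ge], the functions |D_i phi| / tau have integral at least 1
over each coordinate line that meets {|phi| >= tau}; this is the hypothesis of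
[loomis_whitney]. *)
Lemma weak_sobolev_smooth (phi : V -> R) (tau S m : R) : smooth phi ->
  compact (closure [set x | phi x != 0]) -> 0 < tau -> 0 < S ->
  (forall i, \int[mu]_x `|partial i phi x|%:E <= S%:E)%E ->
  0 <= m -> (m%:E <= mu [set x | (tau <= `|phi x|)%R])%E ->
  m ^+ n.+1 <= (S / tau) ^+ n.+2.
Proof.
move=> sphi cphi tau0 S0 HS m0.
pose A := [set x : V | (tau <= `|phi x|)%R].
have mphi := continuous_borel (smooth_continuous sphi).
have mA : measurable A.
  rewrite -[A]setTI; apply: (measurable_fun_le (f := fun=> tau) (g := fun x => `|phi x|)) => //.
  exact: measurableT_comp.
rewrite -/A lebesgue_rVE// => mlA.
have [A0|/set0P An0] := eqVneq A set0.
  move: mlA; rewrite A0 measure0 lee_fin => mle0.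
  by rewrite (_ : m = 0) ?expr0n ?exprn_ge0 ?divr_ge0 ?ltW//; apply/eqP; rewrite eq_le mle0.
have -> : (S / tau) ^+ n.+2 = \prod_(i < n.+2) (S / tau).
  by rewrite prodr_const card_ord.
have mp i : measurable_fun [set: V] (fun x => (`|partial i phi x| / tau)%:E).
  apply/measurable_EFinP; apply: measurable_funM => //; apply: measurableT_comp => //.
  exact: (measurable_smooth (smooth_partial i sphi)).
apply: (loomis_whitney mA An0 mp) => //.
- by move=> i x; rewrite lee_fin divr_ge0// ltW.
- by move=> i; rewrite divr_gt0.
- move=> i; under eq_integral do rewrite EFinM.
  have mpi : measurable_fun [set: V] (fun x => `|partial i phi x|%:E).
    apply/measurable_EFinP; apply: measurableT_comp => //.
    exact: (measurable_smooth (smooth_partial i sphi)).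
  rewrite ge0_integralZr//; last by rewrite lee_fin invr_ge0 ltW.
  rewrite EFinM lee_pmul2r ?lte_fin ?invr_gt0//.
  by rewrite -ge0_integral_borel.
- move=> x Ax i; under eq_integral do rewrite EFinM.
  have mpi := measurable_smooth_line x i (smooth_partial i sphi).
  rewrite ge0_integralZr//; last 2 first.
  + by apply/measurable_EFinP; exact: measurableT_comp.
  + by rewrite lee_fin invr_ge0 ltW.
  rewrite lee_pdivlMr// mul1e.
  apply: le_trans (integral_line_ge _ _ sphi cphi).
  by rewrite lee_fin.
Qed.
End test_sobolev.

(** * Real-valued integrals over a complete measure *)

Section real_integrals.
Context d (T : measurableType d) (R : realType) (mu : {measure set T -> \bar R}).
Hypothesis cmu : measure_is_complete mu.
Variables (O : set T) (mO : measurable O).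
Implicit Types f g h v : T -> R.
Local Notation I f := (mu.-integrable O (EFin \o f)).

Lemma integrable_measurable f : I f -> measurable_fun O f.
Proof. by move=> /measurable_int/measurable_EFinP. Qed.

Lemma ae_eq_measurable f g : (\forall x \ae mu, O x -> f x = g x) ->
  measurable_fun O f -> measurable_fun O g.
Proof.
move=> fg /measurable_EFinP mf; apply/measurable_EFinP.
apply: (ae_measurable_fun cmu _ mf).
by apply: filterS fg => x fg Ox; congr EFin; exact: fg.
Qed.

Lemma integrable_dominated f g : measurable_fun O f -> I g ->
  (\forall x \ae mu, O x -> `|f x| <= g x) -> I f.
Proof.
move=> mf /integrableP[mg ig] fg; apply/integrableP; split.
  exact/measurable_EFinP.
apply: le_lt_trans ig; apply: ae_ge0_le_integral => //.
- by apply: measurableT_comp => //; exact/measurable_EFinP.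
- by apply: measurableT_comp.
apply: filterS fg => x fg Ox /=; rewrite lee_fin.
exact: le_trans (fg Ox) (ler_norm _).
Qed.

Lemma integrable_ae_eq f g : (\forall x \ae mu, O x -> f x = g x) -> I f -> I g.
Proof.
move=> fg If; apply: (@integrable_dominated _ (fun x => `|f x|)).
- by apply: (ae_eq_measurable fg); exact: integrable_measurable.
- exact: (integrable_norm If).
- by apply: filterS fg => x fg Ox; rewrite fg.
Qed.

Lemma integrable_add f g : I f -> I g -> I (fun x => f x + g x).
Proof. by move=> If Ig; exact: (integrableD mO If Ig). Qed.

Lemma integrable_sub f g : I f -> I g -> I (fun x => f x - g x).
Proof. by move=> If Ig; exact: (integrableB mO If Ig). Qed.

Lemma integrable_scale c f : I f -> I (fun x => c * f x).
Proof.
move=> If; rewrite (_ : EFin \o _ = fun x => (c%:E * (EFin \o f) x)%E) //.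
exact: integrableZl.
Qed.

Lemma integrable_zero : I (fun=> 0).
Proof. exact: integrable0. Qed.

Lemma integrable_bigsum (J : finType) (F : J -> T -> R) :
  (forall j, I (F j)) -> I (fun x => \sum_j F j x).
Proof.
move=> IF.
rewrite (_ : EFin \o _ = (fun x => \sum_j (F j x)%:E)%E).
  by apply: integrable_sum => // j0 _; exact: IF.
by apply/funext => x; rewrite /= sumEFin.
Qed.

Lemma integrable_mul_bounded f h C : I f -> measurable_fun O h ->
  (forall x, O x -> `|h x| <= C) -> I (fun x => f x * h x).
Proof.
move=> If mh hC; apply: (@integrable_dominated _ (fun x => C * `|f x|)).
- by apply: measurable_funM => //; exact: integrable_measurable.
- apply: integrable_scale; exact: (integrable_norm If).
- by apply: nearW => x Ox; rewrite normrM mulrC ler_wpM2r// hC.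
Qed.

Lemma Rintegral_ae_eq f g : I f -> I g -> (\forall x \ae mu, O x -> f x = g x) ->
  \int[mu]_(x in O) f x = \int[mu]_(x in O) g x.
Proof.
move=> If Ig fg; rewrite /Rintegral; congr fine.
apply: ae_eq_integral => //.
- by apply/measurable_EFinP; exact: integrable_measurable.
- by apply/measurable_EFinP; exact: integrable_measurable.
by apply: filterS fg => x fg Ox; rewrite fg.
Qed.

Lemma Rintegral_ae_le f g : I f -> I g -> (\forall x \ae mu, O x -> f x <= g x) ->
  \int[mu]_(x in O) f x <= \int[mu]_(x in O) g x.
Proof.
move=> If Ig fg.
pose g' x := Num.max (f x) (g x).
have gg' : \forall x \ae mu, O x -> g x = g' x.
  by apply: filterS fg => x fg Ox; rewrite /g' max_r// fg.
have Ig' : I g' by exact: (integrable_ae_eq gg').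
rewrite (Rintegral_ae_eq Ig Ig' gg').
by apply: le_Rintegral => // x Ox; rewrite /g' le_max lexx.
Qed.

Lemma Rintegral_bigsum (J : finType) (F : J -> T -> R) :
  (forall j, I (F j)) ->
  \int[mu]_(x in O) (\sum_j F j x) = \sum_j \int[mu]_(x in O) F j x.
Proof.
move=> IF; have : forall s : seq J, \int[mu]_(x in O) (\sum_(j <- s) F j x) =
    \sum_(j <- s) \int[mu]_(x in O) F j x.
  elim=> [|j s IH].
    under eq_Rintegral do rewrite big_nil.
    by rewrite big_nil Rintegral_cst// mul0r.
  under eq_Rintegral do rewrite big_cons.
  rewrite big_cons RintegralD//; first by rewrite IH.
  rewrite (_ : EFin \o _ = (fun x => \sum_(j <- s) (F j x)%:E)%E).
    by apply: integrable_sum => // j0 _; exact: IF.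
  by apply/funext => x; rewrite /= sumEFin.
exact.
Qed.

Lemma Rintegral_EFin f : I f ->
  ((\int[mu]_(x in O) f x)%R%:E = \int[mu]_(x in O) (f x)%:E)%E.
Proof. by move=> If; rewrite fineK//; exact: integrable_fin_num. Qed.

Lemma measurable_ge_set (u : T -> R) (c : R) : measurable_fun O u ->
  measurable (O `&` [set x | c <= `|u x|]).
Proof.
move=> mu'; have mn : measurable_fun O (fun x => `|u x|) by exact: measurableT_comp.
rewrite (_ : _ `&` _ = O `&` (fun x => `|u x|) @^-1` `[c, +oo[%classic); first exact: mn.
by apply/seteqP; split => x [Ox /=]; rewrite in_itv/= ?andbT => h; split => //=; rewrite in_itv/= ?andbT.
Qed.

Lemma measurable_gt_set (u : T -> R) (c : R) : measurable_fun O u ->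
  measurable (O `&` [set x | c < `|u x|]).
Proof.
move=> mu'; have mn : measurable_fun O (fun x => `|u x|) by exact: measurableT_comp.
rewrite (_ : _ `&` _ = O `&` (fun x => `|u x|) @^-1` `]c, +oo[%classic); first exact: mn.
by apply/seteqP; split => x [Ox /=]; rewrite in_itv/= ?andbT => h; split => //=; rewrite in_itv/= ?andbT.
Qed.

Lemma measurable_excess (u : T -> R) (K : R) :
  measurable_fun O u ->
  measurable_fun O (fun x => Num.max (`|u x| - K) 0 : R).
Proof.
move=> mu'.
have m1 : measurable_fun O (fun x => `|u x| - K).
  by apply: measurable_funB => //; exact: measurableT_comp.
have m2 : measurable_fun O (fun x : T => 0 : R) by exact: measurable_cst.
exact: (measurable_maxr m1 m2).
Qed.

(** The excess of |u| over K tends to 0 pointwise as K grows, and is dominated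
by |u|. *)
Lemma integrable_tail_small (u : T -> R) : I u -> forall e : R, 0 < e ->
  exists2 K : R, 0 < K & \int[mu]_(x in O) Num.max (`|u x| - K) 0 < e.
Proof.
move=> iu e e0.
pose f (j : nat) (x : T) := (Num.max (`|u x| - j.+1%:R) 0 : R)%:E.
have mu' := integrable_measurable iu.
have mf j : measurable_fun O (f j).
  by apply/measurable_EFinP; exact: measurable_excess.
have f_le j x : (`|f j x| <= (abse \o (EFin \o u)) x)%E.
  rewrite /f /= !lee_fin ger0_norm ?le_max ?lexx ?orbT// ge_max normr_ge0 andbT.
  by rewrite lerBlDr lerDl.
have f_cvg : \forall x \ae mu, O x -> f j x @[j --> \oo] --> (cst 0%E : T -> \bar R) x.
  apply: nearW => x _; apply: cvg_near_cst.
  have [N _ HN] := nbhs_infty_ger `|u x|.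
  exists N => // j /= Nj; rewrite /f max_r// subr_le0.
  by apply: (le_trans (HN j Nj)); rewrite ler_nat.
have f_dom : \forall x \ae mu, forall j, O x -> (`|f j x| <= (abse \o (EFin \o u)) x)%E.
  by apply: nearW => x j _; exact: f_le.
have [_ _] := dominated_convergence mO mf (measurable_cst _) f_cvg (integrable_abse iu) f_dom.
rewrite integral0 => /fine_cvgP[_ ] /cvgrPdist_lt /(_ e e0)[N _ /(_ N (leqnn N))] /=.
rewrite sub0r normrN => H; exists N.+1%:R => //.
exact: le_lt_trans (ler_norm _) H.
Qed.

End real_integrals.

(** * Bump functions and the fundamental lemma of the calculus of variations *)

Section smooth_comp.
Variables (R : realType) (n : nat).
Local Notation V := 'rV[R]_n.

Definition comp_gen (E : set (R -> R)) : set (V -> R) :=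
  [set phi | exists2 g, E g & exists2 psi : V -> R, smooth psi & phi = g \o psi].

(** D g is the derivative of g. The second hypothesis makes the algebra generated
by the compositions with members of E stable under partial derivatives. *)
Lemma smooth_comp (E : set (R -> R)) (D : (R -> R) -> R -> R) :
  (forall g, E g -> forall x : R, is_derive x 1 g (D g x)) ->
  (forall g psi, E g -> smooth psi -> smooth_alg (comp_gen E) (D g \o psi)) ->
  forall g (psi : V -> R), E g -> smooth psi -> smooth (g \o psi).
Proof.
move=> dE algE g psi Eg spsi.
apply: (@smooth_alg_smooth R n (comp_gen E)); last first.
  by apply: SmoothAlgGen; exists g => //; exists psi.
move=> _ [{}g {}Eg [{}psi {}spsi ->]].
have dg x := dE g Eg x.
split.
  move=> x; apply: continuous_comp; first exact: smooth_continuous.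
  apply: differentiable_continuous; apply/derivable1_diffP.
  exact: (ex_derive (is_derive := dg _)).
move=> k.
have dgp x : is_derive x (ebase R k) (g \o psi) (D g (psi x) * 'D_(ebase R k) psi x).
  by apply: is_derive_comp => //; exact: smooth_derivable.
split; first by move=> x; exact: (ex_derive (is_derive := dgp x)).
rewrite (_ : partial k _ = (D g \o psi) \* partial k psi).
  apply: SmoothAlgM; first exact: algE.
  exact: (SmoothAlg _ (smooth_partial k spsi)).
by apply/funext => x; exact: (derive_val (is_derive := dgp x)).
Qed.

End smooth_comp.

Section bump.
Variable R : realType.

Definition pow_exp (m : nat) (y : R) : R := y ^+ m * expR (- y).

Lemma pow_exp_le (m : nat) (y : R) : 0 < y ->
  pow_exp m y <= m.+1%:R ^+ m.+1 / y.
Proof.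
move=> y0; rewrite /pow_exp ler_pdivlMr// mulrAC -exprSr expRN.
rewrite ler_pdivrMr ?expR_gt0//.
have -> : y = m.+1%:R * (y / m.+1%:R) by rewrite mulrC divfK// pnatr_eq0.
rewrite expRM_natl exprMn ler_pM2l ?exprn_gt0//.
apply: lerXn2r; rewrite ?nnegrE ?expR_ge0 ?divr_ge0 ?ltW//.
by rewrite (lt_le_trans _ (expR_ge1Dx _))// ltrDr.
Qed.

Lemma is_derive_pow_exp m (y : R) :
  is_derive y 1 (pow_exp m) (m%:R * pow_exp m.-1 y - pow_exp m y).
Proof.
have d1 := is_deriveX m (is_derive_id y (1 : R)).
have d2 : is_derive y 1 (expR \o -%R) (expR (- y) * -1).
  exact: (is_derive1_comp (is_derive_expR (- y)) (is_deriveN (is_derive_id y (1:R)))).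
have := is_deriveM d1 d2.
rewrite (_ : id ^+ m * _ = pow_exp m); last first.
  by apply/funext => t; rewrite mulrfctE exprfctE.
move=> H; apply: (is_derive_eq H).
rewrite /= exprfctE /= /pow_exp -[_ *: 1]/(_ * 1) -![_ *: _]/(_ * _); lra.
Qed.

(** The function x^-m exp(-1/x) on the positive half-line, extended by 0. The
family is indexed by m because it is stable under differentiation up to
linear combinations, whereas exp(-1/x) alone is not. *)
Definition bump_fun (m : nat) (x : R) : R := if 0 < x then pow_exp m x^-1 else 0.

Lemma bump_fun_ge0 m x : 0 <= bump_fun m x.
Proof.
rewrite /bump_fun; case: ifPn => // x0.
by rewrite mulr_ge0 ?expR_ge0// exprn_ge0// invr_ge0 ltW.
Qed.

Lemma bump_fun_le m x : bump_fun m x <= m.+1%:R ^+ m.+1 * `|x|.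
Proof.
rewrite /bump_fun; case: ifPn => [x0|_]; last by rewrite mulr_ge0// exprn_ge0.
by rewrite (le_trans (pow_exp_le m _)) ?invr_gt0// invrK gtr0_norm.
Qed.

Definition bump_fun' (m : nat) (x : R) : R :=
  bump_fun m.+2 x - m%:R * bump_fun m.+1 x.

(** At 0 the difference quotient of the function of index m is that of index
m + 1, which tends to 0 by [bump_fun_le]. *)
Lemma is_derive_bump_fun m (x : R) : is_derive x 1 (bump_fun m) (bump_fun' m x).
Proof.
have [x0|x0|->] := ltgtP x 0.
- have -> : bump_fun' m x = 0 by rewrite /bump_fun' /bump_fun ltNge (ltW x0) /= mulr0 subrr.
  apply: (@near_eq_is_derive _ _ _ (cst 0)).
    near=> y; have y0 : y < 0 by near: y; exact: lt_nbhsl.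
    by rewrite /bump_fun ltNge (ltW y0).
- have -> : bump_fun' m x = (m%:R * pow_exp m.-1 x^-1 - pow_exp m x^-1) * (- (x ^- 2)).
    rewrite /bump_fun' /bump_fun x0 /pow_exp.
    rewrite -exprVn; set y := x^-1; case: m => [|m] /=; rewrite !exprS; lra.
  apply: (@near_eq_is_derive _ _ _ (pow_exp m \o (fun t => t^-1))).
    near=> y; rewrite /bump_fun (_ : 0 < y = true)//.
    near: y; exact: lt_nbhsr.
  apply: is_derive1_comp; first exact: is_derive_pow_exp.
  have := is_deriveV (lt0r_neq0 x0) (is_derive_id x (1 : R)).
  by rewrite -[_ *: 1]/(_ * 1) mulr1.
rewrite (_ : bump_fun' m 0 = 0); last by rewrite /bump_fun' /bump_fun ltxx mulr0 subrr.
have b0 : bump_fun m 0 = 0 by rewrite /bump_fun ltxx.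
have H0 : m.+2%:R ^+ m.+2 * `|h| @[h --> (0:R)^'] --> (0 : R).
  rewrite -[X in _ --> X](mulr0 (m.+2%:R ^+ m.+2)); apply: cvgM; first exact: cvg_cst.
  rewrite -[X in _ --> X](@normr0 _ R).
  apply: cvg_trans (@norm_continuous _ R 0); apply: cvg_app; exact: cvg_within.
have H : h^-1 *: ((bump_fun m \o shift (0 : R)) (h *: 1) - bump_fun m 0)
    @[h --> (0:R)^'] --> (0 : R).
  apply: (@squeeze_cvgr _ _ _ _ (fun h => - (m.+2%:R ^+ m.+2 * `|h|)) (fun h : R => m.+2%:R ^+ m.+2 * `|h|)).
  - near=> h; rewrite -ler_norml b0 subr0 /= addr0 -[h *: 1]/(h * 1) mulr1.
    rewrite -[_ *: _]/(h^-1 * bump_fun m h) normrM (ger0_norm (bump_fun_ge0 _ _)).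
    have [h0|h0] := ltP 0 h; last first.
      by rewrite /bump_fun ltNge h0 /= mulr0 mulr_ge0// exprn_ge0.
    have := bump_fun_le m.+1 h; apply: le_trans.
    by rewrite /bump_fun h0 gtr0_norm ?invr_gt0// /pow_exp exprS mulrA.
  - rewrite -[X in _ --> X]oppr0; apply: cvgN; exact: H0.
  - exact: H0.
by split; [exact: cvgP H|exact: cvg_lim H].
Unshelve. all: by end_near.
Qed.

Lemma bump_fun0_le1 x : bump_fun 0 x <= 1.
Proof.
rewrite /bump_fun; case: ifPn => // x0; rewrite /pow_exp expr0 mul1r -expR0.
by rewrite ler_expR oppr_le0 invr_ge0 ltW.
Qed.

Lemma bump_fun_eq0 m x : x <= 0 -> bump_fun m x = 0.
Proof. by move=> x0; rewrite /bump_fun ltNge x0. Qed.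

Lemma smooth_bump_fun n m (psi : 'rV[R]_n -> R) :
  smooth psi -> smooth (bump_fun m \o psi).
Proof.
pose E : set (R -> R) := [set g | exists m, g = bump_fun m].
apply: (@smooth_comp R n E (fun g x => 'D_1 g x)); last by exists m.
  move=> _ [k ->] x; apply: derivableP.
  exact: (ex_derive (is_derive := is_derive_bump_fun k x)).
move=> _ f [k ->] sf.
have -> : (fun x : R => 'D_1 (bump_fun k) x) \o f =
    (bump_fun k.+2 \o f) \+ ((fun=> - k%:R) \* (bump_fun k.+1 \o f)).
  apply/funext => x /=.
  by rewrite (derive_val (is_derive := is_derive_bump_fun k (f x))) /bump_fun' mulNr.
have gen l : smooth_alg (comp_gen E) (bump_fun l \o f).
  by apply: SmoothAlgGen; exists (bump_fun l); [exists l|exists f].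
apply: (SmoothAlgD (gen _)); apply: SmoothAlgM (gen _).
exact: (SmoothAlg _ (smooth_cst _)).
Qed.

End bump.

Section box_bump.
Variables (R : realType) (n : nat).
Local Notation V := 'rV[R]_n.
Notation mu := (lebesgue_rV R n).
Implicit Types a b : 'I_n -> R.

Definition box a b : set V := [set x | forall i, a i < x ord0 i < b i].
Definition cbox a b : set V := [set x | forall i, a i <= x ord0 i <= b i].

(** Test functions with values in [0, 1] which converge to the indicator function
of the open box. *)
Definition box_bump a b (j : nat) (x : V) : R :=
  \prod_i (bump_fun 0 (j.+1%:R * (x ord0 i - a i)) *
           bump_fun 0 (j.+1%:R * (b i - x ord0 i))).

Lemma box_sub_cbox a b : box a b `<=` cbox a b.
Proof. by move=> x xab i; have /andP[/ltW -> /ltW ->] := xab i. Qed.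

Lemma smooth_box_bump a b j : smooth (box_bump a b j).
Proof.
have H : forall s : seq 'I_n, smooth (fun x : V => \prod_(i <- s)
   (bump_fun 0 (j.+1%:R * (x ord0 i - a i)) *
           bump_fun 0 (j.+1%:R * (b i - x ord0 i)))).
  elim=> [|i s IH].
    rewrite (_ : (fun x => _) = fun=> 1); first exact: smooth_cst.
    by apply/funext => x; rewrite big_nil.
  rewrite (_ : (fun x => _) = ((bump_fun 0 \o (fun x : V => j.+1%:R * (x ord0 i - a i))) \*
    (bump_fun 0 \o (fun x : V => j.+1%:R * (b i - x ord0 i)))) \*
    (fun x : V => \prod_(i <- s) (bump_fun 0 (j.+1%:R * (x ord0 i - a i)) *
           bump_fun 0 (j.+1%:R * (b i - x ord0 i))))); last first.
    by apply/funext => x; rewrite big_cons.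
  have s1 : smooth (fun x : V => j.+1%:R * (x ord0 i - a i)).
    have h := smooth_sub (smooth_coord R i) (@smooth_cst R n (a i)).
    exact: (smoothZ _ h).
  have s2 : smooth (fun x : V => j.+1%:R * (b i - x ord0 i)).
    have h := smooth_sub (@smooth_cst R n (b i)) (smooth_coord R i).
    exact: (smoothZ _ h).
  exact: (smoothM (smoothM (smooth_bump_fun 0 s1) (smooth_bump_fun 0 s2)) IH).
exact: H.
Qed.

Lemma box_bump_ge0 a b j x : 0 <= box_bump a b j x.
Proof. by apply: prodr_ge0 => i _; rewrite mulr_ge0// bump_fun_ge0. Qed.

Lemma box_bump_le1 a b j x : box_bump a b j x <= 1.
Proof.
apply: prodr_ile1 => i _; rewrite mulr_ge0 ?bump_fun_ge0//=.
by rewrite mulr_ile1 ?bump_fun_ge0 ?bump_fun0_le1.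
Qed.

Lemma box_bump_out a b j x : ~ box a b x -> box_bump a b j x = 0.
Proof.
move=> /existsNP[i /negP]; rewrite negb_and -!leNgt => xi.
rewrite /box_bump (bigD1 i)//=; case/orP: xi => xi.
  by rewrite bump_fun_eq0 ?mul0r// pmulr_rle0 ?subr_le0.
by rewrite (bump_fun_eq0 0 (x := j.+1%:R * (b i - x ord0 i))) ?mulr0 ?mul0r// pmulr_rle0 ?subr_le0.
Qed.

Lemma box_bump_cvg a b x : box a b x ->
  box_bump a b j x @[j --> \oo] --> (1 : R).
Proof.
move=> xab.
pose c := \sum_i ((x ord0 i - a i)^-1 + (b i - x ord0 i)^-1).
have E j : box_bump a b j x = expR (- (c * harmonic j)).
  rewrite /c big_distrl /= -sumrN expR_sum; apply: eq_bigr => i _.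
  have /andP[ax xb] := xab i.
  rewrite /bump_fun !mulr_gt0 ?subr_gt0// /pow_exp !expr0 !mul1r -expRD.
  by rewrite /harmonic /= !invfM -opprD mulrDl ![j.+1%:R^-1 * _]mulrC.
under eq_cvg do rewrite E.
rewrite -expR0; apply: continuous_cvg; first exact: continuous_expR.
rewrite -oppr0; apply: cvgN; rewrite -(mulr0 c); apply: cvgM; first exact: cvg_cst.
exact: cvg_harmonic.
Qed.

Lemma closed_cbox a b : closed (cbox a b).
Proof.
rewrite (_ : cbox a b = \bigcap_i ((fun x : V => x ord0 i : R) @^-1` `[a i, b i]%classic)).
  apply: closed_bigI => i _; apply: closed_comp; last exact: interval_closed.
  by move=> x _; exact: coord_continuous.
by apply/seteqP; split => x /= xab i; [move=> _|]; have := xab i; rewrite /= in_itv /= //; apply.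
Qed.

Lemma compact_cbox a b : compact (cbox a b).
Proof.
have := @rV_compact R n (fun i => `[a i, b i]%classic) (fun i => @segment_compact _ _ _).
by congr compact; apply/seteqP; split => x /= xab i; have := xab i; rewrite in_itv.
Qed.

Lemma test_fun_box_bump (O : set V) a b j : cbox a b `<=` O ->
  test_fun O (box_bump a b j).
Proof.
move=> abO.
have cl : closure [set x | box_bump a b j x != 0] `<=` cbox a b.
  rewrite ((closure_id (cbox a b)).1 (@closed_cbox a b)).
  apply: closure_subset => x /eqP xn0; apply: box_sub_cbox.
  by apply: contrapT => /(box_bump_out j).
split; first exact: smooth_box_bump.
  by apply: (subclosed_compact _ (@compact_cbox a b) cl); exact: closed_closure.
exact: subset_trans cl abO.
Qed.

Lemma measurable_box a b : measurable (box a b).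
Proof.
rewrite (_ : box a b = \bigcap_(i in [set: 'I_n])
   ((fun x : V => x ord0 i : R) @^-1` `]a i, b i[%classic)).
  apply: fin_bigcap_measurable => // i _.
  by rewrite -[X in measurable X]setTI; exact: measurable_coord.
by apply/seteqP; split => x /= xab i; [move=> _|]; have := xab i; rewrite /= in_itv /= //; apply.
Qed.

(** Dominated convergence along [box_bump]. *)
Lemma integral_box_eq0 (O : set V) (f : V -> R) a b :
  L1loc O f -> (forall phi, test_fun O phi -> \int[mu]_(x in O) (f x * phi x) = 0) ->
  cbox a b `<=` O -> (\int[mu]_(x in box a b) (f x)%:E = 0)%E.
Proof.
move=> lf f0 abO.
have mB := borel_lebesgue_measurable (measurable_box a b).
have mC : measurable (cbox a b : set (rV_lebesgue R n)).
  rewrite -(setCK (cbox a b)); apply: measurableC; apply: borel_lebesgue_measurable.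
  by apply: open_borel; apply: closed_openC; exact: closed_cbox.
have iB : mu.-integrable (box a b) (EFin \o f).
  apply: (integrableS mC mB (@box_sub_cbox a b)).
  by apply: lf => //; exact: compact_cbox.
pose fj j x := (f x * box_bump a b j x)%:E.
have mfj j : measurable_fun (box a b : set (rV_lebesgue R n)) (fj j).
  apply/measurable_EFinP; apply: measurable_funM; first exact: (integrable_measurable iB).
  exact: (measurable_fun_lebesgue (measurable_smooth (smooth_box_bump a b j))).
have fj_le j x : (`|fj j x| <= `|(f x)%:E|)%E.
  rewrite !abse_EFin lee_fin normrM ler_piMr// ger0_norm ?box_bump_ge0//.
  exact: box_bump_le1.
have fj_cvg : \forall x \ae mu, box a b x -> fj j x @[j --> \oo] --> (EFin \o f) x.
  apply: nearW => x xab; apply/fine_cvgP; split; first exact: nearW.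
  rewrite /comp /= -[X in _ --> X]mulr1; apply: cvgM; first exact: cvg_cst.
  exact: box_bump_cvg.
have fj_dom : \forall x \ae mu, forall j, box a b x -> (`|fj j x| <= (abse \o (EFin \o f)) x)%E.
  by apply: nearW => x j _; exact: fj_le.
have [_ _] := dominated_convergence mB mfj (measurable_int _ iB) fj_cvg
  (integrable_abse iB) fj_dom.
have -> : [sequence \int[mu]_(x in box a b) fj j x]_j%E = (fun=> 0%E).
  apply/funext => j /=; have tb := @test_fun_box_bump O a b j abO.
  have := f0 _ tb; rewrite Rintegral_mkcond.
  have -> : (fun x => f x * box_bump a b j x) \_ O =
            (fun x => f x * box_bump a b j x) \_ (box a b).
    apply/funext => x; rewrite !patchE; case: ifPn => xO; case: ifPn => xB //.
      by rewrite box_bump_out ?mulr0//; move: xB; rewrite notin_setE.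
    by move: xO; rewrite notin_setE => -[]; apply/abO/box_sub_cbox/set_mem.
  rewrite -Rintegral_mkcond /Rintegral => E.
  have : (\int[mu]_(x in box a b) fj j x \is a fin_num)%E.
    apply: integrable_fin_num => //; apply: (le_integrable mB (mfj j) _ iB).
    by move=> x _; exact: fj_le.
  by move=> /fineK <-; rewrite [fine _]E.
by move=> H; apply/esym; apply: (cvg_unique _ (cvg_cst _) H).
Qed.

End box_bump.

Section weak_derivative_unique.
Variables (R : realType) (n : nat).
Local Notation V := 'rV[R]_n.
Notation mu := (lebesgue_rV R n).

(** Balls are boxes, because the norm is the maximum norm. *)
Lemma borel_sub_boxes : (@measurable _ V) `<=` <<s [set box a b | a in setT & b in setT] >>.
Proof.
set G := (X in <<s X >>).
pose T := g_sigma_algebraType G.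
have openG (A : set V) : open A -> <<s G >> A.
  move=> /open_countable_ball_cover[D [c [r [r0 -> _]]]].
  apply: (@bigcup_measurable _ T) => k _; apply: sub_sigma_algebra.
  exists (fun i => c k ord0 i - r k) => //; exists (fun i => c k ord0 i + r k) => //.
  apply/seteqP; split => x /=.
    by move=> xi; apply/(rV_ballP _ _ (r0 k)) => i; rewrite distrC ltr_distl.
  by move=> /(rV_ballP _ _ (r0 k)) xi i; rewrite -ltr_distl distrC.
have mG (i : 'I_n) : measurable_fun [set: T] (fun x : T => (x : V) ord0 i : R).
  apply: (measurability _ (RGenOpens.measurableE R)).
  move=> _ [_ [a [b ->] <-]]; rewrite setTI; apply: openG.
  apply: open_comp => [x _|]; first exact: coord_continuous.
  exact: interval_open.
apply: smallest_sub; first exact: smallest_sigma_algebra.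
rewrite -bigcup_seq => B [i _] [Y mY] <-; rewrite setTI.
by have := mG i measurableT Y mY; rewrite setTI.
Qed.

Lemma box_setI (a b a' b' : 'I_n -> R) : box a b `&` box a' b' =
  box (fun i => Num.max (a i) (a' i)) (fun i => Num.min (b i) (b' i)).
Proof.
apply/seteqP; split => x.
  move=> [xab xab'] i; have /andP[? ?] := xab i; have /andP[? ?] := xab' i.
  by rewrite gt_max lt_min; apply/andP; split; apply/andP.
move=> xi; split => i; have := xi i; rewrite gt_max lt_min.
  by move=> /andP[/andP[-> _] /andP[-> _]].
by move=> /andP[/andP[_ ->] /andP[_ ->]].
Qed.

(** Open boxes form a pi-system, and the sets E for which the integral vanishes a
Dynkin system. Intersecting with a fixed box makes f integrable. *)
Lemma integral_borel_box_eq0 (O : set V) (f : V -> R) (a0 b0 : 'I_n -> R) :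
  L1loc O f -> (forall phi, test_fun O phi -> \int[mu]_(x in O) (f x * phi x) = 0) ->
  cbox a0 b0 `<=` O -> forall E : set V, measurable E ->
  (\int[mu]_(x in E `&` box a0 b0) (f x)%:E = 0)%E.
Proof.
move=> lf f0 abO.
pose G := [set box a b | a in [set: 'I_n -> R] & b in [set: 'I_n -> R]].
pose B0 : set (rV_lebesgue R n) := box a0 b0.
have mB0 : measurable B0 := borel_lebesgue_measurable (measurable_box a0 b0).
have iB0 : mu.-integrable B0 (EFin \o f).
  have mC : measurable (cbox a0 b0 : set (rV_lebesgue R n)).
    rewrite -(setCK (cbox a0 b0)); apply: measurableC; apply: borel_lebesgue_measurable.
    by apply: open_borel; apply: closed_openC; exact: closed_cbox.
  apply: (integrableS mC mB0 (@box_sub_cbox _ _ a0 b0)).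
  by apply: lf => //; exact: compact_cbox.
pose L := [set E : set V | measurable E /\
  (\int[mu]_(x in E `&` B0) (f x)%:E = 0)%E].
have GI : setI_closed G.
  move=> _ _ [a _ [b _ <-]] [a' _ [b' _ <-]]; rewrite box_setI /G /=.
  by eexists => //; eexists => //.
have GL : G `<=` L.
  move=> _ [a _ [b _ <-]]; split; first exact: measurable_box.
  rewrite box_setI; apply: (integral_box_eq0 lf f0).
  apply: subset_trans abO => x xi i; have := xi i.
  rewrite ge_max le_min => /andP[/andP[_ h1] /andP[_ h2]].
  by apply/andP.
have mEB (E : set V) : measurable E -> measurable (E `&` B0 : set (rV_lebesgue R n)).
  by move=> mE; apply: measurableI => //; exact: borel_lebesgue_measurable.
have intT : (\int[mu]_(x in B0) (f x)%:E = 0)%E.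
  exact: (integral_box_eq0 lf f0 abO).
have dL : dynkin L.
  split.
  - by split; [exact: measurableT|rewrite setTI].
  - move=> E [mE E0]; split; first exact: measurableC.
    have := integral_setU mu (mEB E mE) (mEB (~` E) (measurableC mE)) (f := EFin \o f).
    rewrite -setIUl setUv setTI E0 add0e intT => H; apply/esym; apply: H.
    + exact: (measurable_int _ iB0).
    + by apply/disj_setPS => x [[Ex _] [nEx _]].
  - move=> F tF LF; split; first by apply: bigcup_measurable => k _; case: (LF k).
    rewrite setI_bigcupl integral_bigcup.
    + by rewrite eseries0// => k _ _; case: (LF k).
    + exact: trivIset_setIr.
    + by move=> k; apply: mEB; case: (LF k).
    + rewrite -setI_bigcupl; apply: integrableS iB0 => //.
      by apply: mEB; apply: bigcup_measurable => k _; case: (LF k).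
move=> E mE; have : <<s G >> E by exact: borel_sub_boxes.
rewrite -(setI_closed_g_dynkin_g_sigma_algebra GI) => dE.
by have [] := dE L (conj dL GL).
Qed.

(** A Borel set agrees with {f > 0} up to a null set, by [lebesgue_borel_cover];
the integral of f over it vanishes. *)
Lemma box_le0 (O : set V) (f : V -> R) (a b : 'I_n -> R) :
  L1loc O f -> (forall phi, test_fun O phi -> \int[mu]_(x in O) (f x * phi x) = 0) ->
  cbox a b `<=` O -> \forall x \ae mu, box a b x -> f x <= 0.
Proof.
move=> lf f0 abO.
pose B0 : set (rV_lebesgue R n) := box a b.
have mB0 : measurable B0 := borel_lebesgue_measurable (measurable_box a b).
have mC : measurable (cbox a b : set (rV_lebesgue R n)).
  rewrite -(setCK (cbox a b)); apply: measurableC; apply: borel_lebesgue_measurable.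
  by apply: open_borel; apply: closed_openC; exact: closed_cbox.
have iC : mu.-integrable (cbox a b) (EFin \o f).
  by apply: lf => //; exact: compact_cbox.
have iB0 : mu.-integrable B0 (EFin \o f).
  exact: (integrableS mC mB0 (@box_sub_cbox _ _ a b) iC).
pose E : set (rV_lebesgue R n) := B0 `&` [set x | 0 < f x].
have mE : measurable E.
  have := integrable_measurable iB0; move=> mf.
  rewrite (_ : E = B0 `&` f @^-1` `]0, +oo[%classic); first exact: mf.
  by apply/seteqP; split => x [Bx fx]; split => //; move: fx; rewrite /= in_itv/= ?andbT.
have Eoo : (mu E < +oo)%E.
  apply: bounded_lebesgue_lty => //.
  have [M [Mr HM]] := compact_bounded (@compact_cbox _ _ a b).
  by exists M; split => // y My x [Bx _]; apply: HM => //; exact: box_sub_cbox.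
have [B [mB EB nullB]] := lebesgue_borel_cover mE Eoo.
have := integral_borel_box_eq0 lf f0 abO mB.
have mBB : measurable (B `&` B0 : set (rV_lebesgue R n)).
  by apply: measurableI => //; exact: borel_lebesgue_measurable.
have mN : measurable (B `\` E : set (rV_lebesgue R n)).
  by apply: measurableD => //; exact: borel_lebesgue_measurable.
rewrite (negligible_integral mN)//; last first.
  exact: (integrableS mB0 mBB (@subIsetr _ _ _) iB0).
have -> : (B `&` B0) `\` (B `\` E) = E.
  apply/seteqP; split => x; last by move=> Ex; split; [split; [exact: EB|case: Ex]|case].
  by move=> [[Bx B0x] nx]; apply: contrapT => nE; apply: nx.
have iE : mu.-integrable E (EFin \o f) by apply: (integrableS mB0 mE _ iB0) => x [].
move=> H.
have : (\int[mu]_(x in E) `|(f x)%:E| = 0)%E.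
  rewrite -[RHS]H; apply: eq_integral => x /set_mem [_ fx].
  by rewrite gee0_abs// lee_fin ltW.
move/(ae_eq_integral_abs mu mE (measurable_int _ iE)).
apply: filterS => x H1 Bx; rewrite leNgt; apply/negP => fx.
have := H1 (conj Bx fx); move=> [] fx0.
by rewrite fx0 ltxx in fx.
Qed.

Lemma compact_closed_rV (K : set V) : compact K -> closed K.
Proof.
apply: compact_closed.
have H := @norm_hausdorff R V.
exact: H.
Qed.

Lemma closed_lebesgue_measurable (K : set V) : closed K ->
  measurable (K : set (rV_lebesgue R n)).
Proof.
move=> cK; rewrite -(setCK K); apply: measurableC; apply: borel_lebesgue_measurable.
by apply: open_borel; exact: closed_openC.
Qed.

Lemma test_fun_out (O : set V) phi x : test_fun O phi -> ~ O x -> phi x = 0.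
Proof.
move=> [_ _ sO] nO; apply/eqP/negPn/negP => px; apply: nO; apply: sO.
exact: subset_closure.
Qed.

Lemma test_fun_bounded (O : set V) phi : test_fun O phi ->
  exists2 C : R, 0 < C & forall x, `|phi x| <= C.
Proof.
move=> [sphi cphi sO].
have /compact_bounded[M [Mr HM]] : compact (phi @` closure [set x | phi x != 0]).
  apply: continuous_compact cphi; apply: continuous_subspaceT.
  exact: smooth_continuous.
exists (`|M| + 1); first by rewrite ltr_wpDl.
move=> x; have [->|px] := eqVneq (phi x) 0.
  by rewrite normr0 addr_ge0.
apply: HM; first by rewrite (le_lt_trans (ler_norm _))// ltrDl.
by exists x => //; exact: subset_closure.
Qed.

Lemma integrable_L1loc_test (O : set V) (f phi : V -> R) :
  measurable (O : set (rV_lebesgue R n)) -> L1loc O f ->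
  test_fun O phi -> mu.-integrable O (EFin \o (fun x => f x * phi x)).
Proof.
move=> mO lf tphi; have [C C0 HC] := test_fun_bounded tphi.
have [sphi cphi sO] := tphi.
set K := closure _ in cphi sO.
have mK : measurable (K : set (rV_lebesgue R n)).
  by apply: closed_lebesgue_measurable; exact: closed_closure.
have iK : mu.-integrable K (EFin \o (fun x => f x * phi x)).
  apply: (integrable_mul_bounded mK (lf K cphi sO) (C := C)) => [|x _]; last exact: HC.
  exact: (measurable_fun_lebesgue (measurable_smooth sphi)).
apply/(integrable_mkcond _ mO).2.
move: iK => /(integrable_mkcond _ mK).1.
rewrite (_ : _ \_ K = (EFin \o (fun x => f x * phi x)) \_ O)//.
apply/funext => x; rewrite !patchE; case: ifPn => xK; case: ifPn => xO //.
- by move: xO; rewrite notin_setE => -[]; apply: sO; exact/set_mem.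
- suff px0 : phi x = 0 by rewrite /= px0 mulr0.
  apply/eqP/negPn/negP => px; move: xK; rewrite notin_setE; apply.
  exact: subset_closure.
Qed.

Lemma box_eq0 (O : set V) (f : V -> R) (a b : 'I_n -> R) :
  measurable (O : set (rV_lebesgue R n)) ->
  L1loc O f -> (forall phi, test_fun O phi -> \int[mu]_(x in O) (f x * phi x) = 0) ->
  cbox a b `<=` O -> \forall x \ae mu, box a b x -> f x = 0.
Proof.
move=> mO lf f0 abO.
have lNf : L1loc O (fun x => -1 * f x).
  move=> K cK KO; apply: integrable_scale; last exact: lf.
  apply: closed_lebesgue_measurable.
  exact: compact_closed_rV.
have Nf0 phi : test_fun O phi -> \int[mu]_(x in O) (-1 * f x * phi x) = 0.
  move=> tphi; under eq_Rintegral do rewrite -mulrA.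
  rewrite RintegralZl//; last exact: integrable_L1loc_test.
  by rewrite f0// mulr0.
have h1 := box_le0 lf f0 abO; have h2 := box_le0 lNf Nf0 abO.
apply: filterS2 h1 h2 => x f1 f2 xab; apply/eqP; rewrite eq_le f1//=.
by rewrite -oppr_le0 -mulN1r f2.
Qed.

(** The fundamental lemma of the calculus of variations: O is a countable union of
boxes whose closures are contained in O. *)
Lemma L1loc_ae_eq0 (O : set V) (f : V -> R) : open O ->
  L1loc O f -> (forall phi, test_fun O phi -> \int[mu]_(x in O) (f x * phi x) = 0) ->
  \forall x \ae mu, O x -> f x = 0.
Proof.
move=> oO lf f0.
have mO := borel_lebesgue_measurable (open_borel oO).
have [D [c [r [r0 OE HD]]]] := open_countable_ball_cover oO.
pose a k i := c k ord0 i - r k; pose b k i := c k ord0 i + r k.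
have H k : \forall x \ae mu, D k -> box (a k) (b k) x -> f x = 0.
  have [Dk|nDk] := pselect (D k); last by apply: nearW.
  have abO : cbox (a k) (b k) `<=` O.
    by move=> x xab; apply: (HD k Dk) => i; rewrite distrC ler_distl; exact: xab.
  by have h := box_eq0 mO lf f0 abO; apply: filterS h => x hx _; exact: hx.
apply: filterS (ae_foralln H) => x Hx; rewrite OE => -[k Dk].
move=> /(rV_ballP _ _ (r0 k)) xk; apply: (Hx k Dk) => i.
by rewrite /a /b -ltr_distl distrC; exact: xk.
Qed.

End weak_derivative_unique.

(** * Weak derivatives of integrable functions *)

Section weak_calculus.
Variables (R : realType) (n : nat).
Local Notation V := 'rV[R]_n.
Notation mu := (lebesgue_rV R n).
Variable O : set V.
Hypothesis oO : open O.
Hypothesis Ofin : (mu O < +oo)%E.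
Implicit Types (v w phi psi : V -> R) (k : 'I_n).

Lemma open_lebesgue_measurable : measurable (O : set (rV_lebesgue R n)).
Proof. exact: (borel_lebesgue_measurable (open_borel oO)). Qed.
Let mO := open_lebesgue_measurable.
Let cmu := @lebesgue_rV_complete R n.
Local Notation I f := (mu.-integrable O (EFin \o f)).

Lemma integrable_L1loc v : I v -> L1loc O v.
Proof.
move=> iv K cK KO; apply: (integrableS mO _ KO iv).
by apply: closed_lebesgue_measurable; exact: compact_closed_rV.
Qed.

Lemma bounded_integrable v C : measurable_fun (O : set (rV_lebesgue R n)) v ->
  (forall x, O x -> `|v x| <= C) -> I v.
Proof.
move=> mv vC; apply: (measurable_bounded_integrable mO Ofin mv).
exists C; split; first exact: num_real.
by move=> x Cx y Oy; exact: le_trans (vC y Oy) (ltW Cx).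
Qed.

(** Weak derivatives of integrable functions, with an explicit integrable
representative. Unlike the representative chosen by [wD], explicit ones are
compatible with sums, multiples and compositions. *)
Definition wder k v (g : V -> R) := [/\ I v, I g & forall phi, test_fun O phi ->
  \int[mu]_(x in O) (v x * partial k phi x) = - \int[mu]_(x in O) (g x * phi x)].

Lemma wder_weak_derivative k v g : wder k v g -> weak_derivative O k v g.
Proof. by move=> [iv ig H]; split => //; exact: integrable_L1loc. Qed.

Lemma test_fun_measurable phi : test_fun O phi ->
  measurable_fun (O : set (rV_lebesgue R n)) phi.
Proof. by move=> [sphi _ _]; exact: (measurable_fun_lebesgue (measurable_smooth sphi)). Qed.

Lemma test_fun_integrable phi : test_fun O phi -> I phi.
Proof.
move=> tphi; have [C C0 HC] := test_fun_bounded tphi.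
by apply: (bounded_integrable (C := C)) => [|x _]; [exact: test_fun_measurable|exact: HC].
Qed.

Lemma test_fun_sub_supp phi psi : test_fun O phi -> smooth psi ->
  (forall x, psi x != 0 -> closure [set x | phi x != 0] x) -> test_fun O psi.
Proof.
move=> [sphi cphi phiO] spsi H.
have cl : closure [set x | psi x != 0] `<=` closure [set x | phi x != 0].
  rewrite [X in _ `<=` X](closure_id _).1; last exact: closed_closure.
  exact: closure_subset.
split => //; last exact: subset_trans cl phiO.
by apply: (subclosed_compact _ cphi cl); exact: closed_closure.
Qed.

Lemma test_fun_partial phi k : test_fun O phi -> test_fun O (partial k phi).
Proof.
move=> tphi; have [sphi _ _] := tphi.
apply: (test_fun_sub_supp tphi); first exact: smooth_partial.
move=> x; apply: contra_neqP => nx; exact: partial_out.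
Qed.

Lemma test_fun_add phi psi : test_fun O phi -> test_fun O psi ->
  test_fun O (phi \+ psi).
Proof.
move=> [s1 c1 O1] [s2 c2 O2].
have cU := compactU c1 c2.
have cl : closure [set x | (phi \+ psi) x != 0] `<=`
    closure [set x | phi x != 0] `|` closure [set x | psi x != 0].
  rewrite -closureU; apply: closure_subset => x /=.
  have [->|px] := eqVneq (phi x) 0; first by rewrite add0r; right.
  by left.
split; first exact: smoothD.
- by apply: (subclosed_compact _ cU cl); exact: closed_closure.
- by move=> x /cl[/O1|/O2].
Qed.

Lemma test_fun_comp (H : R -> R) phi : H 0 = 0 -> smooth (H \o phi) ->
  test_fun O phi -> test_fun O (H \o phi).
Proof.
move=> H0 sH tphi; apply: (test_fun_sub_supp tphi) => // x /= hx.
by apply: subset_closure; apply: contra_neq hx => ->.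
Qed.

Lemma test_fun_scale c phi : test_fun O phi -> test_fun O (fun x => c * phi x).
Proof.
move=> tphi; have [sphi _ _] := tphi.
apply: (test_fun_sub_supp tphi); first exact: smoothZ.
by move=> x cx; apply: subset_closure; apply: contra_neq cx => ->; rewrite mulr0.
Qed.

Lemma integrable_test v phi : I v -> test_fun O phi -> I (fun x => v x * phi x).
Proof.
move=> iv tphi; apply: integrable_L1loc_test => //; exact: integrable_L1loc.
Qed.

Lemma weak_derivative_unique k v g1 g2 :
  weak_derivative O k v g1 -> weak_derivative O k v g2 ->
  \forall x \ae mu, O x -> g1 x = g2 x.
Proof.
move=> [lv l1 H1] [_ l2 H2].
have ldiff : L1loc O (fun x => g1 x - g2 x).
  move=> K cK KO; apply: integrable_sub; [|exact: l1|exact: l2].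
  by apply: closed_lebesgue_measurable; exact: compact_closed_rV.
have H phi : test_fun O phi -> \int[mu]_(x in O) ((g1 x - g2 x) * phi x) = 0.
  move=> tphi; under eq_Rintegral do rewrite mulrBl.
  rewrite RintegralB//; [|exact: integrable_L1loc_test..].
  by apply/eqP; rewrite subr_eq0 -eqr_opp -H1// -H2.
have := L1loc_ae_eq0 oO ldiff H.
by apply: filterS => x h Ox; apply/eqP; rewrite -subr_eq0 h.
Qed.

Lemma wD_weak_derivative k v g : weak_derivative O k v g ->
  weak_derivative O k v (wD O k v).
Proof. by move=> H; rewrite /wD; apply: xgetPex; exists g. Qed.

Lemma wD_ae_eq k v g : weak_derivative O k v g ->
  \forall x \ae mu, O x -> wD O k v x = g x.
Proof. by move=> H; exact: (weak_derivative_unique (wD_weak_derivative H) H). Qed.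

Lemma LpP r v : 1 <= r -> Lp O r v <->
  measurable_fun (O : set (rV_lebesgue R n)) v /\
  mu.-integrable O (EFin \o (fun x => `|v x| `^ r)).
Proof.
move=> r1; have r0 : 0 < r := lt_le_trans ltr01 r1.
have E : (EFin \o (fun x => `|v x| `^ r)) \_ O = fun x => (`|(v \_ O) x| `^ r)%:E.
  apply/funext => x; rewrite !patchE; case: ifPn => // _.
  by rewrite normr0 powR0// gt_eqF.
split => [Lv|[mv iv]].
  have := Lfun_integrable r1 Lv; rewrite -E => /(integrable_mkcond _ mO).2 iv.
  split => //; move: Lv; rewrite /Lp /= inE => /andP[/[!inE] mv _].
  exact/(measurable_restrictT _ mO).2.
rewrite /Lp /= inE; apply/andP; split; rewrite inE /=.
  exact/(measurable_restrictT _ mO).1.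
rewrite /finite_norm unlock /Lnorm; apply: poweR_lty.
move: iv => /(integrable_mkcond _ mO).1; rewrite E => /integrableP[_].
by under eq_integral do rewrite gee0_abs ?lee_fin ?powR_ge0//.
Qed.

Lemma Lp1P v : Lp O 1 v <-> I v.
Proof.
rewrite LpP//; split => [[mv]|iv].
  have E : (fun x => `|v x| `^ 1) = Num.norm \o v.
    by apply/funext => x; rewrite powRr1.
  rewrite E => iv; apply: (integrable_dominated mO mv iv).
  by apply: nearW => x Ox /=.
split; first exact: (integrable_measurable iv).
rewrite (_ : (fun x => _) = Num.norm \o v); first exact: (integrable_norm iv).
by apply/funext => x; rewrite powRr1.
Qed.

Lemma W11_wder v k : W11 O v -> wder k v (wD O k v).
Proof.
move=> [/Lp1P iv H]; have [[g Hg] /Lp1P ig] := H k.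
have [_ _ E] := wD_weak_derivative Hg.
by split.
Qed.

Lemma wder_wD k v g : wder k v g -> \forall x \ae mu, O x -> wD O k v x = g x.
Proof. by move=> /wder_weak_derivative; exact: wD_ae_eq. Qed.

Lemma wder_wD_wder k v g : wder k v g -> wder k v (wD O k v).
Proof.
move=> H; have Hg := wder_wD H; have [iv ig E] := H.
have ig' : I (wD O k v).
  by apply: (integrable_ae_eq cmu mO _ ig); apply: filterS Hg => x h Ox; rewrite h.
split => //.
by have [_ _] := wD_weak_derivative (wder_weak_derivative H).
Qed.

Lemma wder_W11 v (g : 'I_n -> V -> R) : I v -> (forall k, wder k v (g k)) -> W11 O v.
Proof.
move=> iv H; split; first exact/Lp1P.
move=> k; split; first by exists (g k); exact: wder_weak_derivative.
by apply/Lp1P; have [_ ig _] := wder_wD_wder (H k).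
Qed.

Lemma wder_add k v w g h : wder k v g -> wder k w h ->
  wder k (fun x => v x + w x) (fun x => g x + h x).
Proof.
move=> [iv ig Hv] [iw ih Hw]; split; [exact: integrable_add..|].
move=> phi tphi.
under eq_Rintegral do rewrite mulrDl; under [in RHS]eq_Rintegral do rewrite mulrDl.
have tk := test_fun_partial k tphi.
rewrite RintegralD//; [|exact: integrable_test..].
rewrite RintegralD//; [|exact: integrable_test..].
by rewrite Hv// Hw// opprD.
Qed.

Lemma wder_scale k c v g : wder k v g ->
  wder k (fun x => c * v x) (fun x => c * g x).
Proof.
move=> [iv ig Hv]; split; [exact: integrable_scale..|].
move=> phi tphi; have tk := test_fun_partial k tphi.
under eq_Rintegral do rewrite -mulrA; under [in RHS]eq_Rintegral do rewrite -mulrA.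
rewrite RintegralZl//; last exact: integrable_test.
rewrite RintegralZl//; last exact: integrable_test.
by rewrite Hv// mulrN.
Qed.

Lemma wder_ae k v w g h : (\forall x \ae mu, O x -> v x = w x) ->
  (\forall x \ae mu, O x -> g x = h x) -> wder k v g -> wder k w h.
Proof.
move=> vw gh [iv ig H].
have iw := integrable_ae_eq cmu mO vw iv; have ih := integrable_ae_eq cmu mO gh ig.
split => // phi tphi; have tk := test_fun_partial k tphi.
rewrite -(Rintegral_ae_eq mO (integrable_test iv tk) (integrable_test iw tk)); last first.
  by apply: filterS vw => x h1 Ox; rewrite h1.
rewrite H//; congr (- _); apply: (Rintegral_ae_eq mO); [exact: integrable_test..|].
by apply: filterS gh => x h1 Ox; rewrite h1.
Qed.

Lemma integral_partial_eq0 phi k : test_fun O phi ->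
  \int[mu]_(x in O) partial k phi x = 0.
Proof.
move=> tphi; have [sphi cphi sO] := tphi.
have mp : measurable_fun [set: V] (fun x => (partial k phi x)%:E).
  by apply/measurable_EFinP; exact: (measurable_smooth (smooth_partial k sphi)).
have tk := test_fun_partial k tphi.
rewrite Rintegral_mkcond (_ : _ \_ O = partial k phi); last first.
  apply/funext => x; rewrite patchE; case: ifPn => //; rewrite notin_setE => nO.
  by rewrite (test_fun_out tk nO).
rewrite /Rintegral integralE.
rewrite ge0_integral_borel//; last exact: measurable_funepos.
rewrite ge0_integral_borel//; last exact: measurable_funeneg.
rewrite integral_partial_pos_neg//.
by case: integral => //= r; rewrite subrr.
Qed.

(** The partial derivatives of the product with another test function have
integral 0. *)
Lemma wder_test phi k : test_fun O phi -> wder k phi (partial k phi).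
Proof.
move=> tphi; have tk := test_fun_partial k tphi.
split; [exact: test_fun_integrable..|] => eta teta.
have tketa := test_fun_partial k teta.
have [sphi _ _] := tphi; have [seta _ _] := teta.
have tM : test_fun O (phi \* eta).
  apply: (test_fun_sub_supp tphi); first exact: smoothM.
  by move=> x px; apply: subset_closure; apply: contra_neq px => /= ->; rewrite mul0r.
have := integral_partial_eq0 k tM.
rewrite (_ : partial k (phi \* eta) = fun x => phi x * partial k eta x + partial k phi x * eta x); last first.
  apply/funext => x; rewrite partialM; [|exact: smooth_derivable..].
  by rewrite [eta x * _]mulrC.
rewrite RintegralD//; last 2 first.
- by apply: integrable_test => //; exact: test_fun_integrable.
- by apply: integrable_test => //; exact: test_fun_integrable.
by move/eqP; rewrite addr_eq0 => /eqP.
Qed.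

End weak_calculus.

(** * Limits of test functions and the chain rule *)

Section sobolev_approx.
Variables (R : realType) (n : nat).
Local Notation V := 'rV[R]_n.
Notation mu := (lebesgue_rV R n).
Variable O : set V.
Hypothesis oO : open O.
Hypothesis Ofin : (mu O < +oo)%E.
Implicit Types (v w phi psi : V -> R) (k : 'I_n) (g h : 'I_n -> V -> R).
Let mO := open_lebesgue_measurable oO.
Let cmu := @lebesgue_rV_complete R n.
Local Notation I f := (mu.-integrable O (EFin \o f)).

(** The distance in W^{1,1}, for given gradients. *)
Definition w11_dist v g w h : R :=
  \int[mu]_(x in O) (`|v x - w x| + \sum_k `|g k x - h k x|).

Definition gradient phi : 'I_n -> V -> R := fun k => partial k phi.

(** The pair (v, g) is a limit of test functions and their gradients in W^{1,1}:
this is [W011] with an explicit gradient, see [W011_w011] and [w011_W011]. *)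
Definition w011 v g := (forall k, wder O k v (g k)) /\ I v /\
  forall e : R, 0 < e -> exists2 phi, test_fun O phi &
    w11_dist v g phi (gradient phi) < e.

Lemma integrable_normr (u : V -> R) : I u -> I (fun x => `|u x|).
Proof. by move=> iu; exact: (integrable_norm iu). Qed.

Lemma integrable_w11_dist v g w h : I v -> I w -> (forall k, I (g k)) ->
  (forall k, I (h k)) ->
  I (fun x => `|v x - w x| + \sum_k `|g k x - h k x|).
Proof.
move=> iv iw ig ih; apply: integrable_add => //.
  by apply: integrable_normr; exact: integrable_sub.
apply: integrable_bigsum => // k; apply: integrable_normr; exact: integrable_sub.
Qed.

(** A test function and its derivatives are bounded, so that both sides of the
identity that defines the weak derivative are continuous in L^1. *)
Lemma wder_closed k v (g : V -> R) : I v -> I g ->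
  (forall e : R, 0 < e -> exists v' (g' : V -> R), wder O k v' g' /\
    \int[mu]_(x in O) (`|v x - v' x| + `|g x - g' x|) < e) -> wder O k v g.
Proof.
move=> iv ig H; split => // phi tphi.
have tk := test_fun_partial k tphi.
have [C1 C10 HC1] := test_fun_bounded tphi.
have [C2 C20 HC2] := test_fun_bounded tk.
apply/eqP; rewrite -subr_eq0 opprK; apply/eqP.
have ivk := integrable_test oO iv tk; have igp := integrable_test oO ig tphi.
apply/normr0_eq0; apply/eqP; rewrite eq_le normr_ge0 andbT.
apply/ler_addgt0Pr => e e0; rewrite add0r.
have C0 : 0 < C1 + C2 by rewrite addr_gt0.
have [v' [g' [[iv' ig' E] d]]] := H (e / (C1 + C2)) (divr_gt0 e0 C0).
have ivk' := integrable_test oO iv' tk; have igp' := integrable_test oO ig' tphi.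
have -> : \int[mu]_(x in O) (v x * partial k phi x) + \int[mu]_(x in O) (g x * phi x) =
   \int[mu]_(x in O) ((v x - v' x) * partial k phi x + (g x - g' x) * phi x).
  transitivity (\int[mu]_(x in O) (v x * partial k phi x - v' x * partial k phi x) +
     \int[mu]_(x in O) (g x * phi x - g' x * phi x)).
    rewrite RintegralB// RintegralB// E// opprK; lra.
  rewrite -RintegralD//; [|exact: integrable_sub..].
  by apply: eq_Rintegral => x _; rewrite !mulrBl.
have iA : I (fun x => (v x - v' x) * partial k phi x + (g x - g' x) * phi x).
  apply: integrable_add => //; apply: integrable_test => //; exact: integrable_sub.
have iB : I (fun x => `|v x - v' x| + `|g x - g' x|).
  by apply: integrable_add => //; apply: integrable_normr; exact: integrable_sub.
apply: (le_trans (le_normr_Rintegral mO iA)).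
apply: (@le_trans _ _ (\int[mu]_(x in O) ((C1 + C2) * (`|v x - v' x| + `|g x - g' x|)))).
  apply: le_Rintegral => //; [exact: integrable_normr|exact: integrable_scale|].
  move=> x Ox; rewrite (le_trans (ler_normD _ _))// !normrM mulrDr.
  apply: lerD; rewrite mulrC ler_wpM2r//.
    by rewrite (le_trans (HC2 x))// lerDr ltW.
  by rewrite (le_trans (HC1 x))// lerDl ltW.
rewrite RintegralZl// mulrC -ler_pdivlMr//; exact: ltW.
Qed.

Lemma w011_wder v g : w011 v g -> forall k, wder O k v (g k).
Proof. by case. Qed.

Lemma w011_integrable v g : w011 v g -> I v /\ forall k, I (g k).
Proof. by move=> [H [iv _]]; split=> // k; have [_ ? _] := H k. Qed.

Lemma w011_add v g w h : w011 v g -> w011 w h ->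
  w011 (fun x => v x + w x) (fun k x => g k x + h k x).
Proof.
move=> [dv [iv av]] [dw [iw aw]]; split; first by move=> k; exact: wder_add.
split; first exact: integrable_add.
move=> e e0; have e20 : 0 < e / 2 by rewrite divr_gt0.
have [phi tphi dphi] := av _ e20; have [psi tpsi dpsi] := aw _ e20.
exists (phi \+ psi); first exact: test_fun_add.
have ig k : I (g k) by have [_ ? _] := dv k.
have ih k : I (h k) by have [_ ? _] := dw k.
have iphi := test_fun_integrable oO Ofin tphi; have ipsi := test_fun_integrable oO Ofin tpsi.
have igphi k : I (gradient phi k).
  by apply: (test_fun_integrable oO Ofin); exact: test_fun_partial.
have igpsi k : I (gradient psi k).
  by apply: (test_fun_integrable oO Ofin); exact: test_fun_partial.
have igs k : I (gradient (phi \+ psi) k).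
  by apply: (test_fun_integrable oO Ofin); apply: test_fun_partial; exact: test_fun_add.
rewrite [e]splitr; apply: le_lt_trans (ltrD dphi dpsi).
rewrite /w11_dist -RintegralD//; [|exact: integrable_w11_dist..].
apply: le_Rintegral => //.
- by apply: integrable_w11_dist => //; [exact: integrable_add..|move=> k; exact: integrable_add].
- by apply: integrable_add => //; exact: integrable_w11_dist.
move=> x Ox; rewrite addrACA -big_split /=; apply: lerD.
  by rewrite opprD addrACA ler_normD.
have [s1 _ _] := tphi; have [s2 _ _] := tpsi.
apply: ler_sum => k _; rewrite /gradient partialD; [|exact: smooth_derivable..].
by rewrite opprD addrACA ler_normD.
Qed.

Lemma w011_scale c v g : w011 v g -> w011 (fun x => c * v x) (fun k x => c * g k x).
Proof.
move=> [dv [iv av]]; split; first by move=> k; exact: wder_scale.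
split; first exact: integrable_scale.
move=> e e0; have c0 : 0 < `|c| + 1 by rewrite ltr_wpDl.
have [phi tphi dphi] := av _ (divr_gt0 e0 c0).
exists (fun x => c * phi x); first exact: test_fun_scale.
have ig k : I (g k) by have [_ ? _] := dv k.
have iphi := test_fun_integrable oO Ofin tphi.
have igphi k : I (gradient phi k).
  by apply: (test_fun_integrable oO Ofin); exact: test_fun_partial.
have [s1 _ _] := tphi.
have gE k x : gradient (fun x => c * phi x) k x = c * gradient phi k x.
  have dp : derivable phi x (ebase R k) by exact: smooth_derivable.
  have := partialM (@derivable_cst _ _ _ c x (ebase R k)) dp.
  by rewrite partial_cst mulr0 addr0.
have d : (`|c| + 1) * w11_dist v g phi (gradient phi) < e.
  by rewrite mulrC -ltr_pdivlMr.
refine (le_lt_trans _ d) => {d}.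
rewrite /w11_dist -RintegralZl//; last exact: integrable_w11_dist.
apply: le_Rintegral => //.
- apply: integrable_w11_dist => //; [exact: integrable_scale..| |].
    by move=> k; exact: integrable_scale.
  move=> k; apply: (test_fun_integrable oO Ofin); apply: test_fun_partial.
  exact: test_fun_scale.
- by apply: integrable_scale => //; exact: integrable_w11_dist.
move=> x Ox; rewrite mulrDr mulr_sumr; apply: lerD.
  by rewrite -mulrBr normrM ler_wpM2r// lerDl.
apply: ler_sum => k _; rewrite gE -mulrBr normrM ler_wpM2r// lerDl //.
Qed.

Lemma w011_sub v g w h : w011 v g -> w011 w h ->
  w011 (fun x => v x - w x) (fun k x => g k x - h k x).
Proof.
move=> H1 H2; have := w011_add H1 (w011_scale (-1) H2).
have -> : (fun x => v x + -1 * w x) = (fun x => v x - w x).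
  by apply/funext => x; rewrite mulN1r.
suff -> : (fun k x => g k x + -1 * h k x) = (fun k x => g k x - h k x) by [].
by apply/funext => k; apply/funext => x; rewrite mulN1r.
Qed.

Lemma w11_dist_norm v g phi : I v -> (forall k, wder O k v (g k)) ->
  test_fun O phi ->
  W11_norm O (v \- phi)%R = (w11_dist v g phi (gradient phi))%:E.
Proof.
move=> iv dv tphi.
have iphi := test_fun_integrable oO Ofin tphi.
have igphi k : I (gradient phi k).
  by apply: (test_fun_integrable oO Ofin); exact: test_fun_partial.
have ig k : I (g k) by have [_ ? _] := dv k.
have normE (u : V -> R) : I u ->
    Lnorm mu 1 (EFin \o (u \_ O)) = (\int[mu]_(x in O) `|u x|)%:E.
  move=> iu; rewrite Lnorm1 (Rintegral_EFin mO (integrable_normr iu)).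
  rewrite [RHS]integral_mkcond; apply: eq_integral => x _ /=.
  by rewrite !patchE; case: ifPn => //; rewrite normr0.
have dd k : wder O k (v \- phi) (fun x => g k x - gradient phi k x).
  have := wder_add oO (dv k) (wder_scale oO (-1) (wder_test oO Ofin k tphi)).
  have -> : (fun x => v x + -1 * phi x) = (v \- phi).
    by apply/funext => x; rewrite mulN1r.
  suff -> : (fun x => g k x + -1 * partial k phi x) = (fun x => g k x - gradient phi k x) by [].
  by apply/funext => x; rewrite mulN1r.
have ivphi : I (v \- phi) by exact: (integrable_sub mO iv iphi).
have igk k : I (fun x => g k x - gradient phi k x) by exact: (integrable_sub mO).
have iwD k : I (wD O k (v \- phi)).
  by have [_ ? _] := wder_wD_wder oO (dd k).
have wDE k : \int[mu]_(x in O) `|wD O k (v \- phi) x| =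
             \int[mu]_(x in O) `|g k x - gradient phi k x|.
  apply: (Rintegral_ae_eq mO); [exact: integrable_normr..|].
  by have := wder_wD oO (dd k); apply: filterS => x hx Ox; rewrite hx.
rewrite /W11_norm normE// (eq_bigr (fun k => (\int[mu]_(x in O) `|g k x - gradient phi k x|)%:E)); last first.
  by move=> k _; rewrite normE// wDE.
rewrite sumEFin -EFinD; congr EFin.
rewrite /w11_dist RintegralD//; last 2 first.
- exact: integrable_normr.
- by apply: integrable_bigsum => // k; exact: integrable_normr.
by congr (_ + _); rewrite Rintegral_bigsum// => k; exact: integrable_normr.
Qed.

Lemma W011_w011 v : W011 O v -> w011 v (fun k => wD O k v).
Proof.
move=> [W H]; have dv k := W11_wder oO k W.
have iv : I v by have [/(Lp1P oO)] := W.
split => //; split => // e e0.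
have [phi tphi d] := H _ e0; exists phi => //.
by move: d; rewrite (w11_dist_norm iv dv tphi) lte_fin.
Qed.

Lemma w011_W011 v g : w011 v g -> W011 O v.
Proof.
move=> [dv [iv H]]; split; first exact: (wder_W11 oO iv dv).
move=> e e0; have [phi tphi d] := H _ e0; exists phi => //.
by rewrite (w11_dist_norm iv dv tphi) lte_fin.
Qed.

(** A smooth truncation H, with derivative H1. The Lipschitz bound on H1 serves to
compare H1 (v x) with H1 (phi x) in the chain rule, and [soft_cut_smooth] to
keep H \o phi a test function. *)
Record soft_cut (H H1 : R -> R) (L : R) : Prop := SoftCut {
  soft_cut0 : H 0 = 0;
  soft_cut_derive : forall x : R, is_derive x 1 H (H1 x);
  soft_cut_ge0 : forall x, 0 <= H1 x;
  soft_cut_le1 : forall x, H1 x <= 1;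
  soft_cut_lip : forall x y, `|H1 x - H1 y| <= L * `|x - y|;
  soft_cut_smooth : forall phi, smooth phi -> smooth (H \o phi) }.

Section chain_rule.
Variables (H H1 : R -> R) (L : R).
Hypothesis cutH : soft_cut H H1 L.

Let dH := soft_cut_derive cutH.

Lemma soft_cut_contract x y : `|H x - H y| <= `|x - y|.
Proof.
wlog xy : x y / y < x.
  move=> W; have [xy|xy|->] := ltgtP x y; last by rewrite subrr normr0.
    by rewrite distrC [leRHS]distrC; exact: W.
  exact: W.
have cH : {within `[y, x], continuous H}.
  apply: continuous_subspaceT => z; apply: differentiable_continuous.
  by apply/derivable1_diffP; exact: (ex_derive (is_derive := dH z)).
have [c _ ->] := MVT xy (fun z _ => dH z) cH.
rewrite normrM ler_piMl// ger0_norm; first exact: soft_cut_le1 cutH _.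
exact: soft_cut_ge0 cutH _.
Qed.

Lemma soft_cut_continuous : continuous H.
Proof.
move=> z; apply: differentiable_continuous.
by apply/derivable1_diffP; exact: (ex_derive (is_derive := dH z)).
Qed.

Lemma soft_cut_lip_gt0 : exists2 L', 0 < L' & forall x y, `|H1 x - H1 y| <= L' * `|x - y|.
Proof.
exists (`|L| + 1); first by rewrite ltr_wpDl.
move=> x y; apply: (le_trans (soft_cut_lip cutH x y)); rewrite ler_wpM2r//.
by rewrite (le_trans (ler_norm _))// lerDl.
Qed.

Lemma soft_cut_derive_continuous : continuous H1.
Proof.
have [L' L'0 HL] := soft_cut_lip_gt0.
move=> x; apply/cvgrPdist_lt => e e0.
near=> y; apply: (le_lt_trans (HL x y)).
rewrite mulrC -ltr_pdivlMr//; near: y.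
apply/nbhs_ballP; exists (e / L'); first by rewrite /= divr_gt0.
by move=> y.
Unshelve. all: by end_near.
Qed.

Lemma measurable_soft_cut v : measurable_fun (O : set (rV_lebesgue R n)) v ->
  measurable_fun (O : set (rV_lebesgue R n)) (H \o v).
Proof.
move=> mv; apply: (measurableT_comp _ mv).
by apply: continuous_measurable_fun; exact: soft_cut_continuous.
Qed.

Lemma measurable_soft_cut_derive v : measurable_fun (O : set (rV_lebesgue R n)) v ->
  measurable_fun (O : set (rV_lebesgue R n)) (H1 \o v).
Proof.
move=> mv; apply: (measurableT_comp _ mv).
by apply: continuous_measurable_fun; exact: soft_cut_derive_continuous.
Qed.

Lemma soft_cut_norm_le x : `|H1 x| <= 1.
Proof. by rewrite ger0_norm; [exact: soft_cut_le1 cutH _|exact: soft_cut_ge0 cutH _]. Qed.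

Lemma gradient_soft_cut phi k x : smooth phi ->
  gradient (H \o phi) k x = H1 (phi x) * gradient phi k x.
Proof.
move=> sphi; have dp : derivable phi x (ebase R k) by exact: smooth_derivable.
exact: (derive_val (is_derive := is_derive_comp (dH (phi x)) dp)).
Qed.

(** Let phi be a test function close to v. The gradients of H(v) and H(phi) differ
by H1(phi) (g - D phi) + (H1(v) - H1(phi)) g. The first term is small. In the
second one, |g| is compared with a large constant K: up to K the Lipschitz
bound on H1 gives at most L K |v - phi|, and the excess over K, multiplied by
2, has a small integral by [integrable_tail_small]. *)
Lemma w011_chain v g : w011 v g ->
  w011 (H \o v) (fun k x => H1 (v x) * g k x).
Proof.
move=> W; have [dv [iv av]] := W.
have ig k : I (g k) by have [_ ? _] := dv k.
have mv := integrable_measurable iv.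
have iHv : I (H \o v).
  apply: (integrable_dominated mO (measurable_soft_cut mv) (integrable_normr iv)).
  apply: nearW => x _ /=; have := soft_cut_contract (v x) 0.
  by rewrite (soft_cut0 cutH) !subr0.
have iHg k : I (fun x => H1 (v x) * g k x).
  under eq_fun do rewrite mulrC.
  apply: (integrable_mul_bounded mO (ig k) (measurable_soft_cut_derive mv) (C := 1)).
  by move=> x _; exact: soft_cut_norm_le.
have fin (e A B : R) : A < e / 2 -> B < e / 4 -> A + 2 * B < e by lra.
have approx (e : R) : 0 < e -> exists2 phi, test_fun O phi & test_fun O (H \o phi) /\
    w11_dist (H \o v) (fun k x => H1 (v x) * g k x) (H \o phi) (gradient (H \o phi)) < e.
  move=> e0; have [L' L'0 HL] := soft_cut_lip_gt0.
  pose G x := \sum_k `|g k x|.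
  have iG : I G by apply: integrable_bigsum => // k; exact: integrable_normr.
  have e4 : 0 < e / 4 by rewrite divr_gt0.
  have [K K0 HK] := integrable_tail_small mO iG e4.
  have C0 : 0 < 1 + L' * K by rewrite addr_gt0// mulr_gt0.
  have e2C : 0 < e / 2 / (1 + L' * K) by rewrite !divr_gt0.
  have [phi tphi dphi] := av _ e2C.
  have [sphi cphi _] := tphi.
  have tH : test_fun O (H \o phi).
    apply: (test_fun_comp (soft_cut0 cutH) _ tphi).
    exact: (soft_cut_smooth cutH).
  exists phi => //; split => //.
  have igphi k : I (gradient phi k).
    by apply: (test_fun_integrable oO Ofin); exact: test_fun_partial.
  have igHphi k : I (gradient (H \o phi) k).
    by apply: (test_fun_integrable oO Ofin); exact: test_fun_partial.
  have iphi := test_fun_integrable oO Ofin tphi.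
  have iHphi := test_fun_integrable oO Ofin tH.
  have iT : I (fun x => Num.max (`|G x| - K) 0).
    apply: (integrable_dominated mO _ (integrable_normr iG)).
      by apply: measurable_excess; exact: (integrable_measurable iG).
    apply: nearW => x _ /=; rewrite ger0_norm ?le_max ?lexx ?orbT//.
    by rewrite ge_max normr_ge0 andbT lerBlDr lerDl ltW.
  have iD := integrable_w11_dist iv iphi ig igphi.
  have bound : w11_dist (H \o v) (fun k x => H1 (v x) * g k x) (H \o phi) (gradient (H \o phi))
     <= (1 + L' * K) * w11_dist v g phi (gradient phi) + 2 * \int[mu]_(x in O) Num.max (`|G x| - K) 0.
    rewrite /w11_dist -RintegralZl// -RintegralZl// -RintegralD//; [|exact: integrable_scale..].
    apply: le_Rintegral => //.
    - exact: integrable_w11_dist.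
    - by apply: integrable_add => //; exact: integrable_scale.
    move=> x Ox.
    have G0 : 0 <= G x by apply: sumr_ge0 => k _.
    have s1 : \sum_k `|H1 (v x) * g k x - gradient (H \o phi) k x| <=
        \sum_k `|g k x - gradient phi k x| + `|H1 (v x) - H1 (phi x)| * G x.
      rewrite /G mulr_sumr -big_split; apply: ler_sum => k _ /=.
      rewrite gradient_soft_cut// -normrM.
      rewrite (_ : _ - _ = H1 (phi x) * (g k x - gradient phi k x) + (H1 (v x) - H1 (phi x)) * g k x); last lra.
      apply: (le_trans (ler_normD _ _)); rewrite lerD2r normrM ler_piMl//.
      exact: soft_cut_norm_le.
    have s2 : `|H1 (v x) - H1 (phi x)| * G x <=
        L' * K * `|v x - phi x| + 2 * Num.max (`|G x| - K) 0.
      have a1 : `|H1 (v x) - H1 (phi x)| <= 2.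
        apply: (le_trans (ler_normB _ _)).
        by rewrite -[leRHS]/(1 + 1) lerD ?soft_cut_norm_le.
      have a2 := HL (v x) (phi x).
      rewrite (ger0_norm G0); set M := Num.max _ _.
      have GM : G x <= K + M by rewrite -lerBlDl /M le_max lexx.
      have M0 : 0 <= M by rewrite /M le_max lexx orbT.
      apply: (@le_trans _ _ (`|H1 (v x) - H1 (phi x)| * (K + M))).
        by rewrite ler_wpM2l.
      rewrite mulrDr; apply: lerD; last by rewrite ler_wpM2r.
      by rewrite mulrAC ler_wpM2r// ltW.
    have s3 := soft_cut_contract (v x) (phi x).
    have s4 : 0 <= \sum_k `|g k x - gradient phi k x| by apply: sumr_ge0.
    have s5 : 0 <= L' * K * \sum_k `|g k x - gradient phi k x|.
      by rewrite !mulr_ge0// ltW.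
    rewrite /=; move: s1 s2 s3 s5; lra.
  apply: (le_lt_trans bound).
  have h1 : (1 + L' * K) * w11_dist v g phi (gradient phi) < e / 2.
    by rewrite mulrC -ltr_pdivlMr.
  exact: fin.
split.
  move=> k; apply: wder_closed => // e e0.
  have [phi tphi [tH d]] := approx _ e0.
  exists (H \o phi), (gradient (H \o phi) k); split; first exact: wder_test.
  apply: le_lt_trans d; apply: le_Rintegral => //.
  - have := wder_test oO Ofin k tH => -[i1 i2 _].
    by apply: integrable_add => //; apply: integrable_normr; exact: integrable_sub.
  - apply: integrable_w11_dist => //; first exact: test_fun_integrable.
    by move=> j; apply: (test_fun_integrable oO Ofin); exact: test_fun_partial.
  move=> x Ox; rewrite lerD2l (bigD1 k)//= lerDl.
  by apply: sumr_ge0.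
split => // e e0; have [phi tphi [tH d]] := approx _ e0.
by exists (H \o phi).
Qed.

End chain_rule.

End sobolev_approx.

(** * Smooth truncations and a Sobolev inequality for level sets *)

Section soft_abs.
Variables (R : realType) (e : R).
Hypothesis e0 : 0 < e.

(** A smooth approximation of the absolute value of s; its derivative [soft_sgn]
approximates the sign. *)
Definition soft_abs (s : R) : R := Num.sqrt (s ^+ 2 + e ^+ 2).
Definition soft_sgn (s : R) : R := s / soft_abs s.

Lemma soft_sq_gt0 s : 0 < s ^+ 2 + e ^+ 2.
Proof. by rewrite ltr_wpDl ?sqr_ge0// exprn_gt0. Qed.

Lemma soft_abs_gt0 s : 0 < soft_abs s.
Proof. by rewrite sqrtr_gt0 soft_sq_gt0. Qed.

Lemma soft_abs_sqr s : soft_abs s ^+ 2 = s ^+ 2 + e ^+ 2.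
Proof. by rewrite sqr_sqrtr// ltW// soft_sq_gt0. Qed.

Lemma soft_absN s : soft_abs (- s) = soft_abs s.
Proof. by rewrite /soft_abs sqrrN. Qed.

Lemma soft_abs_ge s : `|s| <= soft_abs s.
Proof.
rewrite -(@ler_pXn2r _ 2) ?nnegrE ?(ltW (soft_abs_gt0 s))//.
by rewrite soft_abs_sqr real_normK ?num_real// lerDl exprn_ge0// ltW.
Qed.

Lemma soft_abs_ge_eps s : e <= soft_abs s.
Proof.
rewrite -(@ler_pXn2r _ 2) ?nnegrE ?(ltW e0) ?(ltW (soft_abs_gt0 s))//.
by rewrite soft_abs_sqr lerDr sqr_ge0.
Qed.

Lemma soft_abs_le s : soft_abs s <= `|s| + e.
Proof.
rewrite -(@ler_pXn2r _ 2) ?nnegrE ?(addr_ge0 (normr_ge0 s) (ltW e0)) ?(ltW (soft_abs_gt0 s))//.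
rewrite soft_abs_sqr sqrrD real_normK ?num_real// -addrA lerD2l lerDr.
by rewrite mulrn_wge0// mulr_ge0// ltW.
Qed.

Lemma is_derive_soft_abs (s : R) : is_derive s 1 soft_abs (soft_sgn s).
Proof.
have d1 : is_derive s 1 (fun t : R => t ^+ 2 + e ^+ 2) (2 * s).
  have := is_deriveD (is_deriveX 2 (is_derive_id s (1 : R))) (is_derive_cst (e ^+ 2) s (1 : R)).
  move=> H; apply: (is_derive_eq H).
  by rewrite /= addr0 -[_ *: 1]/(_ * 1) mulr1 expr1.
have := @is_derive1_comp R Num.sqrt (fun t : R => t ^+ 2 + e ^+ 2) s _ _
  (is_derive1_sqrt (soft_sq_gt0 s)) d1.
move=> H; apply: (is_derive_eq H).
rewrite /soft_sgn -/(soft_abs s) invfM mulrACA mulVf ?pnatr_eq0// mul1r.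
exact: mulrC.
Qed.

Lemma is_derive_soft_absV (s : R) :
  is_derive s 1 (fun t => (soft_abs t)^-1) (- (s * (soft_abs s)^-1 ^+ 3)).
Proof.
have := is_deriveV (lt0r_neq0 (soft_abs_gt0 s)) (is_derive_soft_abs s).
move=> H; apply: (is_derive_eq H).
rewrite -[_ *: _]/(_ * _) mulNr; congr (- _).
by rewrite /soft_sgn exprVn !exprS expr0 mulr1 !invfM; rewrite mulrC -!mulrA.
Qed.

Lemma is_derive_soft_sgn (s : R) :
  is_derive s 1 soft_sgn (e ^+ 2 * (soft_abs s)^-1 ^+ 3).
Proof.
have := is_deriveM (is_derive_id s (1 : R)) (is_derive_soft_absV s).
move=> H; apply: (is_derive_eq H).
have h := lt0r_neq0 (soft_abs_gt0 s).
rewrite /= -![_ *: _]/(_ * _) mulr1.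
have E : e ^+ 2 = soft_abs s ^+ 2 - s ^+ 2 by rewrite soft_abs_sqr; lra.
rewrite E mulrBl [X in _ = X - _](_ : _ = (soft_abs s)^-1); last first.
  by rewrite [X in _ * X]exprS mulrCA -exprMn mulfV// expr1n mulr1.
by rewrite mulrN addrC mulrA -expr2.
Qed.

Lemma soft_sgn_norm_le1 s : `|soft_sgn s| <= 1.
Proof.
rewrite normrM normfV (gtr0_norm (soft_abs_gt0 s)).
by rewrite ler_pdivrMr ?soft_abs_gt0// mul1r soft_abs_ge.
Qed.

Lemma soft_sgnN s : soft_sgn (- s) = - soft_sgn s.
Proof. by rewrite /soft_sgn soft_absN mulNr. Qed.

Lemma soft_sgn_MVT (x y : R) : y < x ->
  exists2 c : R, 0 <= c <= e^-1 & soft_sgn x - soft_sgn y = c * (x - y).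
Proof.
move=> yx.
have cf : {within `[y, x], continuous soft_sgn}.
  apply: continuous_subspaceT => z; apply: differentiable_continuous.
  by apply/derivable1_diffP; exact: (ex_derive (is_derive := is_derive_soft_sgn z)).
have [c _ ->] := MVT yx (fun z _ => is_derive_soft_sgn z) cf.
exists (e ^+ 2 * (soft_abs c)^-1 ^+ 3) => //.
have a0 := soft_abs_gt0 c; have ae := soft_abs_ge_eps c.
apply/andP; split.
  by rewrite mulr_ge0 ?exprn_ge0 ?invr_ge0 ?ltW.
have vle : (soft_abs c)^-1 <= e^-1 by rewrite lef_pV2 ?posrE.
have v0 : 0 <= (soft_abs c)^-1 by rewrite invr_ge0 ltW.
apply: (@le_trans _ _ (e ^+ 2 * e^-1 ^+ 3)).
  apply: ler_wpM2l; first exact: sqr_ge0.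
  by apply: lerXn2r => //; rewrite nnegrE invr_ge0 (ltW e0).
by rewrite (exprSr e^-1 2) mulrA -exprMn mulfV ?gt_eqF// expr1n mul1r.
Qed.

Lemma soft_sgn_le (x y : R) : y <= x -> soft_sgn y <= soft_sgn x.
Proof.
rewrite le_eqVlt => /predU1P[->//|yx].
have [c /andP[c0 _] E] := soft_sgn_MVT yx.
by rewrite -subr_ge0 E mulr_ge0// subr_ge0 ltW.
Qed.

Lemma soft_sgn_lip (x y : R) : `|soft_sgn x - soft_sgn y| <= e^-1 * `|x - y|.
Proof.
wlog xy : x y / y < x.
  move=> W; have [xy|xy|->] := ltgtP x y; last by rewrite !subrr normr0 mulr0.
    by rewrite distrC [X in _ * X]distrC; exact: W.
  exact: W.
have [c /andP[c0 ce] ->] := soft_sgn_MVT xy.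
by rewrite normrM ler_wpM2r// ger0_norm.
Qed.

Lemma soft_abs_lip (x y : R) : `|soft_abs x - soft_abs y| <= `|x - y|.
Proof.
wlog xy : x y / y < x.
  move=> W; have [xy|xy|->] := ltgtP x y; last by rewrite !subrr normr0.
    by rewrite distrC [leRHS]distrC; exact: W.
  exact: W.
have cf : {within `[y, x], continuous soft_abs}.
  apply: continuous_subspaceT => z; apply: differentiable_continuous.
  by apply/derivable1_diffP; exact: (ex_derive (is_derive := is_derive_soft_abs z)).
have [c _ ->] := MVT xy (fun z _ => is_derive_soft_abs z) cf.
by rewrite normrM ler_piMl// soft_sgn_norm_le1.
Qed.

Lemma soft_sgn_ge x : 0 < x -> 1 - e / x <= soft_sgn x.
Proof.
move=> x0; rewrite /soft_sgn.
have a0 := soft_abs_gt0 x.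
rewrite ler_pdivlMr// mulrBl mul1r lerBlDr.
have := soft_abs_le x; rewrite (gtr0_norm x0) => h1.
have h2 : x <= soft_abs x by have := soft_abs_ge x; rewrite (gtr0_norm x0).
apply: (le_trans h1); rewrite lerD2l mulrAC ler_pdivlMr//.
by rewrite ler_wpM2l// ltW.
Qed.

Lemma smooth_soft_absV n (psi : 'rV[R]_n -> R) : smooth psi ->
  smooth ((fun t => (soft_abs t)^-1) \o psi).
Proof.
pose q t := (soft_abs t)^-1.
pose E : set (R -> R) := [set q].
apply: (@smooth_comp R n E (fun g x => - (x * q x ^+ 3))) => //.
  by move=> _ -> x; exact: is_derive_soft_absV.
move=> g f _ sf.
have -> : (fun x => - (x * q x ^+ 3)) \o f =
   (fun=> -1) \* (f \* ((q \o f) \* ((q \o f) \* (q \o f)))).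
  by apply/funext => x /=; rewrite mulN1r !exprS expr0 mulr1.
have gq : smooth_alg (comp_gen E) (q \o f).
  by apply: SmoothAlgGen; exists q => //; exists f.
apply: (SmoothAlgM (SmoothAlg _ (smooth_cst _))).
exact: (SmoothAlgM (SmoothAlg _ sf) (SmoothAlgM gq (SmoothAlgM gq gq))).
Qed.

Lemma smooth_soft_abs n (psi : 'rV[R]_n -> R) : smooth psi ->
  smooth (soft_abs \o psi).
Proof.
move=> spsi.
have -> : soft_abs \o psi =
    ((psi \* psi) \+ (fun=> e ^+ 2)) \* ((fun t => (soft_abs t)^-1) \o psi).
  apply/funext => x /=; rewrite -expr2 -soft_abs_sqr expr2 mulfK//.
  by rewrite gt_eqF// soft_abs_gt0.
have s1 := smoothD (smoothM spsi spsi) (@smooth_cst R n (e ^+ 2)).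
exact: (smoothM s1 (smooth_soft_absV spsi)).
Qed.

End soft_abs.

Section soft_cut_construction.
Variables (R : realType) (n : nat).

(** H(s) is half of soft_abs(s + L) - soft_abs(s - L). For e = 0 this would be the
truncation of s to [-L, L]. *)
Lemma soft_cut_exists (L d : R) : 0 < L -> 0 < d ->
  exists H H1 C, [/\ @soft_cut R n H H1 C, forall s, `|H s| <= L &
    forall s, `|s| <= L / 2 -> 1 - H1 s <= d].
Proof.
move=> L0 d0; pose e := d * L / 2.
have e0 : 0 < e by rewrite !divr_gt0// mulr_gt0.
pose H s := 2^-1 * (soft_abs e (s + L) - soft_abs e (s - L)).
pose H1 s := 2^-1 * (soft_sgn e (s + L) - soft_sgn e (s - L)).
have dH (x : R) : is_derive x 1 H (H1 x).
  have sh c : is_derive x 1 (fun t => soft_abs e (t + c)) (soft_sgn e (x + c)).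
    have d1 : is_derive x 1 (fun t : R => t + c) 1.
      have := is_deriveD (is_derive_id x (1 : R)) (is_derive_cst c x (1 : R)).
      by rewrite addr0.
    have := @is_derive1_comp R (soft_abs e) (fun t : R => t + c) x _ _
      (is_derive_soft_abs e0 (x + c)) d1.
    by rewrite mulr1.
  have := is_deriveZ (2^-1 : R) (is_deriveB (sh L) (sh (- L))).
  by [].
(* The second derivative of soft_abs is at most 1/e. *)
exists H, H1, e^-1; split; first split.
- by rewrite /H add0r sub0r soft_absN subrr mulr0.
- exact: dH.
- move=> x; rewrite /H1 mulr_ge0// subr_ge0 soft_sgn_le// lerD2l.
  by rewrite ge0_cp// ltW.
- move=> x; rewrite /H1 mulrC ler_pdivrMr// mul1r.
  have := soft_sgn_norm_le1 e0 (x + L); have := soft_sgn_norm_le1 e0 (x - L).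
  by rewrite !ler_norml => /andP[h1 _] /andP[_ h2]; lra.
- move=> x y; rewrite /H1 -mulrBr normrM gtr0_norm//.
  have h1 := soft_sgn_lip e0 (x + L) (y + L); have h2 := soft_sgn_lip e0 (x - L) (y - L).
  rewrite (_ : x + L - (y + L) = x - y) in h1; last lra.
  rewrite (_ : x - L - (y - L) = x - y) in h2; last lra.
  rewrite mulrC ler_pdivrMr//.
  rewrite (_ : _ - _ = (soft_sgn e (x + L) - soft_sgn e (y + L)) -
    (soft_sgn e (x - L) - soft_sgn e (y - L))); last lra.
  apply: (le_trans (ler_normB _ _)); move: h1 h2; lra.
- move=> phi sphi.
  have -> : H \o phi = fun x => 2^-1 * (((soft_abs e) \o (phi \+ (fun=> L))) \-
     ((soft_abs e) \o (phi \- (fun=> L)))) x by [].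
  have s1 := smooth_soft_abs e0 (smoothD sphi (@smooth_cst R n L)).
  have s2 := smooth_soft_abs e0 (smooth_sub sphi (@smooth_cst R n L)).
  exact: (smoothZ _ (smooth_sub s1 s2)).
- move=> s; rewrite /H normrM gtr0_norm// mulrC ler_pdivrMr//.
  apply: (le_trans (soft_abs_lip e0 _ _)).
  rewrite (_ : _ - _ = 2 * L); last lra.
  by rewrite gtr0_norm ?mulr_gt0// mulrC.
move=> s; rewrite ler_norml => /andP[s1 s2].
have L2 : 0 < L / 2 by rewrite divr_gt0.
have h1 : soft_sgn e (L / 2) <= soft_sgn e (s + L).
  by apply: soft_sgn_le => //; lra.
have h2 : soft_sgn e (L / 2) <= soft_sgn e (L - s).
  by apply: soft_sgn_le => //; lra.
have h3 := soft_sgn_ge e0 L2.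
have h4 : e / (L / 2) = d.
  by rewrite /e -[d * L / 2]mulrA mulfK// gt_eqF.
have h5 : soft_sgn e (s - L) = - soft_sgn e (L - s).
  by rewrite -soft_sgnN// opprB.
rewrite /H1 h5; move: h3; rewrite h4; move: h1 h2; lra.
Qed.

(** This keeps the competitor above the smaller of the solution and Theta. *)
Lemma soft_cut_min H H1 C : @soft_cut R n H H1 C -> forall s, Num.min 0 s <= H s.
Proof.
move=> cut s; have dH := soft_cut_derive cut.
rewrite ge_min; have [s0|s0|->] := ltgtP s 0.
- have := soft_cut_contract cut s 0; rewrite (soft_cut0 cut) !subr0 (ltr0_norm s0).
  by rewrite ler_norml opprK => /andP[-> _]; rewrite orbT.
- have cH : {within `[0, s], continuous H}.
    by apply: continuous_subspaceT; exact: (soft_cut_continuous cut).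
  have [c _] := MVT s0 (fun z _ => dH z) cH.
  rewrite (soft_cut0 cut) !subr0 => ->.
  by rewrite mulr_ge0 ?(soft_cut_ge0 cut)// ltW.
- by rewrite (soft_cut0 cut) lexx.
Qed.

End soft_cut_construction.

Section weak_sobolev.
Variables (R : realType) (n : nat).
Local Notation V := 'rV[R]_n.+2.
Notation mu := (lebesgue_rV R n.+2).
Variable O : set V.
Hypothesis oO : open O.
Hypothesis Ofin : (mu O < +oo)%E.
Let mO := open_lebesgue_measurable oO.

Lemma chebyshev_ge (u : V -> R) (d : R) : mu.-integrable O (EFin \o u) -> 0 < d ->
  (mu (O `&` [set x | (d <= `|u x|)%R]) <= ((\int[mu]_(x in O) `|u x|) / d)%:E)%E.
Proof.
move=> iu d0; have := le_integral_abse mu mO (measurable_int _ iu) d0.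
rewrite -[X in (_ <= X)%E](Rintegral_EFin mO (integrable_normr iu)).
by rewrite EFinM lee_pdivlMr// muleC.
Qed.

(** Let phi be a test function close to v. Outside {|phi| >= tau'}, the set
{|v| > tau} is contained in {|v - phi| >= tau - tau'}, which is small by
Chebyshev's inequality. The gaps between tau' and tau, m' and m, and below S,
make room for the error of approximation. *)
Lemma w011_sobolev (v : V -> R) g (S tau tau' m m' : R) : w011 O v g ->
  \sum_k \int[mu]_(x in O) `|g k x| < S -> 0 < tau' < tau -> 0 <= m' < m ->
  (m%:E <= mu (O `&` [set x | (tau < `|v x|)%R]))%E ->
  m' ^+ n.+1 <= (S / tau') ^+ n.+2.
Proof.
have tri (s s' a b c : R) : s < a -> b < s' -> a <= b + c -> s - s' <= c by lra.
move=> [dv [iv av]] HS /andP[t0 tt] /andP[m0 mm] mle.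
have ig k : mu.-integrable O (EFin \o g k) by have [_ ? _] := dv k.
pose d := tau - tau'; have d0 : 0 < d by rewrite subr_gt0.
pose e := Num.min (S - \sum_k \int[mu]_(x in O) `|g k x|) (d * (m - m')).
have e0 : 0 < e by rewrite lt_min subr_gt0 HS mulr_gt0// subr_gt0.
have [phi tphi dphi] := av e e0.
have [sphi cphi sO] := tphi.
have iphi := test_fun_integrable oO Ofin tphi.
have igphi k : mu.-integrable O (EFin \o gradient phi k).
  by apply: (test_fun_integrable oO Ofin); exact: test_fun_partial.
have iD := integrable_w11_dist oO iv iphi ig igphi.
have S0 : 0 < S.
  by apply: le_lt_trans HS; apply: sumr_ge0 => k _; exact: Rintegral_ge0.
have d1 : w11_dist O v g phi (gradient phi) <= S - \sum_k \int[mu]_(x in O) `|g k x|.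
  by apply: (le_trans (ltW dphi)); rewrite ge_min lexx.
have d2 : w11_dist O v g phi (gradient phi) <= d * (m - m').
  by apply: (le_trans (ltW dphi)); rewrite ge_min lexx orbT.
apply: (@weak_sobolev_smooth R n phi tau' S m' sphi cphi t0 S0) => //.
  move=> i.
  have -> : (\int[mu]_x `|partial i phi x|%:E = (\int[mu]_(x in O) `|gradient phi i x|)%:E)%E.
    rewrite (Rintegral_EFin mO (integrable_normr (igphi i))) [RHS]integral_mkcond.
    apply: eq_integral => x _; rewrite patchE; case: ifPn => //.
    rewrite notin_setE => nO; have := test_fun_out (test_fun_partial i tphi) nO.
    by move=> ->; rewrite normr0.
  rewrite lee_fin.
  apply: (@le_trans _ _ (\int[mu]_(x in O) (`|g i x| + (`|v x - phi x| + \sum_k `|g k x - gradient phi k x|)))).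
    apply: le_Rintegral => //; first exact: (integrable_normr (igphi i)).
      by apply: integrable_add => //; exact: (integrable_normr (ig i)).
    move=> x Ox; rewrite (bigD1 i)//=.
    have h1 : 0 <= \sum_(k | k != i) `|g k x - gradient phi k x| by apply: sumr_ge0.
    have h2 := normr_ge0 (v x - phi x).
    have h3 := ler_normD (g i x) (gradient phi i x - g i x).
    rewrite addrC subrK distrC in h3.
    move: h1 h2 h3; lra.
  rewrite RintegralD//; last exact: (integrable_normr (ig i)).
  apply: (@le_trans _ _ (\sum_k \int[mu]_(x in O) `|g k x| + w11_dist O v g phi (gradient phi))).
    rewrite lerD2r (bigD1 i)//= lerDl; apply: sumr_ge0 => k _; exact: Rintegral_ge0.
  by rewrite -lerBrDl.
have iB : mu.-integrable O (EFin \o (fun x => v x - phi x)) by exact: (integrable_sub mO).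
have cheb := chebyshev_ge iB d0.
have le1 : \int[mu]_(x in O) `|v x - phi x| <= w11_dist O v g phi (gradient phi).
  apply: le_Rintegral => //; first exact: (integrable_normr iB).
  by move=> x Ox; rewrite lerDl; apply: sumr_ge0.
have cheb' : (mu (O `&` [set x | (d <= `|v x - phi x|)%R]) <= (m - m')%:E)%E.
  apply: (le_trans cheb); rewrite lee_fin ler_pdivrMr// mulrC.
  exact: le_trans le1 d2.
have mphi : measurable [set x : V | tau' <= `|phi x|].
  rewrite -[X in measurable X]setTI; apply: (measurable_fun_le (f := fun=> tau') (g := fun x => `|phi x|)) => //.
  by apply: measurableT_comp => //; exact: measurable_smooth.
have mphi' := borel_lebesgue_measurable mphi.
have mv := integrable_measurable iv.
have mB : measurable (O `&` [set x | (d <= `|v x - phi x|)%R] : set (rV_lebesgue R n.+2)).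
  have mB' : measurable_fun (O : set (rV_lebesgue R n.+2)) (fun x => v x - phi x) by exact: (integrable_measurable iB).
  exact: (measurable_ge_set mO d mB').
have mA : measurable (O `&` [set x | (tau < `|v x|)%R] : set (rV_lebesgue R n.+2)).
  exact: (measurable_gt_set mO tau mv).
have : (m%:E <= mu [set x : V | (tau' <= `|phi x|)%R] + (m - m')%:E)%E.
  apply: (le_trans mle).
  apply: (@le_trans _ _ (mu ([set x : V | (tau' <= `|phi x|)%R] `|` (O `&` [set x | (d <= `|v x - phi x|)%R])))).
    apply: le_measure; rewrite ?inE//; first exact: measurableU.
    move=> x [Ox /= tv]; have [h|h] := leP tau' `|phi x|; [by left|right; split => //=].
    have := ler_normD (phi x) (v x - phi x); rewrite addrC subrK.
    by exact: (tri _ _ _ _ _ tv h).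
  apply: (@le_trans _ _ (mu [set x : V | (tau' <= `|phi x|)%R] + mu (O `&` [set x | (d <= `|v x - phi x|)%R]))%E).
    exact: (@measureU2 _ _ _ mu _ _ mphi' mB).
  by rewrite leeD2l.
by rewrite -leeBlDr// -EFinB opprB addrCA subrr addr0.
Qed.

End weak_sobolev.

(** * Decay by iteration, and the weighted energy estimate *)

(** Suppose lam(s) <= B s^-t. The step with m = 2 B s^-t yields the same bound at
4s if B is large enough: the powers of s agree, because
t (1 - 1/q) (N + 1) + (N + 1) = t N, and B occurs with the exponent
(1 - 1/q) (N + 1), which is less than N since q < N + 1. Hence an induction on
k for s <= 4^k, which starts from lam <= M. *)
Lemma stampacchia (R : realType) (N : nat) (lam : R -> R) (M K q : R) :
  (0 < N)%N -> 0 <= M -> 0 < K -> 0 < q < N.+1%:R ->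
  (forall s : R, 0 < s -> 0 <= lam s <= M) ->
  (forall s m : R, 0 < s -> lam s < m ->
    lam (4 * s) ^+ N <= (K * m `^ (1 - 1 / q) / s) ^+ N.+1) ->
  exists2 B : R, 0 < B &
    forall s : R, 0 < s -> lam s <= B / s `^ (N.+1%:R * q / (N.+1%:R - q)).
Proof.
move=> N0 M0 K0 /andP[q0 qN] lamM step.
set D : R := N.+1%:R in qN *; set t := D * q / (D - q); set al := 1 - 1 / q in step *.
have Dq : 0 < D - q by rewrite subr_gt0.
have tE : t * al * D + D = t * (D - 1).
  have iE : (1 / q) * q = 1 by rewrite mul1r mulVf// gt_eqF.
  have tD : t * (D - q) = D * q by rewrite mulfVK// gt_eqF.
  apply: (mulIf (x := q)); first by rewrite gt_eqF.
  have -> : (t * al * D + D) * q = t * D * (q - (1 / q) * q) + D * q by rewrite /al; lra.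
  by rewrite iE -tD; lra.
(* After taking logarithms, the induction step reads A <= be * ln B. *)
pose be := D - 1 - al * D.
have be0 : 0 < be.
  have h : 1 < D / q by rewrite ltr_pdivlMr// mul1r.
  by rewrite /be /al; move: h; lra.
pose A := D * (ln K + al * ln 2) + (D - 1) * (t * ln 4).
pose B := M + 1 + expR (A / be).
have B0 : 0 < B by rewrite addr_gt0 ?expR_gt0// ltr_wpDl.
have lnB : A <= be * ln B.
  rewrite mulrC -ler_pdivrMr// -[leLHS]expRK ler_ln ?posrE ?expR_gt0//.
  by rewrite /B lerDr addr_ge0.
have t0 : 0 < t by rewrite divr_gt0// mulr_gt0// ltr0n.
exists B => // s s0.
suff H k s' : 0 < s' -> s' <= 4 ^+ k -> lam s' <= B / s' `^ t.
  apply: (H (Num.bound s)) => //; have := archi_boundP (ltW s0).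
  move=> /ltW/le_trans; apply; rewrite -natrX ler_nat.
  by rewrite ltnW// ltn_expl.
elim: k s' => {s s0} [|k IH] s s0 sk.
  have /andP[_ h] := lamM _ s0; apply: (le_trans h).
  rewrite ler_pdivlMr ?powR_gt0//.
  have st : s `^ t <= 1.
    have : s `^ t <= 1 `^ t by rewrite ge0_ler_powR ?nnegrE ?(ltW t0) ?(ltW s0).
    by rewrite powR1.
  have hB : M <= B by rewrite /B -addrA lerDl addr_ge0// expR_ge0.
  apply: le_trans hB; rewrite -[leRHS]mulr1.
  by apply: ler_wpM2l => //.
pose s' := s / 4.
have s'0 : 0 < s' by rewrite divr_gt0.
have sE : s = 4 * s' by rewrite /s'; lra.
have h1 : lam s' <= B / s' `^ t.
  by apply: IH => //; rewrite ler_pdivrMr// mulrC -exprS.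
have p0 : 0 < B / s' `^ t by rewrite divr_gt0// powR_gt0.
(* The factor 2 makes m strictly larger than lam s'. *)
pose m := 2 * (B / s' `^ t).
have m0 : 0 < m by rewrite mulr_gt0.
have h2 : lam s' < m by rewrite (le_lt_trans h1)// /m; lra.
have := step _ _ s'0 h2; rewrite -sE => h3.
have X0 : 0 < B / s `^ t by rewrite divr_gt0// powR_gt0.
have /andP[l0 _] := lamM _ s0.
rewrite -(@ler_pXn2r _ N)// ?nnegrE ?(ltW X0)//; apply: (le_trans h3).
have Y0 : 0 < K * m `^ al / s' by rewrite divr_gt0// mulr_gt0// powR_gt0.
rewrite -ler_ln ?posrE ?exprn_gt0// !lnXn//.
have E1 : ln (K * m `^ al / s') = ln K + al * (ln 2 + ln B - t * ln s') - ln s'.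
  rewrite lnM ?posrE ?mulr_gt0 ?powR_gt0 ?invr_gt0// lnV ?posrE// lnM ?posrE ?powR_gt0//.
  rewrite ln_powR /m lnM ?posrE// lnM ?posrE ?invr_gt0 ?powR_gt0// lnV ?posrE ?powR_gt0//.
  by rewrite ln_powR; lra.
have E2 : ln (B / s `^ t) = ln B - t * (ln 4 + ln s').
  rewrite lnM ?posrE ?invr_gt0 ?powR_gt0// lnV ?posrE ?powR_gt0// ln_powR.
  by rewrite sE lnM ?posrE.
rewrite E1 E2 -[leLHS]mulr_natl -[leRHS]mulr_natl -/D.
have -> : N%:R = D - 1 by rewrite /D -natr1; lra.
have E3 : (t * al * D + D) * ln s' = t * (D - 1) * ln s' by rewrite tE.
move: lnB E3; rewrite /A /be; lra.
Qed.

Lemma powR_add (R : realType) (x r s : R) : 0 < x ->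
  x `^ (r + s) = x `^ r * x `^ s.
Proof. by move=> x0; rewrite powRD// (gt_eqF x0) implybT. Qed.

Lemma powR_mul_base (R : realType) (x r : R) : 0 < x ->
  x `^ r * x = x `^ (r + 1).
Proof. by move=> x0; rewrite powR_add// powRr1// ltW. Qed.

(** If x > s then x / s <= (x / s)^c. Integrated against a weight, with s adapted to
its mass, this does the work of Hoelder's inequality. *)
Lemma le_young (R : realType) (x s c : R) : 0 <= x -> 0 < s -> 1 <= c ->
  x <= s + s `^ (1 - c) * x `^ c.
Proof.
move=> x0 s0 c1; have [xs|sx] := leP x s.
  by apply: (le_trans xs); rewrite lerDl mulr_ge0// powR_ge0.
have x0' : 0 < x by exact: lt_trans sx.
apply: (@le_trans _ _ (s `^ (1 - c) * x `^ c)); last by rewrite lerDr ltW.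
have -> : s `^ (1 - c) * x `^ c = s * (x / s) `^ c.
  rewrite powR_add// powRr1 ?(ltW s0)// -mulrA; congr (_ * _).
  by rewrite mulrC powRM ?invr_ge0 ?(ltW s0)// -powR_inv1 ?(ltW s0)// -powRrM mulN1r.
have xs : 1 <= x / s by rewrite ler_pdivlMr// mul1r ltW.
rewrite -[leLHS](divfK (x := s)) ?gt_eqF// mulrC ler_wpM2l ?(ltW s0)//.
by rewrite -[leLHS]powRr1 ?ler_powR// divr_ge0 ?(ltW s0).
Qed.

Section energy.
Context d (T : measurableType d) (R : realType) (mu : {measure set T -> \bar R}).
Hypothesis cmu : measure_is_complete mu.
Variables (O : set T) (mO : measurable O).
Implicit Types F Y Z D P Q om : T -> R.
Local Notation I f := (mu.-integrable O (EFin \o f)).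

Lemma integrable_weight om F : I F -> measurable_fun O om ->
  (forall x, O x -> 0 <= om x <= 1) -> I (fun x => om x * F x).
Proof.
move=> iF mom om1.
rewrite (_ : (fun x => om x * F x) = (fun x => F x * om x)); last by apply/funext => x; rewrite mulrC.
apply: (integrable_mul_bounded mO iF mom (C := 1)) => x /om1 /andP[h0 h1].
by rewrite ger0_norm.
Qed.

(** Here Y stands for |Dg|^p, D for |Dg|, Z for the data, and P and Q for the two
sides of the variational inequality. [le_young] is used twice, with s chosen
such that its two terms have the same order in m: s = m^(-p/q) for Z, which
gives m^(1 - p/q) for the integrals of om Z and om Y, and s = m^(-1/q) for D. *)
Lemma energy_estimate Y Z D P Q om (p q nu C1 c m J : R) :
  1 < p -> p < q -> 0 < nu -> 0 <= C1 -> 0 <= c -> 0 < m ->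
  I Y -> I Z -> I D -> I P -> I Q -> I (fun x => Z x `^ (q / p)) ->
  (forall x, 0 <= Y x) -> (forall x, 0 <= Z x) -> 
  (\forall x \ae mu, O x -> nu * Y x <= P x - Q x + C1 * Z x) ->
  (forall x (s : R), 0 < s -> D x <= c * (s + s `^ (1 - p) * Y x)) ->
  \int[mu]_(x in O) (Z x `^ (q / p)) <= J ->
  I om -> (forall x, O x -> 0 <= om x <= 1) -> \int[mu]_(x in O) om x <= m ->
  \int[mu]_(x in O) (om x * P x) <= \int[mu]_(x in O) (om x * Q x) ->
  \int[mu]_(x in O) (om x * D x) <= c * (1 + C1 / nu * (1 + J)) * m `^ (1 - 1 / q).
Proof.
move=> p1 pq nu0 C10 c0 m0 iY iZ iD iP iQ iZq Y0 Z0 hY hD hJ iom om1 hm PQ.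
have mom : measurable_fun O om by exact: integrable_measurable iom.
have p0 : 0 < p by lra.
have q0 : 0 < q by lra.
have cst_le (a F' : R) F : I F -> 0 <= a -> \int[mu]_(x in O) F x <= F' ->
    \int[mu]_(x in O) (a * F x) <= a * F'.
  by move=> iF a0 hF; rewrite RintegralZl// ler_wpM2l.
have w_le F : I F -> (forall x, 0 <= F x) ->
    \int[mu]_(x in O) (om x * F x) <= \int[mu]_(x in O) F x.
  move=> iF F0; apply: le_Rintegral => //; first exact: integrable_weight.
  by move=> x Ox; rewrite ler_piMl//; have /andP[] := om1 _ Ox.
have iw F : I F -> I (fun x => om x * F x) by move=> iF; exact: integrable_weight.
have split_le F F1 (a b f1 : R) : I F -> I F1 -> 0 <= a -> 0 <= b ->
    (\forall x \ae mu, O x -> F x <= a + b * F1 x) ->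
    \int[mu]_(x in O) (om x * F1 x) <= f1 ->
    \int[mu]_(x in O) (om x * F x) <= a * m + b * f1.
  move=> iF iF1 a0 b0 hF hf1.
  have ia : I (fun x => a * om x) by exact: integrable_scale.
  have ib : I (fun x => b * (om x * F1 x)) by apply: integrable_scale => //; exact: iw.
  apply: (@le_trans _ _ (\int[mu]_(x in O) (a * om x + b * (om x * F1 x)))).
    apply: (Rintegral_ae_le cmu mO); [exact: iw|exact: integrable_add|].
    apply: filterS hF => x h Ox; have /andP[w0 _] := om1 _ Ox.
    have := ler_wpM2l w0 (h Ox); lra.
  rewrite RintegralD//; apply: lerD; apply: cst_le => //; exact: iw.
have J0 : 0 <= J by apply: le_trans hJ; apply: Rintegral_ge0 => x _; exact: powR_ge0.
have qp1 : 1 <= q / p by rewrite ler_pdivlMr// mul1r ltW.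
have hZq : \int[mu]_(x in O) (om x * Z x `^ (q / p)) <= J.
  by apply: le_trans hJ; apply: w_le => // x; exact: powR_ge0.
have hZ : \int[mu]_(x in O) (om x * Z x) <= m `^ (1 - p / q) * (1 + J).
  pose r := m `^ (- (p / q)).
  have r0 : 0 < r by rewrite powR_gt0.
  have -> : m `^ (1 - p / q) * (1 + J) = r * m + r `^ (1 - q / p) * J.
    rewrite /r -powRrM.
    have -> : - (p / q) * (1 - q / p) = 1 - p / q.
      have : (p / q) * (q / p) = 1 by rewrite mulrA divfK ?mulfV ?gt_eqF.
      lra.
    rewrite powR_mul_base// (_ : - (p / q) + 1 = 1 - p / q); first lra.
    by rewrite addrC.
  apply: (split_le _ _ _ _ _ iZ iZq _ _ _ hZq); [exact: ltW|exact: powR_ge0|].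
  by apply: nearW => x Ox; exact: le_young.
have hYi : \int[mu]_(x in O) (om x * Y x) <= C1 / nu * (m `^ (1 - p / q) * (1 + J)).
  rewrite mulrAC ler_pdivlMr// mulrC.
  apply: (@le_trans _ _ (C1 * \int[mu]_(x in O) (om x * Z x))); last by rewrite ler_wpM2l.
  rewrite -!RintegralZl//; [|exact: iw|exact: iw].
  have i1 : I (fun x => om x * P x - om x * Q x) by apply: integrable_sub => //; exact: iw.
  have i2 : I (fun x => C1 * (om x * Z x)) by apply: integrable_scale => //; exact: iw.
  apply: (@le_trans _ _ (\int[mu]_(x in O) ((om x * P x - om x * Q x) + C1 * (om x * Z x)))).
    apply: (Rintegral_ae_le cmu mO); [apply: integrable_scale => //; exact: iw|exact: integrable_add|].
    apply: filterS hY => x h Ox; have /andP[w0 _] := om1 _ Ox.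
    have := ler_wpM2l w0 (h Ox); lra.
  rewrite RintegralD// RintegralB//; [|exact: iw|exact: iw].
  by rewrite gerDr subr_le0.
pose s := m `^ (- (1 / q)).
have s0 : 0 < s by rewrite powR_gt0.
have := @split_le D Y (c * s) (c * s `^ (1 - p)) _ iD iY _ _ _ hYi.
have -> : c * s * m + c * s `^ (1 - p) * (C1 / nu * (m `^ (1 - p / q) * (1 + J)))
    = c * (1 + C1 / nu * (1 + J)) * m `^ (1 - 1 / q).
  have e1 : s * m = m `^ (1 - 1 / q).
    by rewrite /s powR_mul_base// addrC.
  have e2 : s `^ (1 - p) * m `^ (1 - p / q) = m `^ (1 - 1 / q).
    rewrite /s -powRrM -powR_add//.
    by congr (_ `^ _); lra.
  rewrite -[in RHS]mulrA mulrDl mul1r -{1}e1 -e2; lra.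
apply.
- by rewrite mulr_ge0// ltW.
- by rewrite mulr_ge0// powR_ge0.
- by apply: nearW => x Ox; have := hD x _ s0; lra.
Qed.

End energy.

(** * Caratheodory functions and integrability of powers *)

Section caratheodory.
Context d (T : measurableType d) (R : realType) (mu : {measure set T -> \bar R}).
Hypothesis cmu : measure_is_complete mu.
Variables (O : set T) (mO : measurable O) (n : nat).
Implicit Types (U : 'I_n -> T -> R) (b : T -> 'rV[R]_n -> R).

(** grid j (cell U j x) is U x rounded down to a multiple of 1/(j + 1) in every
coordinate. *)
Definition grid (j : nat) (z : 'rV[int]_n) : 'rV[R]_n :=
  \row_k ((z ord0 k)%:~R / j.+1%:R).

Definition cell U (j : nat) (x : T) : 'rV[int]_n :=
  \row_k Num.floor (U k x * j.+1%:R).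

Lemma measurable_cell U j z : (forall k, measurable_fun O (U k)) ->
  measurable (O `&` [set x | cell U j x = z]).
Proof.
move=> mU.
rewrite (_ : _ `&` _ = O `&` \bigcap_(k in [set: 'I_n])
    (O `&` (fun x => U k x * j.+1%:R) @^-1` `[(z ord0 k)%:~R, (z ord0 k + 1)%:~R[%classic)); last first.
  apply/seteqP; split => x [Ox H]; split => //.
    move=> k _; split => //=; rewrite in_itv/=.
    by have := floor_itv (U k x * j.+1%:R); rewrite -H mxE.
  apply/rowP => k; have [_ /=] := H k I; rewrite in_itv/= => /floor_def.
  by rewrite mxE.
apply: measurableI => //; apply: fin_bigcap_measurable => // k _.
by apply: (measurable_funM (mU k) (measurable_cst _)).
Qed.

Lemma measurable_grid U j b : (forall k, measurable_fun O (U k)) ->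
  (forall z, measurable_fun O (b ^~ z)) ->
  measurable_fun O (fun x => b x (grid j (cell U j x))).
Proof.
move=> mU mb _ B mB.
rewrite (_ : _ `&` _ = \bigcup_(z in [set: 'rV[int]_n])
   ((O `&` [set x | cell U j x = z]) `&` (O `&` (b ^~ (grid j z)) @^-1` B))).
  apply: countable_bigcupT_measurable => [|z]; first exact: countableP.
  by apply: measurableI; [exact: measurable_cell|exact: mb].
apply/seteqP; split => x.
  by move=> [Ox Bx]; exists (cell U j x).
by move=> [z _ [[Ox /= xz] [_ /= Bx]]]; split => //=; rewrite xz.
Qed.

Lemma grid_cvg U x : (fun j => grid j (cell U j x)) @ \oo --> (\row_k U k x : 'rV[R]_n).
Proof.
apply/cvg_ballP => e e0; near=> j.
apply/(rV_ballP _ _ e0) => k; rewrite !mxE.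
have j0 : (0 : R) < j.+1%:R by [].
have -> : U k x - (Num.floor (U k x * j.+1%:R))%:~R / j.+1%:R =
  (U k x * j.+1%:R - (Num.floor (U k x * j.+1%:R))%:~R) / j.+1%:R.
  by rewrite mulrBl mulfK// gt_eqF.
have /andP[h1 h2] := floor_itv (U k x * j.+1%:R).
rewrite intrD in h2.
rewrite ger0_norm ?divr_ge0 ?subr_ge0// ltr_pdivrMr//.
apply: (@lt_trans _ _ 1); first by rewrite ltrBlDl.
rewrite mulrC -ltr_pdivrMr// mul1r invf_plt ?posrE//.
near: j; exact: (near_infty_natSinv_lt (PosNum e0)).
Unshelve. all: by end_near. Qed.

(** Rounding U makes the composition measurable, as only countably many values are
used; continuity in the second variable gives the convergence, for almost all
x, and completeness of the measure the measurability of the limit. *)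
Lemma caratheodory_measurable b U : (forall k, measurable_fun O (U k)) ->
  (forall z, measurable_fun O (b ^~ z)) ->
  (\forall x \ae mu, O x -> continuous (b x)) ->
  measurable_fun O (fun x => b x (\row_k U k x)).
Proof.
move=> mU mb cb.
pose F j x := (b x (grid j (cell U j x)))%:E.
have mF : measurable_fun O (fun x => limn_esup (F ^~ x)).
  by apply: measurable_fun_limn_esup => // j; apply/measurable_EFinP; exact: measurable_grid.
apply/measurable_EFinP; apply: (ae_measurable_fun cmu _ mF).
apply: filterS cb => x cx Ox.
apply: (cvg_limn_einf_sup _).2.
apply: cvg_EFin; first by apply: nearW.
have h : (fun j => b x (grid j (cell U j x))) @ \oo --> b x (\row_k U k x).
  have := @cvg_comp _ _ _ (fun j => grid j (cell U j x)) (b x) _ _ _ (@grid_cvg U x).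
  by apply; exact: (cx Ox).
exact: h.
Qed.

End caratheodory.

Section integrability.
Context d (T : measurableType d) (R : realType) (mu : {measure set T -> \bar R}).
Hypothesis cmu : measure_is_complete mu.
Variables (O : set T) (mO : measurable O).
Implicit Types F G : T -> R.
Local Notation I f := (mu.-integrable O (EFin \o f)).

Lemma measurable_powR_norm F (r : R) : measurable_fun O F ->
  measurable_fun O (fun x => `|F x| `^ r).
Proof.
move=> mF; apply: (measurableT_comp (measurable_powR r)).
by apply: measurableT_comp.
Qed.

Lemma integrable_powR_mono F (p q : R) : (mu O < +oo)%E -> 0 <= p -> p <= q ->
  measurable_fun O F -> I (fun x => `|F x| `^ q) -> I (fun x => `|F x| `^ p).
Proof.
move=> Ofin p0 pq mF iF.
have i1 : I (fun=> 1 : R).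
    apply: (measurable_bounded_integrable mO Ofin) => //.
    exists 1; split; first exact: num_real.
    by move=> y y1 x _; rewrite normr1 ltW.
apply: (integrable_dominated mO (g := fun x => 1 + `|F x| `^ q)).
- exact: measurable_powR_norm.
- exact: (integrable_add mO i1 iF).
- apply: nearW => x Ox; rewrite ger0_norm ?powR_ge0//.
  have [h|h] := leP `|F x| 1.
    apply: (@le_trans _ _ 1); last by rewrite lerDl powR_ge0.
    have : `|F x| `^ p <= 1 `^ p by rewrite ge0_ler_powR ?nnegrE.
    by rewrite powR1.
  apply: (@le_trans _ _ (`|F x| `^ q)); last by rewrite lerDr.
  by apply: ler_powR => //; exact: ltW.
Qed.

Lemma powR_add_le (a b c : R) : 0 <= a -> 0 <= b -> 0 <= c ->
  (a + b) `^ c <= 2 `^ c * (a `^ c + b `^ c).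
Proof.
move=> a0 b0 c0; wlog ab : a b a0 b0 / a <= b.
  move=> W; have [h|h] := leP a b; first exact: W.
  by rewrite addrC [X in _ * X]addrC; apply: W => //; exact: ltW.
apply: (@le_trans _ _ ((2 * b) `^ c)).
  by rewrite ge0_ler_powR ?nnegrE ?addr_ge0 ?mulr_ge0//; lra.
by rewrite powRM// ler_wpM2l ?powR_ge0// lerDr powR_ge0.
Qed.

Lemma integrable_powR_add F G (c : R) : 0 <= c -> measurable_fun O F -> measurable_fun O G ->
  (forall x, 0 <= F x) -> (forall x, 0 <= G x) ->
  I (fun x => F x `^ c) -> I (fun x => G x `^ c) -> I (fun x => (F x + G x) `^ c).
Proof.
move=> c0 mF mG F0 G0 iF iG.
apply: (integrable_dominated mO (g := fun x => 2 `^ c * (F x `^ c + G x `^ c))).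
- apply: (measurableT_comp (measurable_powR c)); exact: measurable_funD.
- by apply: (integrable_scale mO); exact: integrable_add.
- by apply: nearW => x Ox; rewrite ger0_norm ?powR_ge0// powR_add_le.
Qed.

Lemma integrable_powR_sum n (F : 'I_n -> T -> R) (c : R) : 0 < c ->
  (forall k, measurable_fun O (F k)) -> (forall k x, 0 <= F k x) ->
  (forall k, I (fun x => F k x `^ c)) -> I (fun x => (\sum_k F k x) `^ c).
Proof.
move=> c0 mF F0 iF.
suff : forall s : seq 'I_n, I (fun x => (\sum_(k <- s) F k x) `^ c) by exact.
elim=> [|k s IH].
  rewrite (_ : (fun x => _) = fun=> 0); first exact: integrable_zero.
  by apply/funext => x; rewrite big_nil powR0// gt_eqF.
rewrite (_ : (fun x => _) = fun x => (F k x + \sum_(i <- s) F i x) `^ c); last first.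
  by apply/funext => x; rewrite big_cons.
apply: integrable_powR_add => //; first exact: ltW.
- by apply: measurable_sum.
- by move=> x; apply: sumr_ge0.
Qed.

Lemma interpolate_le (X y s : R) : 0 <= X -> 0 <= y -> 0 < s -> s < 1 ->
  X `^ (1 - s) * y `^ s <= X + y.
Proof.
move=> X0 y0 s0 s1; pose M := Num.max X y.
have M0 : 0 <= M by rewrite le_max X0.
have s1' : 0 <= 1 - s by rewrite subr_ge0 ltW.
have E : M `^ (1 - s) * M `^ s = M.
  move: M0; rewrite le_eqVlt => /orP[/eqP <-|M0].
    by rewrite !powR0 ?mul0r// gt_eqF// subr_gt0.
  by rewrite -powR_add// subrK powRr1// ltW.
apply: (@le_trans _ _ M); last by rewrite ge_max lerDl lerDr X0 y0.
rewrite -[leRHS]E ler_pM ?powR_ge0//.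
  by rewrite ge0_ler_powR ?nnegrE// le_max lexx.
by rewrite ge0_ler_powR ?nnegrE ?(ltW s0)// le_max lexx orbT.
Qed.

(** By [interpolate_le], |F G| <= c X^(1 - 1/p) |G| <= c (X + |G|^p). *)
Lemma integrable_mul_conj X F G (c p : R) : 1 < p -> 0 <= c ->
  measurable_fun O F -> measurable_fun O G -> I X -> (forall x, 0 <= X x) ->
  (\forall x \ae mu, O x -> `|F x| <= c * X x `^ (1 - 1 / p)) ->
  I (fun x => `|G x| `^ p) -> I (fun x => F x * G x).
Proof.
move=> p1 c0 mF mG iX X0 hF iG.
apply: (integrable_dominated mO (g := fun x => c * (X x + `|G x| `^ p))).
- exact: measurable_funM.
- by apply: (integrable_scale mO); exact: integrable_add.
- apply: filterS hF => x hF Ox; rewrite normrM.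
  apply: (@le_trans _ _ (c * X x `^ (1 - 1 / p) * `|G x|)).
    by rewrite ler_wpM2r// hF.
  rewrite -mulrA ler_wpM2l//.
  have p0 : 0 < p by exact: lt_trans p1.
  have := @interpolate_le (X x) (`|G x| `^ p) (1 / p) (X0 x) (powR_ge0 _ _).
  rewrite -powRrM mul1r mulfV ?gt_eqF// powRr1//; apply; first by rewrite invr_gt0.
  by rewrite invf_lt1.
Qed.

(** [le_young] with s = A Z^(1/p), where A is such that K A^(1 - p) = nu. *)
Lemma young_absorb (K nu p : R) : 1 < p -> 0 < K -> 0 < nu ->
  exists2 C : R, 0 < C & forall Z g : R, 0 <= Z -> 0 <= g ->
    K * Z `^ (1 - 1 / p) * g <= nu * g `^ p + C * Z.
Proof.
move=> p1 K0 nu0.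
have p0 : 0 < p by exact: lt_trans p1.
pose A := (nu / K) `^ (1 / (1 - p)).
have A0 : 0 < A by rewrite powR_gt0// divr_gt0.
have EA : A `^ (1 - p) = nu / K.
  rewrite /A -powRrM mul1r mulVf ?powRr1 ?divr_ge0 ?(ltW nu0) ?(ltW K0)//.
  by rewrite lt_eqF// subr_lt0.
exists (K * A); first by rewrite mulr_gt0.
move=> Z g Z0 g0; move: Z0; rewrite le_eqVlt => /orP[/eqP <-|Z0].
  rewrite powR0 ?mulr0 ?mul0r ?addr0; first by rewrite mulr_ge0 ?powR_ge0 ?(ltW nu0).
  by rewrite gt_eqF// subr_gt0 div1r invf_lt1.
have s0 : 0 < A * Z `^ (1 / p) by rewrite mulr_gt0// powR_gt0.
have := ler_wpM2l (mulr_ge0 (ltW K0) (powR_ge0 Z (1 - 1 / p))) (le_young g0 s0 (ltW p1)).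
move=> /le_trans; apply.
rewrite powRM ?powR_ge0 ?(ltW A0)// EA -powRrM.
have e1 : Z `^ (1 - 1 / p) * Z `^ (1 / p) = Z by rewrite -powR_add// subrK powRr1// ltW.
have e2 : Z `^ (1 - 1 / p) * Z `^ (1 / p * (1 - p)) = 1.
  rewrite -powR_add// (_ : 1 - 1 / p + 1 / p * (1 - p) = 0) ?powRr0//.
  have : 1 / p * p = 1 by rewrite mul1r mulVf// gt_eqF.
  lra.
have e3 : K * (nu / K) = nu by rewrite mulrC divfK// gt_eqF.
rewrite (_ : K * Z `^ (1 - 1 / p) * _ =
    K * (nu / K) * (Z `^ (1 - 1 / p) * Z `^ (1 / p * (1 - p))) * g `^ p +
    K * A * (Z `^ (1 - 1 / p) * Z `^ (1 / p))); last by lra.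
by rewrite e1 e2 e3 mulr1.
Qed.

End integrability.

(** * The energy estimate under the structure conditions *)

Section obstacle_energy.
Context d (T : measurableType d) (R : realType) (mu : {measure set T -> \bar R}).
Hypothesis cmu : measure_is_complete mu.
Variables (O : set T) (mO : measurable O).
Hypothesis Ofin : (mu O < +oo)%E.
Local Notation I f := (mu.-integrable O (EFin \o f)).

(** Membership in L^r in the form of [LpP], over any complete measure space. *)
Definition lp_fun (r : R) (F : T -> R) :=
  measurable_fun O F /\ I (fun x => `|F x| `^ r).

Lemma lp_fun_ae r F G : (\forall x \ae mu, O x -> F x = G x) ->
  lp_fun r F -> lp_fun r G.
Proof.
move=> FG [mF iF]; split; first exact: (ae_eq_measurable cmu FG).
by apply: (integrable_ae_eq cmu mO _ iF); apply: filterS FG => x h Ox; rewrite h.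
Qed.

Lemma lp_fun_add r F G : 0 <= r -> lp_fun r F -> lp_fun r G ->
  lp_fun r (fun x => F x + G x).
Proof.
move=> r0 [mF iF] [mG iG]; have mFG := measurable_funD mF mG; split => //.
apply: (integrable_dominated mO (g := fun x => (`|F x| + `|G x|) `^ r)).
- exact: measurable_powR_norm.
- by apply: (integrable_powR_add mO) => //; apply: measurableT_comp.
- apply: nearW => x Ox; rewrite ger0_norm ?powR_ge0//.
  by rewrite ge0_ler_powR ?nnegrE ?addr_ge0// ler_normD.
Qed.

Lemma lp_fun_contract r F (om : T -> R) : 0 <= r -> lp_fun r F -> measurable_fun O om ->
  (forall x, `|om x| <= 1) -> lp_fun r (fun x => om x * F x).
Proof.
move=> r0 [mF iF] mom om1; have mF' := measurable_funM mom mF; split => //.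
apply: (integrable_dominated mO (g := fun x => `|F x| `^ r)) => //.
  exact: measurable_powR_norm.
apply: nearW => x Ox; rewrite ger0_norm ?powR_ge0//.
by rewrite ge0_ler_powR ?nnegrE// normrM ler_piMl.
Qed.

Lemma lp_fun_sub r F G : 0 <= r -> lp_fun r F -> lp_fun r G ->
  lp_fun r (fun x => F x - G x).
Proof.
move=> r0 lF lG; rewrite (_ : (fun x => _) = fun x => F x + (fun=> -1) x * G x); last first.
  by apply/funext => x; rewrite mulN1r.
apply: lp_fun_add => //; apply: lp_fun_contract => //.
by move=> x; rewrite normrN1.
Qed.

Lemma lp_fun_mono r s F : 0 <= r -> r <= s -> lp_fun s F -> lp_fun r F.
Proof. by move=> r0 rs [mF iF]; split => //; exact: (integrable_powR_mono mO Ofin r0 rs). Qed.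

Lemma lp_fun_integrable r F : 1 <= r -> lp_fun r F -> I F.
Proof.
move=> r1 lF; have [mF iF] := lp_fun_mono ler01 r1 lF.
apply: (integrable_dominated mO mF iF).
by apply: nearW => x _; rewrite powRr1.
Qed.

Section structure.
Variables (n : nat) (a : 'I_n -> T -> 'rV[R]_n -> R) (h : T -> R).
Variables (f U Th G : 'I_n -> T -> R) (p q c1 nu : R).
Hypotheses (p1 : 1 < p) (pq : p < q) (c10 : 0 < c1) (nu0 : 0 < nu).
Hypothesis ma : forall i z, measurable_fun O (a i ^~ z).
Hypothesis ca : forall i, \forall x \ae mu, O x -> continuous (a i x).
Hypothesis h0 : \forall x \ae mu, O x -> 0 <= h x.
Hypothesis hL : lp_fun (q / p) h.
Hypothesis a_growth : \forall x \ae mu, O x -> forall (z : 'rV[R]_n) (i : 'I_n),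
  `|a i x z| <= c1 * (h x + \sum_(j < n) `|z ord0 j| `^ p) `^ (1 - 1 / p).
Hypothesis a_monotone : \forall x \ae mu, O x -> forall z z' : 'rV[R]_n,
  nu * \sum_(i < n) `|z ord0 i - z' ord0 i| `^ p <=
  \sum_(i < n) (a i x z - a i x z') * (z ord0 i - z' ord0 i).
Hypothesis fL : forall i, lp_fun (q / (p - 1)) (f i).
Hypothesis ThL : forall i, lp_fun q (Th i).
Hypothesis GL : forall i, lp_fun p (G i).
Hypothesis UE : \forall x \ae mu, O x -> forall i, U i x = Th i x + G i x.
Hypothesis mU : forall i, measurable_fun O (U i).

Let p0 : 0 < p. Proof. exact: lt_trans p1. Qed.
Let pm1 : 0 < p - 1. Proof. by rewrite subr_gt0. Qed.
Let e0 : 0 < 1 - 1 / p. Proof. by rewrite subr_gt0 div1r invf_lt1. Qed.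

Let conjE : p / (p - 1) * (1 - 1 / p) = 1.
Proof.
have e1 : p * (1 - 1 / p) = p - 1 by rewrite mulrBr mulr1 mulrCA mul1r mulfV ?mulr1// gt_eqF.
by rewrite mulrAC e1 mulfV// gt_eqF.
Qed.

(** The function that controls the energy; the growth and integrability
assumptions place it in L^(q/p). *)
Definition data x : R := `|h x| + \sum_j `|Th j x| `^ p + \sum_j `|f j x| `^ (p / (p - 1)).

Lemma data_ge0 x : 0 <= data x.
Proof. by rewrite !addr_ge0// sumr_ge0// => j _; exact: powR_ge0. Qed.

Lemma measurable_powR_sum (F : 'I_n -> T -> R) (r : R) : (forall j, measurable_fun O (F j)) ->
  measurable_fun O (fun x => \sum_j `|F j x| `^ r).
Proof. by move=> mF; apply: measurable_sum => j; exact: measurable_powR_norm. Qed.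

Lemma measurable_data : measurable_fun O data.
Proof.
apply: measurable_funD; last by apply: measurable_powR_sum => j; have [] := fL j.
apply: measurable_funD; last by apply: measurable_powR_sum => j; have [] := ThL j.
by apply: measurableT_comp => //; have [] := hL.
Qed.

Lemma data_integrable : I (fun x => data x `^ (q / p)).
Proof.
have qp0 : 0 < q / p by rewrite divr_gt0// (lt_trans p0).
have sum_ok (F : 'I_n -> T -> R) (r s : R) : r * (q / p) = s -> (forall j, lp_fun s (F j)) ->
    I (fun x => (\sum_j `|F j x| `^ r) `^ (q / p)).
  move=> rs lF; apply: (integrable_powR_sum mO) => // j.
  - by apply: measurable_powR_norm; have [] := lF j.
  - rewrite (_ : (fun x => _) = fun x => `|F j x| `^ s); first by have [] := lF j.
    by apply/funext => x; rewrite -powRrM rs.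
have mh : measurable_fun O (fun x => `|h x|).
  by apply: measurableT_comp => //; have [] := hL.
have mT : measurable_fun O (fun x => \sum_j `|Th j x| `^ p).
  by apply: measurable_powR_sum => j; have [] := ThL j.
have mf : measurable_fun O (fun x => \sum_j `|f j x| `^ (p / (p - 1))).
  by apply: measurable_powR_sum => j; have [] := fL j.
have s0 (F : 'I_n -> T -> R) (r : R) x : 0 <= \sum_j `|F j x| `^ r.
  by apply: sumr_ge0 => j _; exact: powR_ge0.
apply: (integrable_powR_add mO) => //; first exact: ltW.
- exact: measurable_funD.
- by move=> x; rewrite addr_ge0.
- apply: (integrable_powR_add mO) => //; first exact: ltW.
    by have [] := hL.
  by apply: (sum_ok _ _ q) => //; rewrite mulrCA mulfV ?mulr1// gt_eqF.
- apply: (sum_ok _ _ (q / (p - 1))) => //.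
  by rewrite mulrACA [X in X * _]mulrC -mulrACA mulrC mulrA mulfV ?mul1r// gt_eqF.
Qed.

Let qp1 : 1 <= q / p. Proof. by rewrite ler_pdivlMr// mul1r ltW. Qed.

Lemma lp_fun_data : lp_fun (q / p) data.
Proof.
split; first exact: measurable_data.
rewrite (_ : (fun x => _) = fun x => data x `^ (q / p)); first exact: data_integrable.
by apply/funext => x; rewrite ger0_norm// data_ge0.
Qed.

Lemma f_conj_integrable i : I (fun x => `|f i x| `^ (p / (p - 1))).
Proof.
apply: (lp_fun_mono _ _ (fL i)).2; first by rewrite divr_ge0 ?ltW.
by rewrite ler_pM2r ?invr_gt0// ltW.
Qed.

Definition flux x : R := \sum_i a i x (\row_j U j x) * G i x.
Definition force x : R := \sum_i f i x * G i x.

Lemma integrable_force : I force.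
Proof.
apply: (integrable_bigsum mO) => i.
apply: (integrable_mul_conj mO p1 ler01 (fL i).1 (GL i).1 (f_conj_integrable i)).
- by move=> x; exact: powR_ge0.
- by apply: nearW => x _; rewrite [leRHS]mul1r -powRrM conjE powRr1.
- exact: (GL i).2.
Qed.

Lemma integrable_flux : I flux.
Proof.
apply: (integrable_bigsum mO) => i.
have UL j : lp_fun p (U j).
  apply: (lp_fun_ae (F := fun x => Th j x + G j x)).
    by apply: filterS UE => x h' Ox; rewrite h'.
  by apply: lp_fun_add; [exact: ltW|apply: lp_fun_mono (ThL j); exact: ltW|].
apply: (integrable_mul_conj mO (X := fun x => `|h x| + \sum_j `|U j x| `^ p) p1 (ltW c10)).
- by apply: (caratheodory_measurable cmu mO).
- exact: (GL i).1.
- apply: (integrable_add mO).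
    exact: (integrable_norm (lp_fun_integrable qp1 hL)).
  by apply: (integrable_bigsum mO) => j; exact: (UL j).2.
- by move=> x; rewrite addr_ge0// sumr_ge0// => j _; exact: powR_ge0.
- apply: filterS2 h0 a_growth => x hx ax Ox.
  have E : \sum_(j < n) `|(\row_j U j x) ord0 j| `^ p = \sum_j `|U j x| `^ p.
    by apply: eq_bigr => j _; rewrite mxE.
  by rewrite (ger0_norm (hx Ox)) -E; exact: (ax Ox).
- exact: (GL i).2.
Qed.

(** Monotonicity at z = U and z' = Th bounds nu |G|^p by the flux minus the sum of
the a_i(Th) G_i. The remaining terms (f_i - a_i(Th)) G_i are at most
(c1 + 1) data^(1 - 1/p) |G_i|, and [young_absorb] turns them into half of the
left-hand side plus a multiple of the data. *)
Lemma ellipticity : exists2 C : R, 0 < C & \forall x \ae mu, O x ->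
  nu / 2 * \sum_i `|G i x| `^ p <= flux x - force x + C * data x.
Proof.
have nu2 : 0 < nu / 2 by rewrite divr_gt0.
have K0 : 0 < c1 + 1 by rewrite addr_gt0.
have [C C0 HC] := young_absorb p1 K0 nu2.
exists (n%:R * C + 1); first by rewrite ltr_wpDl// mulr_ge0// ltW.
have Fn : Filter (nbhs (almost_everywhere mu)) by exact: ae_filter_ringOfSetsType.
near=> x => Ox.
have hx : 0 <= h x by move: Ox; near: x.
have Ux : forall i, U i x = Th i x + G i x by move: Ox; near: x.
have ax : forall (z : 'rV[R]_n) (i : 'I_n),
  `|a i x z| <= c1 * (h x + \sum_(j < n) `|z ord0 j| `^ p) `^ (1 - 1 / p).
  by move: Ox; near: x.
have mx : forall z z' : 'rV[R]_n,
  nu * \sum_(i < n) `|z ord0 i - z' ord0 i| `^ p <=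
  \sum_(i < n) (a i x z - a i x z') * (z ord0 i - z' ord0 i).
  by move: Ox; near: x.
pose z := \row_j U j x; pose z' := \row_j Th j x.
have zz i : z ord0 i - z' ord0 i = G i x by rewrite !mxE Ux addrC addKr.
have := mx z z'; under eq_bigr do rewrite zz; under [X in _ <= X]eq_bigr do rewrite zz.
set Y := \sum_(i < n) _ => mY.
have sT : 0 <= \sum_j `|Th j x| `^ p by apply: sumr_ge0 => j _; exact: powR_ge0.
have sf : 0 <= \sum_j `|f j x| `^ (p / (p - 1)) by apply: sumr_ge0 => j _; exact: powR_ge0.
have aTh i : `|a i x z'| <= c1 * data x `^ (1 - 1 / p).
  have E : \sum_(j < n) `|z' ord0 j| `^ p = \sum_j `|Th j x| `^ p.
    by apply: eq_bigr => j _; rewrite mxE.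
  have := ax z' i; rewrite E => /le_trans; apply; apply: (ler_wpM2l (ltW c10)).
  apply: (ge0_ler_powR (ltW e0)); rewrite ?nnegrE; [exact: addr_ge0|exact: data_ge0|].
  by rewrite /data (ger0_norm hx) lerDl.
have fx i : `|f i x| <= data x `^ (1 - 1 / p).
  have -> : `|f i x| = (`|f i x| `^ (p / (p - 1))) `^ (1 - 1 / p).
    by rewrite -powRrM conjE powRr1.
  rewrite ge0_ler_powR ?nnegrE ?(ltW e0) ?powR_ge0 ?data_ge0//.
  apply: (@le_trans _ _ (\sum_j `|f j x| `^ (p / (p - 1)))); last by rewrite /data lerDr addr_ge0.
  by rewrite (bigD1 i)//= lerDl; apply: sumr_ge0 => j _; exact: powR_ge0.
have key i : (f i x - a i x z') * G i x <= nu / 2 * `|G i x| `^ p + C * data x.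
  have := HC (data x) `|G i x| (data_ge0 x) (normr_ge0 _).
  apply: le_trans; apply: (le_trans (ler_norm _)); rewrite normrM ler_wpM2r//.
  apply: (le_trans (ler_normB _ _)); rewrite mulrDl (mul1r (data x `^ (1 - 1 / p))) addrC.
  exact: (lerD (aTh i) (fx i)).
have S1 : \sum_(i < n) (f i x - a i x z') * G i x <=
    \sum_(i < n) (nu / 2 * `|G i x| `^ p + C * data x).
  by apply: ler_sum => i _; exact: key.
move: S1; rewrite big_split/= -mulr_sumr -/Y sumr_const card_ord.
have -> : \sum_(i < n) (f i x - a i x z') * G i x = force x - \sum_(i < n) a i x z' * G i x.
  by rewrite /force -sumrB; apply: eq_bigr => i _; rewrite mulrBl.
have mY' : nu * Y <= flux x - \sum_(i < n) a i x z' * G i x.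
  by apply: (le_trans mY); rewrite /flux -sumrB; apply: ler_sum => i _; rewrite mulrBl.
have d0 := data_ge0 x.
rewrite -mulr_natl; move: mY' d0; lra.
Unshelve. all: by end_near. Qed.

Lemma obstacle_energy_estimate : exists2 C : R, 0 < C & forall om (m : R), 0 < m ->
  I om -> (forall x, O x -> 0 <= om x <= 1) -> \int[mu]_(x in O) om x <= m ->
  \int[mu]_(x in O) (om x * flux x) <= \int[mu]_(x in O) (om x * force x) ->
  \int[mu]_(x in O) (om x * \sum_i `|G i x|) <= C * m `^ (1 - 1 / q).
Proof.
have [C1 C10 HC] := ellipticity.
have nu2 : 0 < nu / 2 by rewrite divr_gt0.
pose J := \int[mu]_(x in O) (data x `^ (q / p)).
have J0 : 0 <= J by apply: Rintegral_ge0 => x _; exact: powR_ge0.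
(* n.+1 instead of n keeps the constant positive in dimension 0. *)
exists (n.+1%:R * (1 + C1 / (nu / 2) * (1 + J))).
  by rewrite mulr_gt0// ltr_wpDr// mulr_ge0 ?addr_ge0// divr_ge0 ?ltW.
move=> om m m0 iom om1 hm hP.
apply: (energy_estimate cmu mO p1 pq nu2 (ltW C10) (ler0n _ n.+1) m0 _ _ _
  integrable_flux integrable_force data_integrable _ data_ge0 HC _ (lexx J) iom om1 hm hP).
- by apply: (integrable_bigsum mO) => i; exact: (GL i).2.
- exact: (lp_fun_integrable qp1 lp_fun_data).
- by apply: (integrable_bigsum mO) => i; exact: (integrable_norm (lp_fun_integrable (ltW p1) (GL i))).
- by move=> x; apply: sumr_ge0 => i _; exact: powR_ge0.
- move=> x s s0; rewrite -natr1 mulrDl mul1r.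
  have Y0 : 0 <= \sum_i `|G i x| `^ p by apply: sumr_ge0 => i _; exact: powR_ge0.
  apply: (@le_trans _ _ (n%:R * (s + s `^ (1 - p) * \sum_i `|G i x| `^ p))); last first.
    by rewrite lerDl addr_ge0 ?(ltW s0)// mulr_ge0// powR_ge0.
  rewrite mulr_natl -[X in _ *+ X]card_ord -sumr_const; apply: ler_sum => i _.
  apply: (le_trans (le_young (normr_ge0 _) s0 (ltW p1))).
  rewrite lerD2l ler_wpM2l ?powR_ge0// (bigD1 i)//= lerDl.
  by apply: sumr_ge0 => j _; exact: powR_ge0.
Qed.

End structure.
End obstacle_energy.

(** * Decay of the level sets *)

Section level_sets.
Context d (T : measurableType d) (R : realType) (mu : {measure set T -> \bar R}).
Variables (O : set T) (mO : measurable O).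
Hypothesis Ofin : (mu O < +oo)%E.
Local Notation I f := (mu.-integrable O (EFin \o f)).

Lemma measurable_oppD1 (F : T -> R) : measurable_fun O F ->
  measurable_fun O (fun x => 1 - F x).
Proof. by move=> mF; apply: measurable_funB. Qed.

Definition level (v : T -> R) (s : R) : R := fine (mu (O `&` [set x | s < `|v x|])).

Lemma levelE v s : measurable_fun O v ->
  (level v s)%:E = mu (O `&` [set x | s < `|v x|]).
Proof.
move=> mv; rewrite fineK// ge0_fin_numE//; apply: le_lt_trans Ofin.
by apply: le_measure; rewrite ?inE//; exact: measurable_gt_set.
Qed.

Lemma level_itv v s : measurable_fun O v -> 0 <= level v s <= fine (mu O).
Proof.
move=> mv; rewrite fine_ge0//= fine_le ?ge0_fin_numE//.
- by rewrite -levelE// ltry.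
- by apply: le_measure; rewrite ?inE//; exact: measurable_gt_set.
Qed.

Lemma Rintegral_le_level (om v : T -> R) (s e : R) : measurable_fun O v -> I om -> 0 <= e ->
  (forall x, O x -> 0 <= om x <= 1) -> (forall x, O x -> `|v x| <= s -> om x <= e) ->
  \int[mu]_(x in O) om x <= level v s + e * fine (mu O).
Proof.
move=> mv iom e0 om1 ome.
pose A := O `&` [set x | s < `|v x|].
have mA : measurable A by exact: measurable_gt_set.
have iA : I \1_A.
  apply: (measurable_bounded_integrable mO Ofin) => //.
  exists 1; split; first exact: num_real.
  by move=> y y1 x _ /=; rewrite indicE (le_trans _ (ltW y1))//; case: (x \in A); rewrite ?normr1 ?normr0.
have ie : I (fun=> e).
  apply: (measurable_bounded_integrable mO Ofin) => //.
  exists `|e|; split; first exact: num_real.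
  by move=> y y1 x _; exact: ltW.
apply: (@le_trans _ _ (\int[mu]_(x in O) (\1_A x + e))).
  apply: le_Rintegral => //; first exact: (integrable_add mO iA ie).
  move=> x Ox; have /andP[w0 w1] := om1 _ Ox; rewrite indicE.
  have [h|h] := leP `|v x| s.
    by rewrite (le_trans (ome _ Ox h))// lerDr.
  by rewrite mem_set ?lerDl//= (le_trans w1)// lerDl.
rewrite RintegralD// Rintegral_cst// lerD2r /Rintegral integral_indic// /level.
by rewrite /A setIAC setIid.
Qed.

End level_sets.

Section weak_decay.
Variables (R : realType) (n : nat).
Local Notation V := 'rV[R]_n.+2.
Notation mu := (lebesgue_rV R n.+2).
Variable O : set V.
Hypothesis oO : open O.
Hypothesis Ofin : (mu O < +oo)%E.
Let mO := open_lebesgue_measurable oO.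
Let cmu := @lebesgue_rV_complete R n.+2.

(** Truncate at level 2s. The weight 1 - H1(g) is at most e where |g| <= s, so that
its integral is at most lam(s) + e |O| <= m for the e chosen below; and
|g - H(g)| > 2s where |g| > 4s. [w011_sobolev] for g - H(g), with levels s < 2s
and masses l/2 < l = lam(4s), is the step required by [stampacchia]. *)
Lemma weak_decay (g : V -> R) (G : 'I_n.+2 -> V -> R) (q C : R) :
  w011 O g G -> 0 < C -> 0 < q < n.+2%:R ->
  (forall H H1 L m, @soft_cut R n.+2 H H1 L -> 0 < m ->
    \int[mu]_(x in O) (1 - H1 (g x)) <= m ->
    \int[mu]_(x in O) ((1 - H1 (g x)) * \sum_k `|G k x|) <= C * m `^ (1 - 1 / q)) ->
  exists2 B : R, 0 < B & forall s : R, 0 < s ->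
    level mu O g s <= B / s `^ (n.+2%:R * q / (n.+2%:R - q)).
Proof.
have tri (x y z w : R) : y <= 2 * x -> 4 * x < z -> z <= y + w -> 2 * x < w by lra.
have scal (c x y : R) : 2 * (c * x) / y * 2 = 4 * c * x / y by lra.
have shift (x y z w : R) : 0 < x -> y + x = z - w -> w + y <= z by lra.
move=> wg C0 qn HC.
have [ig iG] := w011_integrable wg.
have mg := integrable_measurable ig.
have M0 : 0 <= fine (mu O) by exact: fine_ge0.
have C4 : 0 < 4 * C by rewrite mulr_gt0.
apply: (@stampacchia R n.+1 (level mu O g) (fine (mu O)) (4 * C) q) => //.
  by move=> s _; exact: (level_itv mO Ofin s mg).
move=> s m s0 sm.
have /andP[ls0 _] := level_itv mO Ofin s mg.
have m0 : 0 < m by exact: le_lt_trans sm.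
have /andP[l0 _] := level_itv mO Ofin (4 * s) mg.
pose S := C * m `^ (1 - 1 / q).
have S0 : 0 < S by rewrite mulr_gt0// powR_gt0.
move: l0; rewrite le_eqVlt => /orP[/eqP <-|l0].
  by rewrite expr0n/= exprn_ge0// divr_ge0 ?(ltW s0)// mulr_ge0 ?powR_ge0// ltW.
set l := level mu O g (4 * s) in l0 *.
(* Then lam(s) + e |O| <= m. *)
pose e := (m - level mu O g s) / (fine (mu O) + 1).
have M1 : 0 < fine (mu O) + 1 by rewrite ltr_wpDl.
have e0 : 0 < e by rewrite divr_gt0// subr_gt0.
have s20 : 0 < 2 * s by rewrite mulr_gt0.
have [H [H1 [L [cutH HL He]]]] := @soft_cut_exists R n.+2 (2 * s) e s20 e0.
have Hle1 := soft_cut_le1 cutH.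
have Hge0 := soft_cut_ge0 cutH.
have om1 x : 0 <= 1 - H1 (g x) <= 1 by rewrite subr_ge0 Hle1 gerBl Hge0.
have mH1 : measurable_fun (O : set (rV_lebesgue R n.+2)) (fun x => 1 - H1 (g x)).
  have m1 : measurable_fun (O : set (rV_lebesgue R n.+2)) (H1 \o g).
    exact: (measurable_soft_cut_derive cutH mg).
  exact: (measurable_oppD1 m1).
have iom : mu.-integrable O (EFin \o (fun x => 1 - H1 (g x))).
  apply: (bounded_integrable oO Ofin (C := 1)) => // x _.
  by have /andP[h1 h2] := om1 x; rewrite ger0_norm.
have hm : \int[mu]_(x in O) (1 - H1 (g x)) <= m.
  apply: (@le_trans _ _ (level mu O g s + e * fine (mu O))).
    apply: (Rintegral_le_level mO Ofin mg iom (ltW e0)) => [x _|x _ gs]; first exact: om1.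
    by apply: He; rewrite mulrC mulKf.
  have : e * (fine (mu O) + 1) = m - level mu O g s by rewrite divfK// gt_eqF.
  by rewrite mulrDr mulr1 => /(shift _ _ _ _ e0).
have hS := HC H H1 L m cutH m0 hm.
have wz := w011_sub oO Ofin wg (w011_chain oO Ofin cutH wg).
have sumE : \sum_k \int[mu]_(x in O) `|G k x - H1 (g x) * G k x| =
    \int[mu]_(x in O) ((1 - H1 (g x)) * \sum_k `|G k x|).
  rewrite -(Rintegral_bigsum mO); last first.
    by move=> k; apply: integrable_normr; exact: (w011_integrable wz).2.
  apply: eq_Rintegral => x _; rewrite mulr_sumr; apply: eq_bigr => k _.
  have /andP[h1 _] := om1 x.
  by rewrite -[X in X - _]mul1r -mulrBl normrM (ger0_norm h1).
have S2 : \sum_k \int[mu]_(x in O) `|G k x - H1 (g x) * G k x| < 2 * S.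
  by rewrite sumE; apply: (le_lt_trans hS); rewrite ltr_pMl ?ltr1n.
have key : (l / 2) ^+ n.+1 <= (2 * S / s) ^+ n.+2.
  apply: (w011_sobolev oO Ofin wz S2 (tau := 2 * s) (m := l)).
  - by rewrite s0 /= ltr_pMl ?ltr1n.
  - by rewrite divr_ge0 ?(ltW l0)//= ltr_pdivrMr// ltr_pMr// ltr1n.
  - rewrite levelE//; apply: le_measure; rewrite ?inE.
    + exact: (measurable_gt_set mO (4 * s) mg).
    + exact: (measurable_gt_set mO (2 * s) (integrable_measurable (w011_integrable wz).1)).
    + move=> x [Ox /= gx]; split => //=.
      have h1 := HL (g x); have := ler_normD (H (g x)) (g x - H (g x)).
      by rewrite addrC subrK; exact: (tri _ _ _ _ h1 gx).
have -> : l = l / 2 * 2 by rewrite divfK.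
rewrite exprMn; apply: (@le_trans _ _ ((2 * S / s) ^+ n.+2 * 2 ^+ n.+2)).
  apply: ler_pM => //; first by rewrite exprn_ge0// divr_ge0// ltW.
  by apply: ler_weXn2l => //; rewrite ler1n.
rewrite -exprMn (_ : 2 * S / s * 2 = 4 * C * m `^ (1 - 1 / q) / s)// /S.
exact: scal.
Qed.

End weak_decay.

(** * The competitor, and the weak Lebesgue estimate *)

Lemma ae_forall_ord d (T : measurableType d) (R : realType)
    (mu : {measure set T -> \bar R}) (O : set T) n (P : 'I_n -> T -> Prop) :
  (forall k, \forall x \ae mu, O x -> P k x) ->
  \forall x \ae mu, O x -> forall k, P k x.
Proof.
move=> h; have F : Filter (nbhs (almost_everywhere mu)) by exact: ae_filter_ringOfSetsType.
by apply: filterS (filter_forall F h) => x hx Ox k; exact: hx.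
Qed.

Section obstacle.
Variables (R : realType) (n : nat).
Local Notation V := 'rV[R]_n.
Notation mu := (lebesgue_rV R n).
Variable O : set V.
Hypothesis oO : open O.
Hypothesis Ofin : (mu O < +oo)%E.
Let mO := open_lebesgue_measurable oO.
Let cmu := @lebesgue_rV_complete R n.
Local Notation I f := (mu.-integrable O (EFin \o f)).
Local Notation lp := (lp_fun mu O).

Variables (p : R) (psi : V -> \bar R) (theta w w' u : V -> R).
Hypothesis p1 : 1 < p.
Hypothesis theta_W : W1 O p theta.
Hypothesis w_W : W01 O p w.
Hypothesis w_star : \forall x \ae mu, O x ->
  theta_star psi theta x = ((theta x)%:E + (w x)%:E)%E.
Hypothesis w'_W : W01 O p w'.
Hypothesis w'_u : \forall x \ae mu, O x -> (u x)%:E = ((theta x)%:E + (w' x)%:E)%E.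
Hypothesis psi_u : \forall x \ae mu, O x -> (psi x <= (u x)%:E)%E.

Let p0 : 0 <= p. Proof. exact: (ltW (lt_trans ltr01 p1)). Qed.

(** The difference between u = theta + w' and Theta = theta + w. *)
Definition gap x : R := w' x - w x.
Definition gap_grad (k : 'I_n) x : R := wD O k w' x - wD O k w x.
Definition star_grad (k : 'I_n) x : R := wD O k theta x + wD O k w x.

Lemma lp_wD v k : W1 O p v -> lp p (wD O k v).
Proof. by move=> [_ h]; exact: ((LpP oO _ (ltW p1)).1 (h k)). Qed.

Lemma lp_wD0 v k : W01 O p v -> lp p (wD O k v).
Proof. by move=> [_ h]; exact: ((LpP oO _ (ltW p1)).1 (h k)). Qed.

Lemma w011_gap : w011 O gap gap_grad.
Proof.
have [h1 _] := w'_W; have [h2 _] := w_W.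
exact: (w011_sub oO Ofin (W011_w011 oO Ofin h1) (W011_w011 oO Ofin h2)).
Qed.

Lemma lp_gap_grad k : lp p (gap_grad k).
Proof. by apply: (lp_fun_sub mO p0); apply: lp_wD0. Qed.

Lemma wD_solution : \forall x \ae mu, O x ->
  forall k, wD O k u x = star_grad k x + gap_grad k x.
Proof.
have h k : \forall x \ae mu, O x -> wD O k u x = wD O k theta x + wD O k w' x.
  apply: (wder_wD oO).
  have [h1 _] := theta_W; have [h2 _] := w'_W.
  have ww := w011_wder (W011_w011 oO Ofin h2) k.
  have e2 : \forall x \ae mu, O x -> wD O k theta x + wD O k w' x = wD O k theta x + wD O k w' x.
    exact: nearW.
  apply: (wder_ae oO _ e2 (wder_add oO (W11_wder oO k h1) ww)).
  by apply: filterS w'_u => x hx Ox; have [->] := hx Ox.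
have := ae_forall_ord h.
apply: filterS => x hx Ox k; rewrite (hx Ox k) /star_grad /gap_grad.
by rewrite addrACA -addrA addrC; lra.
Qed.

(** H(g) >= min(0, g) for the gap g, so that the competitor is at least
min(Theta, u); w + H(g) belongs to W_0^{1,1} by [w011_chain]. *)
Lemma competitor H H1 L : @soft_cut R n H H1 L ->
  obstacle_class O p psi theta (fun x => theta x + (w x + H (gap x))) /\
  \forall x \ae mu, O x -> forall k,
    wD O k (fun x => theta x + (w x + H (gap x))) x =
    star_grad k x + H1 (gap x) * gap_grad k x.
Proof.
move=> cutH; set v := fun x => _.
have [th1 th2] := theta_W; have [w1 w2] := w_W.
pose W x := w x + H (gap x).
pose dW k x := wD O k w x + H1 (gap x) * gap_grad k x.
have wW : w011 O W dW.
  exact: (w011_add oO Ofin (W011_w011 oO Ofin w1) (w011_chain oO Ofin cutH w011_gap)).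
have lW k : lp p (dW k).
  apply: (lp_fun_add mO p0); first exact: lp_wD0.
  apply: (lp_fun_contract mO p0 (lp_gap_grad k)) => [|x]; last exact: (soft_cut_norm_le cutH).
  exact: (measurable_soft_cut_derive cutH (integrable_measurable (w011_integrable w011_gap).1)).
pose dv k x := wD O k theta x + dW k x.
have dvP k : wder O k v (dv k).
  exact: (wder_add oO (W11_wder oO k th1) (w011_wder wW k)).
have dvE k := wder_wD oO (dvP k).
have dWE k := wder_wD oO (w011_wder wW k).
have sym (F F' : V -> R) : (\forall x \ae mu, O x -> F x = F' x) ->
    \forall x \ae mu, O x -> F' x = F x.
  by apply: filterS => x hx Ox; rewrite hx.
split; last first.
  have := ae_forall_ord dvE.
  by apply: filterS => x hx Ox k; rewrite (hx Ox k) /dv /dW /star_grad addrA.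
split.
- split.
    apply: (wder_W11 oO (g := dv)) => [|k]; last exact: dvP.
    have [iv _] := w011_integrable wW.
    exact: (integrable_add mO ((Lp1P oO _).1 th1.1) iv).
  move=> k; apply/(LpP oO _ (ltW p1)).
  apply: (lp_fun_ae cmu mO (sym _ _ (dvE k))).
  by apply: (lp_fun_add mO p0) => //; exact: lp_wD.
- apply: filterS3 w_star w'_u psi_u => x h1 h2 h3 Ox.
  have {}h1 := h1 Ox; have [h2'] := h2 Ox; have {}h3 := h3 Ox.
  have h4 : (psi x <= (theta x + w x)%:E)%E.
    by rewrite EFinD -h1 /theta_star le_max lexx.
  have := soft_cut_min cutH (gap x); rewrite ge_min => /orP[h5|h5].
    by apply: (le_trans h4); rewrite lee_fin /v addrA lerDl.
  apply: (le_trans h3); rewrite lee_fin h2' /v lerD2l.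
  by move: h5; rewrite /gap lerBlDl.
- exists W; last by apply: nearW => x _; rewrite /v EFinD.
  split; first exact: (w011_W011 oO Ofin wW).
  move=> k; apply/(LpP oO _ (ltW p1)).
  exact: (lp_fun_ae cmu mO (sym _ _ (dWE k)) (lW k)).
Qed.

Variables (a : 'I_n -> V -> V -> R) (f : 'I_n -> V -> R).
Hypothesis u_sol : obstacle_solution O p psi theta a f u.
Let flx := flux a (fun k => wD O k u) gap_grad.
Let frc := force f gap_grad.
Hypothesis iflux : I flx.
Hypothesis iforce : I frc.

(** The gradient of the competitor minus that of u is -(1 - H1(g)) Dg almost
everywhere. *)
Lemma truncated_inequality H H1 L : @soft_cut R n H H1 L ->
  \int[mu]_(x in O) ((1 - H1 (gap x)) * flx x) <=
  \int[mu]_(x in O) ((1 - H1 (gap x)) * frc x).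
Proof.
move=> cutH; have [vK dv] := competitor cutH.
set v := (fun x => _) in vK dv.
have := u_sol.2 v vK.
have mg := integrable_measurable (w011_integrable w011_gap).1.
have om1 x : O x -> 0 <= 1 - H1 (gap x) <= 1.
  by rewrite subr_ge0 (soft_cut_le1 cutH) gerBl (soft_cut_ge0 cutH).
have mom : measurable_fun (O : set (rV_lebesgue R n)) (fun x => 1 - H1 (gap x)).
  exact: (measurable_oppD1 (measurable_soft_cut_derive cutH mg)).
have dE : \forall x \ae mu, O x -> forall k, wD O k v x - wD O k u x =
    - ((1 - H1 (gap x)) * gap_grad k x).
  apply: filterS2 dv wD_solution => x h1 h2 Ox k.
  by rewrite (h1 Ox) (h2 Ox); lra.
have E (c : 'I_n -> V -> R) : I (fun x => \sum_i c i x * gap_grad i x) ->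
    \int[mu]_(x in O) (\sum_i c i x * (wD O i v x - wD O i u x)) =
    - \int[mu]_(x in O) ((1 - H1 (gap x)) * \sum_i c i x * gap_grad i x).
  move=> ic; have iw := integrable_weight mO ic mom om1.
  rewrite -[RHS]mulN1r -RintegralZl//.
  have iw' := integrable_scale mO (-1) iw.
  have e : \forall x \ae mu, O x ->
      -1 * ((1 - H1 (gap x)) * \sum_i c i x * gap_grad i x) =
      \sum_i c i x * (wD O i v x - wD O i u x).
    apply: filterS dE => x hx Ox; rewrite mulrA mulr_sumr.
    by apply: eq_bigr => i _; rewrite (hx Ox); lra.
  symmetry; apply: (Rintegral_ae_eq mO iw' _ e).
  exact: (integrable_ae_eq cmu mO e iw').
have e1 := E (fun i x => a i x (\row_j wD O j u x)) iflux.
have e2 := E f iforce.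
by rewrite e1 e2 lerN2.
Qed.

End obstacle.

Section final.
Variables (R : realType) (n : nat).
Local Notation mu := (lebesgue_rV R n).

Lemma Lp_lp_fun (O : set 'rV[R]_n) (oO : open O) (r : R) v : 1 <= r -> Lp O r v -> lp_fun mu O r v.
Proof. by move=> r1 /(LpP oO _ r1). Qed.

Lemma Lp_wD_mono (O : set 'rV[R]_n) (oO : open O) (Ofin : (mu O < +oo)%E) (p q : R) v :
  1 <= p -> p <= q -> (forall k, Lp O q (wD O k v)) -> forall k, Lp O p (wD O k v).
Proof.
move=> p1 pq h k; apply/(LpP oO _ p1).
have mO := open_lebesgue_measurable oO.
apply: (lp_fun_mono mO Ofin (le_trans ler01 p1) pq).
exact: (Lp_lp_fun oO (le_trans p1 pq) (h k)).
Qed.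

End final.

Theorem corollary1p1 (R : realType) (n : nat) (n2 : (2 <= n)%N)
    (Omega : set 'rV[R]_n) (Omega_open : open Omega)
    (Omega_bounded : bounded_set Omega)
    (p q : R) (p1 : 1 < p) (pq : p < q) (qn : q < n%:R)
    (h : 'rV[R]_n -> R)
    (h0 : \forall x \ae lebesgue_rV R n, Omega x -> 0 <= h x)
    (hL : Lp Omega (q / p) h)
    (a : 'I_n -> 'rV[R]_n -> 'rV[R]_n -> R)
    (a_caratheodory : forall i, caratheodory_fun Omega (a i))
    (c1 nu : R) (c10 : 0 < c1) (nu0 : 0 < nu)
    (a_growth : \forall x \ae lebesgue_rV R n, Omega x ->
      forall (z : 'rV[R]_n) (i : 'I_n),
      `|a i x z| <=
      c1 * (h x + \sum_(j < n) `|z ord0 j| `^ p) `^ (1 - 1 / p))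
    (a_monotone : \forall x \ae lebesgue_rV R n, Omega x ->
      forall z z' : 'rV[R]_n,
      nu * \sum_(i < n) `|z ord0 i - z' ord0 i| `^ p <=
      \sum_(i < n) (a i x z - a i x z') * (z ord0 i - z' ord0 i))
    (theta : 'rV[R]_n -> R) (theta_W : W1 Omega q theta)
    (psi : 'rV[R]_n -> \bar R)
    (theta_star_W : translate Omega (EFin \o theta) (W01 Omega q)
      (theta_star psi theta))
    (f : 'I_n -> 'rV[R]_n -> R)
    (fL : forall i, Lp Omega (q / (p - 1)) (f i))
    (u : 'rV[R]_n -> R)
    (u_sol : obstacle_solution Omega p psi theta a f u) :
  translate Omega (theta_star psi theta)
    (Lweak Omega (n%:R * q / (n%:R - q)))
    (EFin \o u).
Proof.
case: n n2 Omega Omega_open Omega_bounded qn h h0 hL a a_caratheodory a_growth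
  a_monotone theta theta_W psi theta_star_W f fL u u_sol => [|[|n]]// _.
move=> O oO Ob qn h h0 hL a ca a_growth a_monotone theta theta_W psi [w w_W w_star].
move=> f fL u u_sol; set mu := lebesgue_rV R n.+2.
have Ofin : (mu O < +oo)%E.
  by apply: bounded_lebesgue_lty => //; exact: (open_lebesgue_measurable oO).
have mO := open_lebesgue_measurable oO.
have cmu := @lebesgue_rV_complete R n.+2.
have p0 : 0 < p by exact: lt_trans p1.
have q1 : 1 < q by exact: lt_trans pq.
have pm1 : 0 < p - 1 by rewrite subr_gt0.
have [u_W psi_u [w' w'_W w'_u]] := u_sol.1.
have theta_Wp : W1 O p theta.
  by split; [exact: theta_W.1|exact: (Lp_wD_mono oO Ofin (ltW p1) (ltW pq) theta_W.2)].
have w_Wp : W01 O p w.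
  by split; [exact: w_W.1|exact: (Lp_wD_mono oO Ofin (ltW p1) (ltW pq) w_W.2)].
pose g := gap w w'; pose G := gap_grad O w w'; pose Th := star_grad O theta w.
pose U k := wD O k u.
have wg : w011 O g G by exact: (w011_gap oO Ofin w_Wp w'_W).
have hL' : lp_fun mu O (q / p) h.
  by apply: (Lp_lp_fun oO) => //; rewrite ler_pdivlMr// mul1r ltW.
have fL' i : lp_fun mu O (q / (p - 1)) (f i).
  by apply: (Lp_lp_fun oO) => //; rewrite ler_pdivlMr// mul1r lerBlDr ler_wpDr// ltW.
have ThL i : lp_fun mu O q (Th i).
  apply: (lp_fun_add mO (ltW (lt_trans ltr01 q1))); apply: (Lp_lp_fun oO (ltW q1)).
    exact: theta_W.2.
  exact: w_W.2.
have GL i : lp_fun mu O p (G i) by exact: (lp_gap_grad oO p1 w_Wp w'_W).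
have UE : \forall x \ae mu, O x -> forall i, U i x = Th i x + G i x.
  exact: (wD_solution oO Ofin w theta_Wp w'_W w'_u).
have mU i : measurable_fun (O : set (rV_lebesgue R n.+2)) (U i).
  by have [] := Lp_lp_fun oO (ltW p1) (u_W.2 i).
have ma i z := (ca i).1 z.
have ca' i := (ca i).2.
have iP := integrable_flux cmu mO Ofin p1 pq c10 ma ca' h0 hL' a_growth ThL GL UE mU.
have iQ := integrable_force mO Ofin p1 pq fL' GL.
have [C C0 HC] := obstacle_energy_estimate cmu mO Ofin p1 pq c10 nu0 ma ca' h0 hL' a_growth a_monotone fL' ThL GL UE mU.
have [B B0 HB] : exists2 B : R, 0 < B & forall s : R, 0 < s ->
    level mu O g s <= B / s `^ (n.+2%:R * q / (n.+2%:R - q)).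
  apply: (weak_decay oO Ofin wg C0).
    by rewrite (lt_trans p0 pq) qn.
  move=> H H1 L m cutH m0 hm.
  have mg := integrable_measurable (w011_integrable wg).1.
  have om1 x : O x -> 0 <= 1 - H1 (g x) <= 1.
    by rewrite subr_ge0 (soft_cut_le1 cutH) gerBl (soft_cut_ge0 cutH).
  have iom : mu.-integrable O (EFin \o (fun x => 1 - H1 (g x))).
    apply: (bounded_integrable oO Ofin (C := 1)).
      exact: (measurable_oppD1 (measurable_soft_cut_derive cutH mg)).
    by move=> x /om1 /andP[h1 h2]; rewrite ger0_norm.
  apply: (HC _ m m0 iom om1 hm).
  exact: (truncated_inequality oO Ofin p1 theta_Wp w_Wp w_star w'_W w'_u psi_u u_sol iP iQ cutH).
have mg := integrable_measurable (w011_integrable wg).1.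
exists g.
  split; first exact: mg.
  exists B => // tau tau0.
  have -> : [set x | O x /\ tau < `|g x|] = O `&` [set x | tau < `|g x|] by [].
  by rewrite -(levelE mO Ofin tau mg) lee_fin; exact: HB.
apply: filterS2 w_star w'_u => x h1 h2 Ox.
rewrite (h1 Ox) (h2 Ox) /= -!EFinD; congr EFin.
by rewrite /g /gap -addrA [w x + _]addrC subrK.
Qed.
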